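(* Let $0<p\le q<\infty$, let $\psi\in\mathcal F^q(\mathbb C)$ be a nonzero function, and let $\varphi(z)=az+b$ with $a,b\in\mathbb C$ and $0<|a|\le1$. (a) The operator $W_{\psi,\varphi}:\mathcal F^p(\mathbb C)\to\mathcal F^q(\mathbb C)$ is bounded if and only if $m(\psi,\varphi)<\infty$. Moreover, $$m(\psi,\varphi)\le\|W_{\psi,\varphi}\|\le\left(\frac{q}{p|a|^2}\right)^{1/q}m(\psi,\varphi).$$ (b) The operator $W_{\psi,\varphi}:\mathcal F^p(\mathbb C)\to\mathcal F^q(\mathbb C)$ is compact if and only if $\lim_{|z|\to\infty}m_z(\psi,\varphi)=0$.
   Context: $dA$ is Lebesgue measure on $\mathbb C$. For $0<p<\infty$, the Fock space $\mathcal F^p(\mathbb C)$ is the set of entire functions $f$ with $\|f\|_p=\left(\frac{p}{2\pi}\int_{\mathbb C}|f(z)|^pe^{-\frac{p|z|^2}{2}}\,dA(z)\right)^{1/p}<\infty$ (a Banach space if $p\ge1$; a complete metric space with distance $\|f-g\|_p^p$ if $0<p<1$). For entire functions $\psi,\varphi$, the weighted composition operator is $W_{\psi,\varphi}f=\psi\cdot(f\circ\varphi)$. A linear operator $T:\mathcal F^p(\mathbb C)\to\mathcal F^q(\mathbb C)$ is bounded if it maps $\mathcal F^p(\mathbb C)$ into $\mathcal F^q(\mathbb C)$ and $\|T\|=\sup_{\|f\|_p\le1}\|Tf\|_q<\infty$; it is compact if it maps bounded sets to relatively compact sets. For $z\in\mathbb C$, $m_z(\psi,\varphi)=|\psi(z)|e^{\frac{|\varphi(z)|^2-|z|^2}{2}}$,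 and $m(\psi,\varphi)=\sup_{z\in\mathbb C}m_z(\psi,\varphi)$. *)

(* Defs.v *)
From HB Require Import structures.
From mathcomp Require Import all_boot all_order all_algebra.
From mathcomp Require Import all_classical all_reals all_analysis.
From mathcomp Require Import measurable_realfun complex ring lra.

Set Implicit Arguments.
Unset Strict Implicit.
Unset Printing Implicit Defensive.

Import Order.TTheory GRing.Theory Num.Theory.
Import numFieldNormedType.Exports.
Import ComplexField.Normc.

Local Open Scope classical_set_scope.
Local Open Scope ring_scope.
Local Open Scope complex_scope.

Section definitions.
Context {R : realType}.
Implicit Types (f g psi phi : R[i] -> R[i]) (p q : R) (z : R[i]).

(* The regular-algebra type [R[i]^o] carries the normed topology of [R[i]]. *)
Definition entire f := forall z : R[i], derivable (f : R[i]^o -> R[i]^o) z 1.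

(* [normc] is the real-valued modulus ([`|z|] lives in [R[i]]).  Lebesgue measure
   on the complex plane is the product Lebesgue measure under
   [(x, y) |-> x +i* y]. *)
Definition fock_integrand p f (v : measurableTypeR R * measurableTypeR R) : R :=
  let z := v.1 +i* v.2 in
  normc (f z) `^ p * expR (- (p * normc z ^+ 2 / 2)).

(* Defined for every [f]; the value is [+oo] when the integral diverges. *)
Definition fock_norm p f : \bar R :=
  (((p / (2 * pi))%:E *
    \int[lebesgue_measure \x lebesgue_measure]_v (fock_integrand p f v)%:E)
  `^ p^-1)%E.

Definition in_fock p f := entire f /\ (fock_norm p f < +oo)%E.

Definition wcomp psi phi f : R[i] -> R[i] := fun z => psi z * f (phi z).

Definition m_at psi phi z : R :=
  normc (psi z) * expR ((normc (phi z) ^+ 2 - normc z ^+ 2) / 2).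

Definition m_sup psi phi : \bar R := ereal_sup (range (EFin \o m_at psi phi)).

(* The filter of neighbourhoods of infinity, i.e. "as [|z|] tends to oo". *)
Definition complex_infty : set_system R[i] :=
  filter_from [set: R] (fun M => [set z | M < normc z]).

Definition op_norm p q (T : (R[i] -> R[i]) -> R[i] -> R[i]) : \bar R :=
  ereal_sup [set fock_norm q (T f) |
             f in [set f | in_fock p f /\ (fock_norm p f <= 1)%E]].

Definition bounded_op p q (T : (R[i] -> R[i]) -> R[i] -> R[i]) :=
  (forall f, in_fock p f -> in_fock q (T f)) /\ (op_norm p q T < +oo)%E.

End definitions.

Section measurability.
Context {R : realType}.
Local Notation RR := (measurableTypeR R * measurableTypeR R)%type.

Let box (k : (rat * rat) * (rat * rat)) : set (R * R) :=
  `]ratr k.1.1, ratr k.1.2[ `*` `]ratr k.2.1, ratr k.2.2[.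

Lemma box_cvg_measurable_fun (h : R * R -> R) :
  (forall v e, 0 < e -> exists2 d, 0 < d & forall w,
     `|w.1 - v.1| < d -> `|w.2 - v.2| < d -> `|h w - h v| < e) ->
  measurable_fun [set: RR] (h : RR -> R).
Proof.
move=> hc.
apply: (measurability _ (RGenOInfty.measurableE R)) => _ [_ [a ->] <-].
rewrite setTI.
pose I := [set k | box k `<=` h @^-1` `]a, +oo[].
rewrite (_ : _ @^-1` _ = \bigcup_(k in I) box k); last first.
  apply/seteqP; split => [v|v [k kI]]; last exact: kI.
  rewrite /= in_itv/= andbT => av.
  have av0 : 0 < h v - a by rewrite subr_gt0.
  have [d d0 dP] := hc v _ av0.
  have lr (x : R) : exists k : rat * rat,
      [/\ ratr k.1 < x, x < ratr k.2, x - d < ratr k.1 & ratr k.2 < x + d].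
    have xl : x - d < x by rewrite ltrBlDr ltrDl.
    have xr : x < x + d by rewrite ltrDl.
    have [r1] := rat_in_itvoo xl; rewrite in_itv/= => /andP[? ?].
    have [r2] := rat_in_itvoo xr; rewrite in_itv/= => /andP[? ?].
    by exists (r1, r2).
  have [k1 [k1a k1b k1l k1r]] := lr v.1; have [k2 [k2a k2b k2l k2r]] := lr v.2.
  have kU : box (k1, k2) `<=` h @^-1` `]a, +oo[.
    move=> w [/=]; rewrite !in_itv/= andbT => /andP[w1l w1r] /andP[w2l w2r].
    have /dP : `|w.1 - v.1| < d by rewrite ltr_norml; lra.
    have w2d : `|w.2 - v.2| < d by rewrite ltr_norml; lra.
    by move=> /(_ w2d); rewrite ltr_norml; lra.
  exists (k1, k2) => //; split; rewrite /= in_itv/=; lra.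
rewrite bigcup_mkcond; apply: countable_bigcupT_measurable => //= k.
by case: ifP => // _; apply: measurableX; exact: measurable_itv.
Qed.
End measurability.

Section fock_theory.
Context {R : realType}.
Implicit Types (f g : R[i] -> R[i]) (p : R).
Local Notation RR := (measurableTypeR R * measurableTypeR R)%type.
Local Notation mu := ((@lebesgue_measure R \x @lebesgue_measure R)%E).

Lemma normcE (z : R[i]) : `|z| = (normc z)%:C.
Proof. by case: z. Qed.

Lemma normc_ge0 (z : R[i]) : 0 <= normc z.
Proof. by case: z => x y; exact: sqrtr_ge0. Qed.

Lemma normc_leD (x y : R) : normc (x +i* y) <= `|x| + `|y|.
Proof.
rewrite /= -[leRHS]ger0_norm ?addr_ge0// -sqrtr_sqr ler_wsqrtr//.
by rewrite sqrrD !real_normK ?num_real// lerD2r lerDl mulrn_wge0// mulr_ge0.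
Qed.

Lemma ler_dist_normc (x y : R[i]) : `|normc x - normc y| <= normc (x - y).
Proof.
have := lerB_dist x y; have := lerB_dist y x.
rewrite distrC !normcE -!rmorphB/= !lecR => ? ?.
by rewrite ler_norml; lra.
Qed.

Lemma entire_continuous f : entire f -> forall v : R * R, forall e, 0 < e ->
  exists2 d, 0 < d & forall w : R * R, `|w.1 - v.1| < d -> `|w.2 - v.2| < d ->
  `|normc (f (w.1 +i* w.2)) - normc (f (v.1 +i* v.2))| < e.
Proof.
move=> ef [x y] e e0 /=.
have /derivable1_diffP/differentiable_continuous := ef (x +i* y).
have eC0 : 0 < e%:C by rewrite ltcR.
move=> /(@cvgrPdist_lt R[i] R[i]^o) /(_ _ eC0) /nbhs_ballP[[d d'] /=].
rewrite ltcE/= => /andP[/eqP -> d0] dP.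
exists (d / 2); first by rewrite divr_gt0.
move=> [x' y'] /= xx yy.
have /dP : ball (x +i* y : R[i]^o) (d +i* 0) (x' +i* y').
  rewrite /ball/= -[d +i* 0]/(d%:C) normcE ltcR.
  apply: le_lt_trans (normc_leD (x - x') (y - y')) _.
  rewrite distrC [X in _ + X]distrC; lra.
rewrite /= normcE ltcR; apply: le_lt_trans.
by rewrite distrC; exact: ler_dist_normc.
Qed.

Lemma entireB f g : entire f -> entire g -> entire (f \- g).
Proof. by move=> ef eg z; exact: (derivableB (ef z) (eg z)). Qed.

Lemma entireD f g : entire f -> entire g -> entire (f \+ g).
Proof. by move=> ef eg z; exact: (derivableD (ef z) (eg z)). Qed.

Lemma entire_id : entire (fun z : R[i] => z).
Proof. by move=> z; exact: derivable_id. Qed.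

Let wt (v : RR) : R := expR (- (normc (v.1 +i* v.2) ^+ 2 / 2)).
Let wabs f (v : RR) : R := normc (f (v.1 +i* v.2)) * wt v.

Let wabs_ge0 f v : 0 <= wabs f v.
Proof. by rewrite mulr_ge0 ?normc_ge0 ?expR_ge0. Qed.

Let integrandE p f v : fock_integrand p f v = wabs f v `^ p.
Proof.
by rewrite powRM ?normc_ge0 ?expR_ge0// -expRM; congr (_ * expR _); ring.
Qed.

Let measurable_wabs f : entire f -> measurable_fun [set: RR] (wabs f).
Proof.
move=> ef; apply: measurable_funM.
  exact: (box_cvg_measurable_fun (entire_continuous ef)).
have mn : measurable_fun [set: RR] (fun v : RR => normc (v.1 +i* v.2)).
  exact: (box_cvg_measurable_fun (entire_continuous entire_id)).
apply: measurableT_comp => //; apply: measurableT_comp => //.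
by apply: measurable_funM => //; exact: measurable_funX.
Qed.

Let measurable_wabs_powR p f : entire f ->
  measurable_fun [set: RR] (fun v => (wabs f v `^ p)%:E).
Proof.
move=> ef; apply/measurable_EFinP.
exact: (measurableT_comp (measurable_powR p) (measurable_wabs ef)).
Qed.

Let wabsD f g v : wabs (f \+ g) v <= wabs f v + wabs g v.
Proof. by rewrite -mulrDl ler_wpM2r ?expR_ge0// le_normcD. Qed.

Let wabsBC f g v : wabs (f \- g) v = wabs (g \- f) v.
Proof. by rewrite /wabs /= -normcN opprB. Qed.

Let cst_ge0 p : 0 < p -> 0 <= p / (2 * pi) :> R.
Proof. by move=> p0; rewrite divr_ge0 ?mulr_ge0 ?pi_ge0// ltW. Qed.

Let int_ge0 p f : (0 <= \int[mu]_v (wabs f v `^ p)%:E)%E.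
Proof. by apply: integral_ge0 => v _; rewrite lee_fin powR_ge0. Qed.

Let fock_normE p f : fock_norm p f =
  (((p / (2 * pi))%:E * \int[mu]_v (wabs f v `^ p)%:E) `^ p^-1)%E.
Proof.
by congr ((_ * _) `^ _)%E; apply: eq_integral => v _; rewrite integrandE.
Qed.

Lemma fock_norm_ge0 p f : (0 <= fock_norm p f)%E.
Proof. exact: poweR_ge0. Qed.

Lemma fock_normBC p f g : fock_norm p (f \- g) = fock_norm p (g \- f).
Proof.
rewrite !fock_normE.
by have -> : wabs (f \- g) = wabs (g \- f) by apply/funext => v; rewrite wabsBC.
Qed.

Let fock_norm_powE p f : 0 < p -> (fock_norm p f `^ p)%E =
  ((p / (2 * pi))%:E * \int[mu]_v (wabs f v `^ p)%:E)%E.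
Proof.
move=> p0; rewrite fock_normE -poweRrM mulVf ?gt_eqF// poweRe1//.
by rewrite mule_ge0// lee_fin cst_ge0.
Qed.

Let fock_norm_Lnorm p f : 0 < p -> fock_norm p f =
  (((p / (2 * pi)) `^ p^-1)%:E * Lnorm mu p%:E (EFin \o wabs f))%E.
Proof.
move=> p0; rewrite fock_normE poweRM ?lee_fin ?cst_ge0//.
rewrite unlock; under [in RHS]eq_integral => v _ do rewrite /= ger0_norm//.
by [].
Qed.

Lemma fock_normD p f g : 1 <= p -> entire f -> entire g ->
  (fock_norm p (f \+ g)%R <= fock_norm p f + fock_norm p g)%E.
Proof.
move=> p1 ef eg; have p0 : 0 < p by exact: lt_le_trans p1.
rewrite !fock_norm_Lnorm// -ge0_muleDr ?Lnorm_ge0//.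
rewrite lee_wpmul2l ?lee_fin ?powR_ge0//.
apply: le_trans (minkowski_EFin _ (measurable_wabs ef) (measurable_wabs eg) p1).
rewrite unlock; apply: gt0_ler_poweR; rewrite ?invr_ge0 ?(ltW p0)//.
- by rewrite in_itv/= leey integral_ge0// => v _; rewrite poweR_ge0.
- by rewrite in_itv/= leey integral_ge0// => v _; rewrite poweR_ge0.
apply: ge0_le_integral => //.
- by move=> v _; exact: poweR_ge0.
- under eq_fun do rewrite /= ger0_norm//.
  by apply: measurable_wabs_powR; exact: entireD.
- apply/measurable_EFinP.
  apply: (measurableT_comp (measurable_powR p)); apply: measurableT_comp => //.
  by apply: measurable_funD; exact: measurable_wabs.
move=> v _ /=; rewrite lee_fin; apply: ge0_ler_powR; rewrite ?nnegrE ?(ltW p0)//.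
by rewrite !ger0_norm ?addr_ge0// wabsD.
Qed.

Let powR_subadditive p (a b : R) : 0 < p -> p <= 1 -> 0 <= a -> 0 <= b ->
  (a + b) `^ p <= a `^ p + b `^ p.
Proof.
move=> p0 p1 a0 b0; have [->|an0] := eqVneq a 0.
  by rewrite add0r lerDr powR_ge0.
have [->|bn0] := eqVneq b 0; first by rewrite addr0 lerDl powR_ge0.
have {an0}a0 : 0 < a by rewrite lt_neqAle eq_sym an0.
have {bn0}b0 : 0 < b by rewrite lt_neqAle eq_sym bn0.
have s0 : 0 < a + b by rewrite addr_gt0.
have H c : 0 < c -> c <= a + b -> (a + b) `^ p * (c / (a + b)) <= c `^ p.
  move=> c0 cs; rewrite -[in leRHS](@divfK _ (a + b) _ c) ?gt_eqF//.
  rewrite powRM ?(ltW s0) ?divr_ge0 ?(ltW s0) ?(ltW c0)// [leRHS]mulrC.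
  rewrite ler_wpM2l ?powR_ge0// -[leLHS]powRr1 ?divr_ge0 ?(ltW s0) ?(ltW c0)//.
  by apply: ger_powR => //; rewrite divr_gt0//= ler_pdivrMr// mul1r.
have as_ : a <= a + b by rewrite lerDl ltW.
have bs : b <= a + b by rewrite lerDr ltW.
apply: le_trans (lerD (H a a0 as_) (H b b0 bs)).
by rewrite -mulrDr -mulrDl divff ?gt_eqF// mulr1.
Qed.

Lemma fock_norm_powD p f g : 0 < p -> p <= 1 -> entire f -> entire g ->
  (fock_norm p (f \+ g)%R `^ p <= fock_norm p f `^ p + fock_norm p g `^ p)%E.
Proof.
move=> p0 p1 ef eg; rewrite [X in (X <= _)%E]fock_norm_powE// [X in (_ <= X + _)%E]fock_norm_powE//
  [X in (_ <= _ + X)%E]fock_norm_powE////.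
rewrite -ge0_muleDr; [|exact: int_ge0..].
rewrite lee_wpmul2l ?lee_fin ?cst_ge0// -ge0_integralD//;
  try by [move=> v _; rewrite lee_fin powR_ge0 | exact: measurable_wabs_powR].
apply: ge0_le_integral => //.
- by move=> v _; rewrite lee_fin powR_ge0.
- by apply: measurable_wabs_powR; exact: entireD.
- by apply: emeasurable_funD; exact: measurable_wabs_powR.
move=> v _; rewrite -EFinD lee_fin; apply: le_trans (powR_subadditive _ _ _ _) => //.
by apply: ge0_ler_powR; rewrite ?nnegrE ?addr_ge0 ?wabsD// ltW.
Qed.

Lemma fock_norm_eq0 p f : 0 < p -> entire f -> fock_norm p f = 0 ->
  f = (fun=> 0).
Proof.
move=> p0 ef /eqP; rewrite fock_normE poweR_eq0; last first.
  by rewrite mule_ge0// lee_fin cst_ge0.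
have c0 : p / (2 * pi) != 0 :> R.
  by rewrite gt_eqF// divr_gt0// mulr_gt0// pi_gt0.
move=> /andP[+ _]; rewrite mule_eq0 eqe (negbTE c0)/= => /eqP I0.
have : ae_eq mu [set: RR] (fun v => (wabs f v `^ p)%:E) (cst 0).
  apply/ae_eq_integral_abs => //; first exact: measurable_wabs_powR.
  rewrite -[RHS]I0; apply: eq_integral => v _.
  by rewrite gee0_abs// lee_fin powR_ge0.
move=> [N [mN N0 NP]]; apply/funext => -[x y]; apply/eqP/negPn/negP => fz.
have fz0 : 0 < normc (f (x +i* y)).
  rewrite lt_neqAle normc_ge0 andbT eq_sym.
  by apply: contra fz => /eqP/eq0_normc ->.
have [d d0 dP] := entire_continuous ef (x, y) fz0.
pose B : set RR := `]x - d, x + d[ `*` `]y - d, y + d[.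
have BN : B `<=` N.
  move=> w [/=]; rewrite !in_itv/= => w1 w2; apply: NP => /=.
  move=> /(_ I) []; apply/eqP; rewrite powR_eq0 negb_and.
  rewrite gt_eqF// mulr_gt0 ?expR_gt0//.
  have /dP : `|w.1 - (x, y).1| < d by rewrite /= ltr_norml; lra.
  have w2d : `|w.2 - (x, y).2| < d by rewrite /= ltr_norml; lra.
  by move=> /(_ w2d); rewrite /= ltr_norml; lra.
have : (mu B <= mu N)%E.
  by apply: le_measure => //; rewrite inE//; exact: measurableX.
rewrite N0 leNgt => /negP; apply.
have pos (t : R) : (0 < @lebesgue_measure R `](t - d)%R, (t + d)%R[%classic)%E.
  have lt2 : t - d < t + d by lra.
  by rewrite lebesgue_measure_itv /= lte_fin lt2 -EFinB lte_fin subr_gt0.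
rewrite product_measure1E//; apply: mule_gt0; exact: pos.
Qed.

Lemma fock_norm0 p : 0 < p -> fock_norm p (fun _ : R[i] => 0) = 0.
Proof.
move=> p0; rewrite fock_normE integral0_eq ?mule0 ?poweR0r ?invr_eq0 ?gt_eqF//.
by move=> v _; rewrite /wabs normc0 mul0r powR0// gt_eqF.
Qed.

Lemma in_fockB p f g : 0 < p -> in_fock p f -> in_fock p g ->
  in_fock p (f \- g).
Proof.
move=> p0 [ef fp] [eg gp]; split; first exact: entireB.
pose zf : R[i] -> R[i] := fun=> 0.
have ezf : entire zf.
  by move=> z; exact: (@derivable_cst R[i] R[i]^o R[i]^o 0 z 1).
have -> : f \- g = f \+ (zf \- g) by apply/funext => z; rewrite /= sub0r.
have eNg : entire (zf \- g) := entireB ezf eg.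
have Ngp : (fock_norm p (zf \- g)%R < +oo)%E.
  rewrite (fock_normBC p zf g) (_ : (g \- zf)%R = g)//.
  by apply/funext => z /=; rewrite subr0.
have [p1|p1] := leP 1 p.
  exact: le_lt_trans (fock_normD p1 ef eNg) (lte_add_pinfty fp Ngp).
apply: (@lty_poweRy _ _ p); first by rewrite gt_eqF.
apply: le_lt_trans (fock_norm_powD p0 (ltW p1) ef eNg) _.
exact: lte_add_pinfty (poweR_lty _ fp) (poweR_lty _ Ngp).
Qed.

End fock_theory.

Section fock_space.
Context {R : realType}.

Record fock (p : {posnum R}) := Fock {
  fock_fun :> R[i] -> R[i] ;
  _ : in_fock p%:num fock_fun }.

Context (p : {posnum R}).
Implicit Types f g h : fock p.

Let p_gt0 : 0 < p%:num. Proof. by []. Qed.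

Lemma fockP f : in_fock p%:num f. Proof. by case: f. Qed.

Lemma fock_inj f g : fock_fun f = fock_fun g -> f = g.
Proof.
by case: f g => [f Pf] [g Pg] /= fg; subst g; rewrite (Prop_irrelevance Pf Pg).
Qed.

(* For [p < 1] the norm is only a quasi-norm; its [p]-th power is a distance. *)
Definition fock_dist f g : R :=
  let N := fine (fock_norm p%:num (f \- g)) in
  if 1 <= p%:num then N else N `^ p%:num.

Let NE f g :
  (fine (fock_norm p%:num (f \- g)))%:E = fock_norm p%:num (f \- g).
Proof.
rewrite fineK// ge0_fin_numE ?fock_norm_ge0//.
by have [] := in_fockB p_gt0 (fockP f) (fockP g).
Qed.

Lemma fock_distxx f : fock_dist f f = 0.
Proof.
rewrite /fock_dist (_ : _ \- _ = fun=> 0); last first.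
  by apply/funext => z /=; rewrite subrr.
by rewrite fock_norm0//=; case: ifP => // _; rewrite powR0// gt_eqF.
Qed.

Lemma fock_dist_positivity f g : fock_dist f g = 0 -> f = g.
Proof.
move=> d0; suff N0 : fock_norm p%:num (f \- g) = 0.
  have fg := fock_norm_eq0 p_gt0
    (entireB (fockP f).1 (fockP g).1) N0.
  apply: fock_inj; apply/funext => z; apply/eqP; rewrite -subr_eq0.
  by move/(congr1 (@^~ z)): fg => /= ->.
rewrite -NE; congr EFin; move: d0; rewrite /fock_dist; case: ifP => // _.
exact: powR_eq0_eq0.
Qed.

Lemma fock_dist_sym f g : fock_dist f g = fock_dist g f.
Proof. by rewrite /fock_dist fock_normBC. Qed.

Lemma fock_dist_triangle g f h :
  fock_dist f h <= fock_dist f g + fock_dist g h.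
Proof.
have fgh : f \- h = (f \- g) \+ (g \- h).
  by apply/funext => z /=; rewrite addrA subrK.
have eB u v : entire ((u : fock p) \- (v : fock p)).
  exact: entireB (fockP u).1 (fockP v).1.
rewrite /fock_dist; have [p1|p1] := leP 1 p%:num.
  rewrite -lee_fin EFinD [X in (X <= _)%E]NE [X in (_ <= X + _)%E]NE
    [X in (_ <= _ + X)%E]NE fgh.
  exact: fock_normD p1 (eB f g) (eB g h).
have PE (u v : fock p) : (fine (fock_norm p%:num (u \- v)) `^ p%:num)%:E =
    (fock_norm p%:num (u \- v)%R `^ p%:num)%E.
  by rewrite -NE.
rewrite -lee_fin EFinD [X in (X <= _)%E]PE [X in (_ <= X + _)%E]PE
  [X in (_ <= _ + X)%E]PE fgh.
exact: fock_norm_powD p_gt0 (ltW p1) (eB f g) (eB g h).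
Qed.

HB.instance Definition _ := gen_eqMixin (fock p).
HB.instance Definition _ := gen_choiceMixin (fock p).
HB.instance Definition _ := isMetric.Build R (fock p)
  fock_distxx fock_dist_positivity fock_dist_sym fock_dist_triangle.

End fock_space.

(* [precompact] refers to the topology of the metric [fock_dist] on [fock q];
   norm-bounded sets are the bounded sets of that metric for every [p]. *)
Definition compact_op {R : realType} (p q : {posnum R})
    (T : (R[i] -> R[i]) -> R[i] -> R[i]) :=
  (forall f, in_fock p%:num f -> in_fock q%:num (T f)) /\
  forall S : set (fock p),
    (exists M : R, forall f, S f -> (fock_norm p%:num f <= M%:E)%E) ->
    precompact [set g : fock q | exists2 f, S f & g = T f :> (R[i] -> R[i])].

(* Main.v *)
From HB Require Import structures.
Require Import Defs.
From mathcomp Require Import all_boot all_order all_algebra.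
From mathcomp Require Import all_classical all_reals all_analysis.
From mathcomp Require Import complex.
From mathcomp Require Import measurable_realfun ring lra.

Set Implicit Arguments.
Unset Strict Implicit.
Unset Printing Implicit Defensive.

Import Order.TTheory GRing.Theory Num.Theory.
Import numFieldNormedType.Exports.
Import ComplexField.Normc.

Local Open Scope classical_set_scope.
Local Open Scope ring_scope.
Local Open Scope complex_scope.

(** The operator [W f = psi * (f \o phi)] acts on the density
    [|f(z)| exp (-|z|^2/2)] by multiplication by [m_at psi phi] and composition
    with [phi], so everything reduces to two facts about entire functions.

    - The density of [f] is bounded pointwise by the norm of [f], with constant
      exactly [1] ([density_le_norm]).  By the isometric translations of the Fock
      space it is enough to prove this at the origin, where it says that [|f|^p]
      satisfies the sub-mean value inequality against a radial weight.  For a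
      polynomial this comes from averaging over rotations by [n]-th roots of unity
      ([submean_poly]): the arithmetic-geometric mean inequality reduces the mean
      to [prod_s |s^n - z^n|^(1/n)] over the roots [s], which in the limit is at
      least [prod_s |s|].  An entire function is a uniform limit of
      polynomials on every disc ([taylor_approx]).

    - Norm-bounded families of entire functions are normal
      ([ultra_normal_family]), by the Cauchy estimates.

    As an entire function is only assumed to be differentiable at every point,
    Taylor's formula with its estimates is obtained from Goursat's theorem for
    rectangles and Cauchy's formula on squares.

    The pointwise bound yields [density f ^ q <= N ^ (q - p) * density f ^ p] with
    [N] the norm of [f], hence the norm inequality between the Fock spaces, and
    the change of variables [w = phi z] gives the upper bound for the norm of [W].
    The lower bound tests [W] on the unit vector [fock_kernel (phi z)], whose
    density is [1] at [phi z].  The images of these vectors tend to [0] pointwise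
    at infinity while their norms dominate [m_at psi phi z]; so compactness forces
    [m_at] to vanish at infinity.  Conversely, if [m_at] vanishes at infinity,
    then the image of a ball is compact: along an ultrafilter the family converges
    locally uniformly to an element of the ball, by Montel's theorem and Fatou's
    lemma, and in [energy_wcomp_le] the part outside of a large disc is small. *)

(** * Complex differentiability in epsilon-delta form *)

Section holo.
Context {R : realType}.
Implicit Types (f g : R[i] -> R[i]) (z w h l : R[i]).

(** The norm of [R[i]] takes its values in [R[i]]; this form of the derivative only
    involves real inequalities. *)
Definition has_cderiv f z l := forall e : R, 0 < e -> exists2 d : R, 0 < d &
  forall h, normc h < d -> normc (f (z + h) - f z - l * h) <= e * normc h.

Lemma derivable_has_cderiv f z :
  derivable (f : R[i]^o -> R[i]^o) z 1 <-> exists l, has_cderiv f z l.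
Proof.
split.
  move=> /cvg_ex[/= l fl]; exists l => e e0.
  have eC0 : 0 < e%:C by rewrite ltcR.
  move: fl => /(@cvgrPdist_le R[i] R[i]^o) /(_ _ eC0).
  rewrite near_withinE => /nbhs_ballP[[d d'] /=].
  rewrite ltcE/= => /andP[/eqP -> d0] dP.
  exists d => // h hd; have [->|h0] := eqVneq h 0.
    by rewrite addr0 subrr mulr0 subr0 normc0 mulr0.
  have /dP : ball (0 : R[i]^o) (d +i* 0) (h : R[i]^o).
    by rewrite /ball/= sub0r normrN -[d +i* 0]/(d%:C) Defs.normcE ltcR.
  move=> /(_ h0) /=; rewrite Defs.normcE lecR => H.
  have hn0 : 0 < normc h.
    rewrite lt_neqAle normc_ge0 andbT eq_sym.
    by apply: contra h0 => /eqP/eq0_normc ->.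
  rewrite -ler_pdivrMr// -normcV -normcM mulrC mulrBr -normcN opprB.
  move: H; rewrite /GRing.scale /= mulr1 (addrC h).
  by rewrite mulrCA mulVf// mulr1.
case=> l fl; apply/cvg_ex; exists (l : R[i]^o).
apply/(@cvgrPdist_le R[i] R[i]^o) => -[e e'] /=.
rewrite ltcE/= => /andP[/eqP -> e0].
have [d d0 dP] := fl _ e0.
rewrite near_withinE; apply/nbhs_ballP; exists (d%:C); first by rewrite /= ltcE /= eqxx.
move=> h; rewrite /ball/= sub0r normrN Defs.normcE ltcR => hd h0.
rewrite -[e +i* 0]/(e%:C) Defs.normcE lecR.
have hn0 : 0 < normc h.
  rewrite lt_neqAle normc_ge0 andbT eq_sym.
  by apply: contra h0 => /eqP/eq0_normc ->.
have := dP _ hd.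
rewrite -ler_pdivrMr// -normcV -normcM mulrC mulrBr -normcN opprB.
rewrite /GRing.scale /= mulr1 (addrC h).
by rewrite mulrCA mulVf// mulr1.
Qed.

Lemma entireP f : entire f <-> forall z, exists l, has_cderiv f z l.
Proof.
by split=> H z; apply/derivable_has_cderiv; exact: H.
Qed.

End holo.

(** * Integrals of complex functions along segments *)

Section path_integral.
Context {R : realType}.
Implicit Types (f g : R[i] -> R[i]) (z w : R[i]) (h : R -> R[i]).
Local Notation mu := (@lebesgue_measure R).

Definition path_int h (a b : R) : R[i] :=
  (\int[mu]_(t in `[a, b]) complex.Re (h t)) +i*
  (\int[mu]_(t in `[a, b]) complex.Im (h t)).

Definition path_integrable h (a b : R) :=
  mu.-integrable `[a, b] (EFin \o (fun t => complex.Re (h t))) /\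
  mu.-integrable `[a, b] (EFin \o (fun t => complex.Im (h t))).

Lemma normr_Re_le z : `|complex.Re z| <= normc z.
Proof. by case: z => x y /=; rewrite -sqrtr_sqr ler_wsqrtr// lerDl sqr_ge0. Qed.

Lemma normr_Im_le z : `|complex.Im z| <= normc z.
Proof. by case: z => x y /=; rewrite -sqrtr_sqr ler_wsqrtr// lerDr sqr_ge0. Qed.

Lemma normcB z w : normc (z - w) = normc (w - z).
Proof. by rewrite -normcN opprB. Qed.

Lemma has_cderiv_continuous f z l : has_cderiv f z l ->
  forall e, 0 < e -> exists2 d, 0 < d &
    forall w, normc (w - z) < d -> normc (f w - f z) < e.
Proof.
move=> fl e e0; have [d d0 dP] := fl 1 ltr01.
have k0 : 0 < 1 + normc l by rewrite ltr_wpDr ?Defs.normc_ge0.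
exists (Num.min d (e / (1 + normc l))); first by rewrite lt_min d0 divr_gt0.
move=> w; rewrite lt_min => /andP[wd we].
have {dP}H := dP _ wd.
rewrite mul1r [z + _]addrC subrK in H.
have -> : f w - f z = (f w - f z - l * (w - z)) + l * (w - z) by rewrite subrK.
apply: le_lt_trans (le_normcD _ _) _; rewrite normcM.
apply: le_lt_trans (_ : (1 + normc l) * normc (w - z) < e).
  by rewrite mulrDl mul1r lerD2r.
by rewrite mulrC -ltr_pdivlMr.
Qed.

Lemma path_integrable_holo g (c : R -> R[i]) a b :
  (forall s t, normc (c s - c t) <= `|s - t|) ->
  (forall t, a <= t <= b -> exists l, has_cderiv g (c t) l) ->
  path_integrable (fun t => g (c t)) a b.
Proof.
move=> c1 gl.
have H (p : R[i] -> R) : (forall z, `|p z| <= normc z) ->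
    {morph p : x y / x - y} ->
    mu.-integrable `[a, b] (EFin \o (fun t => p (g (c t)))).
  move=> p1 pB; apply: continuous_compact_integrable.
    exact: segment_compact.
  apply: continuous_in_subspaceT => t /set_mem /=.
  rewrite in_itv /= => /gl[l /has_cderiv_continuous gt].
  apply/cvgrPdist_lt => e /gt[d d0 dP].
  apply/nbhs_ballP; exists d => //= s; rewrite /ball/= => ts.
  rewrite -pB; apply: le_lt_trans (p1 _) _; rewrite normcB.
  by apply: dP; apply: le_lt_trans (c1 _ _) _; rewrite distrC.
split; apply: H.
- exact: normr_Re_le.
- by move=> [? ?] [? ?].
- exact: normr_Im_le.
- by move=> [? ?] [? ?].
Qed.

Lemma path_integrableD h1 h2 a b : path_integrable h1 a b ->
  path_integrable h2 a b -> path_integrable (fun t => h1 t + h2 t) a b.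
Proof.
move=> [r1 i1] [r2 i2]; split.
  rewrite (_ : _ \o _ = (fun t => (complex.Re (h1 t))%:E + (complex.Re (h2 t))%:E)%E).
    exact: integrableD.
  by apply/funext => t /=; case: (h1 t) => ? ?; case: (h2 t).
rewrite (_ : _ \o _ = (fun t => (complex.Im (h1 t))%:E + (complex.Im (h2 t))%:E)%E).
  exact: integrableD.
by apply/funext => t /=; case: (h1 t) => ? ?; case: (h2 t).
Qed.

Lemma path_intD h1 h2 a b : path_integrable h1 a b -> path_integrable h2 a b ->
  path_int (fun t => h1 t + h2 t) a b = path_int h1 a b + path_int h2 a b.
Proof.
move=> [r1 i1] [r2 i2]; rewrite /path_int.
rewrite [RHS]/GRing.add/=; congr (_ +i* _).
  rewrite -RintegralD//; apply: eq_Rintegral => t _.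
  by case: (h1 t) => ? ?; case: (h2 t).
rewrite -RintegralD//; apply: eq_Rintegral => t _.
by case: (h1 t) => ? ?; case: (h2 t).
Qed.

Lemma path_integrableZ c h a b : path_integrable h a b ->
  path_integrable (fun t => c * h t) a b.
Proof.
case: c => x y [r i]; split.
  rewrite (_ : _ \o _ = (fun t => x%:E * (complex.Re (h t))%:E + (- y)%:E * (complex.Im (h t))%:E)%E).
    by apply: integrableD => //; apply: integrableZl.
  by apply/funext => t /=; case: (h t) => u v /=; congr EFin; ring.
rewrite (_ : _ \o _ = (fun t => x%:E * (complex.Im (h t))%:E + y%:E * (complex.Re (h t))%:E)%E).
  by apply: integrableD => //; apply: integrableZl.
by apply/funext => t /=; case: (h t) => ? ? /=.
Qed.

Lemma path_intZ c h a b : path_integrable h a b ->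
  path_int (fun t => c * h t) a b = c * path_int h a b.
Proof.
case: c => x y [r i]; rewrite /path_int.
have rI k : mu.-integrable `[a, b] (EFin \o (fun t => k * complex.Re (h t))).
  rewrite (_ : _ \o _ = (fun t => k%:E * (complex.Re (h t))%:E)%E)//.
  exact: integrableZl.
have iI k : mu.-integrable `[a, b] (EFin \o (fun t => k * complex.Im (h t))).
  rewrite (_ : _ \o _ = (fun t => k%:E * (complex.Im (h t))%:E)%E)//.
  exact: integrableZl.
rewrite [RHS]/GRing.mul/=; congr (_ +i* _).
  rewrite -RintegralZl// -RintegralZl// -RintegralB//.
  by apply: eq_Rintegral => t _; case: (h t).
rewrite -RintegralZl// -RintegralZl// -RintegralD//.
by apply: eq_Rintegral => t _; case: (h t).
Qed.

Lemma path_int_split h a b c : a <= b -> b <= c -> path_integrable h a c ->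
  path_int h a c = path_int h a b + path_int h b c.
Proof.
move=> ab bc [r i]; rewrite /path_int [RHS]/GRing.add/=.
have H (k : R -> R) : mu.-integrable `[a, c] (EFin \o k) ->
    \int[mu]_(t in `[a, c]) k t =
    \int[mu]_(t in `[a, b]) k t + \int[mu]_(t in `[b, c]) k t.
  move=> ik; apply/eqP; rewrite addrC -subr_eq; apply/eqP.
  rewrite Rintegral_itvB//.
  rewrite Rintegral_itv_obnd_cbnd//; apply: integrableS ik => //.
  by apply: subset_itvr; rewrite bnd_simp.
by congr (_ +i* _); exact: H.
Qed.

Lemma fine_lebesgue_itv (a b : R) : a <= b -> fine (mu `[a, b]) = b - a.
Proof.
move=> ab; rewrite lebesgue_measure_itv/= lte_fin; case: ltP => //= ba.
by apply/esym/eqP; rewrite subr_eq0 eq_le ba.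
Qed.

Lemma path_int_cst c a b : a <= b -> path_int (fun=> c) a b = c * (b - a)%:C.
Proof.
move=> ab; rewrite /path_int !Rintegral_cst//.
rewrite fine_lebesgue_itv//.
by case: c => x y; rewrite /GRing.mul /= !mulr0 subr0 add0r; congr (_ +i* _); rewrite addrC.
Qed.

Lemma normc_path_int_le h a b (K : R) : a <= b -> path_integrable h a b ->
  (forall t, a <= t <= b -> normc (h t) <= K) ->
  normc (path_int h a b) <= 2 * K * (b - a).
Proof.
move=> ab [r i] hK.
have H (k : R -> R) : mu.-integrable `[a, b] (EFin \o k) ->
    (forall t, a <= t <= b -> `|k t| <= K) ->
    `|\int[mu]_(t in `[a, b]) k t| <= K * (b - a).
  move=> ik kK; apply: le_trans (le_normr_Rintegral _ ik) _ => //.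
  have -> : K * (b - a) = \int[mu]_(t in `[a, b]) K.
    by rewrite Rintegral_cst// fine_lebesgue_itv.
  apply: le_Rintegral => //.
  - by have := integrable_norm ik.
  - apply: continuous_compact_integrable; first exact: segment_compact.
    by apply: continuous_subspaceT => x; exact: cvg_cst.
have -> : 2 * K * (b - a) = K * (b - a) + K * (b - a) by ring.
apply: le_trans (normc_leD _ _) _; apply: lerD; apply: H => // t tab.
  exact: le_trans (normr_Re_le _) (hK _ tab).
exact: le_trans (normr_Im_le _) (hK _ tab).
Qed.

End path_integral.

(** * Integrals along the boundary of a rectangle *)

Section rectangle_integral.
Context {R : realType}.
Implicit Types (f g : R[i] -> R[i]) (z w : R[i]).

(** The contour integral of [g], counterclockwise. *)
Definition rect_int g (x1 x2 y1 y2 : R) : R[i] :=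
  path_int (fun t => g (t +i* y1)) x1 x2 -
  path_int (fun t => g (t +i* y2)) x1 x2 +
  'i * (path_int (fun t => g (x2 +i* t)) y1 y2 -
        path_int (fun t => g (x1 +i* t)) y1 y2).

Definition edge_integrable g (x1 x2 y1 y2 : R) :=
  [/\ path_integrable (fun t => g (t +i* y1)) x1 x2,
      path_integrable (fun t => g (t +i* y2)) x1 x2,
      path_integrable (fun t => g (x1 +i* t)) y1 y2 &
      path_integrable (fun t => g (x2 +i* t)) y1 y2].

Definition rect (x1 x2 y1 y2 : R) : set R[i] :=
  [set z | x1 <= complex.Re z <= x2 /\ y1 <= complex.Im z <= y2].

Definition rect_edge (x1 x2 y1 y2 : R) : set R[i] :=
  rect x1 x2 y1 y2 `&` [set z | [\/ complex.Im z = y1, complex.Im z = y2,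
    complex.Re z = x1 | complex.Re z = x2]].

Definition holo_on (D : set R[i]) g := forall z, D z -> exists l, has_cderiv g z l.

Lemma holo_onS (A B : set R[i]) g : A `<=` B -> holo_on B g -> holo_on A g.
Proof. by move=> AB gB z /AB; exact: gB. Qed.

Lemma horizontal_dist (y s t : R) : normc ((s +i* y) - (t +i* y)) <= `|s - t|.
Proof.
rewrite [X in normc X](_ : _ = (s - t) +i* 0); last by congr (_ +i* _); rewrite subrr.
by apply: le_trans (normc_leD _ _) _; rewrite normr0 addr0.
Qed.

Lemma vertical_dist (x s t : R) : normc ((x +i* s) - (x +i* t)) <= `|s - t|.
Proof.
rewrite [X in normc X](_ : _ = 0 +i* (s - t)); last by congr (_ +i* _); rewrite subrr.
by apply: le_trans (normc_leD _ _) _; rewrite normr0 add0r.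
Qed.

Lemma holo_edge_integrable g x1 x2 y1 y2 : x1 <= x2 -> y1 <= y2 ->
  holo_on (rect_edge x1 x2 y1 y2) g -> edge_integrable g x1 x2 y1 y2.
Proof.
move=> x12 y12 gE; split; apply: path_integrable_holo => //;
  do ?[exact: horizontal_dist|exact: vertical_dist];
  move=> t /andP[t1 t2]; apply: gE; split => /=.
- by rewrite /rect /= t1 t2 lexx y12.
- exact: Or41.
- by rewrite /rect /= t1 t2 lexx y12.
- exact: Or42.
- by rewrite /rect /= t1 t2 lexx x12.
- exact: Or43.
- by rewrite /rect /= t1 t2 lexx x12.
- exact: Or44.
Qed.

Lemma rect_intD g1 g2 x1 x2 y1 y2 : edge_integrable g1 x1 x2 y1 y2 ->
  edge_integrable g2 x1 x2 y1 y2 ->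
  rect_int (fun z => g1 z + g2 z) x1 x2 y1 y2 =
  rect_int g1 x1 x2 y1 y2 + rect_int g2 x1 x2 y1 y2.
Proof.
move=> [a1 a2 a3 a4] [b1 b2 b3 b4]; rewrite /rect_int !path_intD//.
move: (path_int _ _ _) (path_int _ _ _) => p1 p2; ring.
Qed.

Lemma rect_intZ c g x1 x2 y1 y2 : edge_integrable g x1 x2 y1 y2 ->
  rect_int (fun z => c * g z) x1 x2 y1 y2 = c * rect_int g x1 x2 y1 y2.
Proof.
move=> [a1 a2 a3 a4]; rewrite /rect_int !path_intZ//.
move: (path_int _ _ _) => p1; ring.
Qed.

Lemma normc_i : normc ('i%C : R[i]) = 1.
Proof. by rewrite /= expr0n expr1n add0r sqrtr1. Qed.

Lemma normc_rect_int_le g x1 x2 y1 y2 (K : R) : x1 <= x2 -> y1 <= y2 ->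
  edge_integrable g x1 x2 y1 y2 ->
  (forall z, rect_edge x1 x2 y1 y2 z -> normc (g z) <= K) ->
  normc (rect_int g x1 x2 y1 y2) <= 4 * K * (x2 - x1 + (y2 - y1)).
Proof.
move=> x12 y12 [a1 a2 a3 a4] gK.
have h1 t y : y = y1 \/ y = y2 -> x1 <= t <= x2 -> normc (g (t +i* y)) <= K.
  move=> yE txy; apply: gK; split => /=.
    by rewrite /rect /= txy; case: yE => ->; rewrite lexx y12.
  by case: yE => ->; [exact: Or41|exact: Or42].
have h2 t x : x = x1 \/ x = x2 -> y1 <= t <= y2 -> normc (g (x +i* t)) <= K.
  move=> xE txy; apply: gK; split => /=.
    by rewrite /rect /= txy; case: xE => ->; rewrite lexx x12.
  by case: xE => ->; [exact: Or43|exact: Or44].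
have b1 := normc_path_int_le x12 a1 (fun t => h1 t y1 (or_introl erefl)).
have b2 := normc_path_int_le x12 a2 (fun t => h1 t y2 (or_intror erefl)).
have b3 := normc_path_int_le y12 a3 (fun t => h2 t x1 (or_introl erefl)).
have b4 := normc_path_int_le y12 a4 (fun t => h2 t x2 (or_intror erefl)).
rewrite /rect_int; apply: le_trans (le_normcD _ _) _.
rewrite normcM normc_i mul1r.
have := le_normcD (path_int (fun t : R => g (t +i* y1)) x1 x2)
   (- path_int (fun t : R => g (t +i* y2)) x1 x2).
have := le_normcD (path_int (fun t : R => g (x2 +i* t)) y1 y2)
   (- path_int (fun t : R => g (x1 +i* t)) y1 y2).
rewrite !normcN; move: b1 b2 b3 b4.
set n1 := normc (path_int _ _ _); set n2 := normc (path_int _ _ _).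
set n3 := normc (path_int _ _ _); set n4 := normc (path_int _ _ _).
set n5 := normc (_ - _); set n6 := normc (_ - _).
lra.
Qed.

(** The two integrals along the common vertical edge cancel. *)
Lemma rect_int_splitx g x1 x2 x3 y1 y2 : x1 <= x2 -> x2 <= x3 ->
  path_integrable (fun t => g (t +i* y1)) x1 x3 ->
  path_integrable (fun t => g (t +i* y2)) x1 x3 ->
  rect_int g x1 x3 y1 y2 = rect_int g x1 x2 y1 y2 + rect_int g x2 x3 y1 y2.
Proof.
move=> x12 x23 a1 a2; rewrite /rect_int.
rewrite (path_int_split x12 x23 a1) (path_int_split x12 x23 a2).
move: (path_int _ _ _) (path_int _ _ _) => p1 p2; ring.
Qed.

Lemma rect_int_splity g x1 x2 y1 y2 y3 : y1 <= y2 -> y2 <= y3 ->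
  path_integrable (fun t => g (x1 +i* t)) y1 y3 ->
  path_integrable (fun t => g (x2 +i* t)) y1 y3 ->
  rect_int g x1 x2 y1 y3 = rect_int g x1 x2 y1 y2 + rect_int g x1 x2 y2 y3.
Proof.
move=> y12 y23 a1 a2; rewrite /rect_int.
rewrite (path_int_split y12 y23 a1) (path_int_split y12 y23 a2).
move: (path_int _ _ _) (path_int _ _ _) => p1 p2; ring.
Qed.

Lemma has_cderiv_cst c z : has_cderiv (fun=> c) z 0.
Proof.
move=> e e0; exists 1 => // h _; rewrite subrr mul0r subrr normc0.
by rewrite mulr_ge0 ?Defs.normc_ge0// ltW.
Qed.

Lemma has_cderiv_id z : has_cderiv id z 1.
Proof.
move=> e e0; exists 1 => // h _; rewrite (_ : id (z + h) - id z - 1 * h = 0) ?normc0; last by rewrite /=; ring.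
by rewrite mulr_ge0 ?Defs.normc_ge0// ltW.
Qed.

Lemma rect_int_cst c x1 x2 y1 y2 : x1 <= x2 -> y1 <= y2 ->
  rect_int (fun=> c) x1 x2 y1 y2 = 0.
Proof. by move=> x12 y12; rewrite /rect_int !path_int_cst// !subrr mulr0 addr0. Qed.

Lemma rect_int_id x1 x2 y1 y2 : x1 <= x2 -> y1 <= y2 ->
  rect_int id x1 x2 y1 y2 = 0.
Proof.
move=> x12 y12.
have [a1 a2 a3 a4] : edge_integrable id x1 x2 y1 y2.
  by apply: holo_edge_integrable => // z _; exists 1; exact: has_cderiv_id.
rewrite /rect_int.
have subE h1 h2 (a b : R) c : path_integrable h1 a b -> path_integrable h2 a b ->
    a <= b -> (forall t, h1 t - h2 t = c) ->
    path_int h1 a b - path_int h2 a b = c * (b - a)%:C.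
  move=> i1 i2 ab h12; rewrite -path_int_cst//.
  rewrite -mulN1r -path_intZ// -path_intD//; last exact: path_integrableZ.
  by congr path_int; apply/funext => t; rewrite mulN1r h12.
rewrite (subE _ _ _ _ (0 +i* (y1 - y2)))//; last first.
  by move=> t; congr (_ +i* _); rewrite subrr.
rewrite (subE _ _ _ _ ((x2 - x1) +i* 0))//; last first.
  by move=> t; congr (_ +i* _); rewrite subrr.
by simpc; congr (_ +i* _); ring.
Qed.

End rectangle_integral.

(** * Goursat's theorem *)

Section goursat.
Context {R : realType}.
Implicit Types (f g : R[i] -> R[i]) (z w : R[i]).

Lemma nested_intervals (x : nat -> R) (W : R) : 0 <= W ->
  (forall n, x n <= x n.+1) ->
  (forall n, x n.+1 + W / 2 ^+ n.+1 <= x n + W / 2 ^+ n) ->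
  exists c, forall n, x n <= c <= x n + W / 2 ^+ n.
Proof.
move=> W0 x1 x2.
have xm m n : (m <= n)%N -> x m <= x n.
  move=> /subnK <-; elim: (n - m)%N => [|k IH]; first by rewrite add0n.
  by apply: le_trans IH _; rewrite addSn.
have ym m n : (m <= n)%N -> x n + W / 2 ^+ n <= x m + W / 2 ^+ m.
  move=> /subnK <-; elim: (n - m)%N => [|k IH]; first by rewrite add0n.
  by apply: le_trans IH; rewrite addSn.
have xy m n : x m <= x n + W / 2 ^+ n.
  have [mn|/ltnW nm] := leqP m n.
    by apply: le_trans (xm _ _ mn) _; rewrite lerDl divr_ge0// exprn_ge0.
  by apply: le_trans (ym _ _ nm); rewrite lerDl divr_ge0// exprn_ge0.
exists (sup (range x)) => n; apply/andP; split.
  apply: ub_le_sup; last by exists n.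
  by exists (x 0%N + W / 2 ^+ 0) => _ [m _ <-].
by apply: ge_sup; [exists (x 0%N), 0%N | move=> _ [m _ <-]].
Qed.

Lemma dist_itv_le (x X u v : R) : x <= u <= x + X -> x <= v <= x + X -> `|u - v| <= X.
Proof. by rewrite ler_norml => /andP[? ?] /andP[? ?]; lra. Qed.

Lemma large_of_sum4 (e j j1 j2 j3 j4 : R) : 4 * e < j ->
  j <= j1 + j2 + (j3 + j4) -> j1 <= e -> j2 <= e -> j3 <= e -> e < j4.
Proof. lra. Qed.

Lemma goursat_bound (e S t : R) : 0 < e -> 0 < t ->
  4 * (e / (4 * (S ^+ 2 + 1)) * (S / t)) * (S / t) <= e / (t * t).
Proof.
move=> e0 t0; have S0 : 0 < S ^+ 2 + 1 by rewrite ltr_wpDl// sqr_ge0.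
rewrite -subr_ge0 [leRHS](_ : _ = e / (t * t) / (S ^+ 2 + 1)).
  by rewrite !divr_ge0// ?mulr_ge0 ?ltW.
by field; rewrite !gt_eqF.
Qed.

Lemma expr2_unbounded (W d : R) : 0 < d -> exists n, W / 2 ^+ n < d.
Proof.
move=> d0; have [n nP] : exists n : nat, W / d < n%:R.
  exists (Num.bound `|W / d|); apply: le_lt_trans (ler_norm _) _.
  by apply: archi_boundP; rewrite normr_ge0.
exists n; rewrite ltr_pdivrMr ?exprn_gt0// mulrC -ltr_pdivrMr//.
apply: lt_trans nP _; rewrite -natrX ltr_nat; exact: ltn_expl.
Qed.

(** A large integral survives on one of the four quarters, at the scale of the
    quarter's area. *)
Lemma rect_int_quarter g (x y W H e : R) (n : nat) : 0 <= W -> 0 <= H ->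
  let X := W / 2 ^+ n in let Y := H / 2 ^+ n in
  holo_on (rect x (x + X) y (y + Y)) g ->
  e / 4 ^+ n < normc (rect_int g x (x + X) y (y + Y)) ->
  exists x' y', let X' := W / 2 ^+ n.+1 in let Y' := H / 2 ^+ n.+1 in
    [/\ x <= x', x' + X' <= x + X, y <= y', y' + Y' <= y + Y &
      e / 4 ^+ n.+1 < normc (rect_int g x' (x' + X') y' (y' + Y'))].
Proof.
move=> W0 H0 X Y gh egt.
pose X' := W / 2 ^+ n.+1; pose Y' := H / 2 ^+ n.+1.
have XX : X = X' + X' by rewrite /X /X' exprS; field; rewrite expf_neq0.
have YY : Y = Y' + Y' by rewrite /Y /Y' exprS; field; rewrite expf_neq0.
have X0 : 0 <= X' by rewrite divr_ge0// exprn_ge0.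
have Y0 : 0 <= Y' by rewrite divr_ge0// exprn_ge0.
have ei (u v s t : R) : x <= u -> v <= x + X -> y <= s -> t <= y + Y -> u <= v ->
    s <= t -> edge_integrable g u v s t.
  move=> xu vx ys ty uv st; apply: holo_edge_integrable => //.
  apply: holo_onS gh => z [[/andP[z1 z2] /andP[z3 z4]] _].
  by split; apply/andP; split; lra.
have [||||||a1 a2 _ _] := ei x (x + X) y (y + Y); try lra.
have [||||||b1 b2 b3 b4] := ei x (x + X') y (y + Y); try lra.
have [||||||c1 c2 c3 c4] := ei (x + X') (x + X) y (y + Y); try lra.
have J : rect_int g x (x + X) y (y + Y) =
   rect_int g x (x + X') y (y + Y') + rect_int g x (x + X') (y + Y') (y + Y) +
   (rect_int g (x + X') (x + X) y (y + Y') +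
    rect_int g (x + X') (x + X) (y + Y') (y + Y)).
  have [i1 i2 i3 i4] : [/\ x <= x + X', x + X' <= x + X, y <= y + Y' & y + Y' <= y + Y].
    by split; lra.
  rewrite (@rect_int_splitx _ g x (x + X') (x + X))//.
  by congr (_ + _); apply: rect_int_splity.
have : (normc (rect_int g x (x + X) y (y + Y)) <=
  normc (rect_int g x (x + X') y (y + Y')) +
  normc (rect_int g x (x + X') (y + Y') (y + Y)) +
  (normc (rect_int g (x + X') (x + X) y (y + Y')) +
  normc (rect_int g (x + X') (x + X) (y + Y') (y + Y)))).
  rewrite J; apply: le_trans (le_normcD _ _) _.
  by apply: lerD; exact: le_normcD.
have e4 : e / 4 ^+ n = 4 * (e / 4 ^+ n.+1).
  by rewrite exprS; field; rewrite expf_neq0.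
rewrite {J}e4 in egt.
have XE : x + X = x + X' + X' by rewrite XX addrA.
have YE : y + Y = y + Y' + Y' by rewrite YY addrA.
have [xX yY] : x <= x + X' /\ y <= y + Y' by rewrite !lerDl.
have [xX2 yY2] : x + X' <= x + X /\ y + Y' <= y + Y by rewrite XE YE !lerDl.
have [xX3 yY3] : x + X' + X' <= x + X /\ y + Y' + Y' <= y + Y by rewrite XE YE.
move=> le4.
have [h1|h1] := ltP (e / 4 ^+ n.+1) (normc (rect_int g x (x + X') y (y + Y'))).
  by exists x, y.
have [h2|h2] := ltP (e / 4 ^+ n.+1)
    (normc (rect_int g x (x + X') (y + Y') (y + Y))).
  exists x, (y + Y'); split; [exact: lexx|exact: xX2|exact: yY|exact: yY3|].
  by rewrite -/X' -/Y' -YE.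
have [h3|h3] := ltP (e / 4 ^+ n.+1)
    (normc (rect_int g (x + X') (x + X) y (y + Y'))).
  exists (x + X'), y; split; [exact: xX|exact: xX3|exact: lexx|exact: yY2|].
  by rewrite -/X' -/Y' -XE.
exists (x + X'), (y + Y'); split; [exact: xX|exact: xX3|exact: yY|exact: yY3|].
rewrite -/X' -/Y' -XE -YE.
exact: large_of_sum4 egt le4 h1 h2 h3.
Qed.

(** Bisection: if the integral were larger than [e], nested rectangles
    [Q_n] of diameter [O(2^-n)] would carry integrals larger than [e / 4^n].  At
    their common point [g] agrees with an affine function, whose integral
    vanishes, up to [o(2^-n)] on [Q_n]; as the perimeter is [O(2^-n)], the integral
    over [Q_n] is [o(4^-n)]. *)
Lemma goursat g x1 x2 y1 y2 : x1 <= x2 -> y1 <= y2 ->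
  holo_on (rect x1 x2 y1 y2) g -> rect_int g x1 x2 y1 y2 = 0.
Proof.
move=> x12 y12 gh; apply: eq0_normc; apply/eqP; rewrite eq_le Defs.normc_ge0 andbT.
apply/ler_addgt0Pl => e e0; rewrite addr0 leNgt; apply/negP; move: (e : R) e0 => {}e e0 eJ.
pose W := x2 - x1; pose H := y2 - y1.
have W0 : 0 <= W by rewrite subr_ge0.
have H0 : 0 <= H by rewrite subr_ge0.
pose P (n : nat) (p : R * R) := [/\ x1 <= p.1, p.1 + W / 2 ^+ n <= x2, y1 <= p.2,
  p.2 + H / 2 ^+ n <= y2 & e / 4 ^+ n <
    normc (rect_int g p.1 (p.1 + W / 2 ^+ n) p.2 (p.2 + H / 2 ^+ n))].
have step np : exists p', P np.1 np.2 -> P np.1.+1 p' /\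
   [/\ np.2.1 <= p'.1, p'.1 + W / 2 ^+ np.1.+1 <= np.2.1 + W / 2 ^+ np.1,
     np.2.2 <= p'.2 & p'.2 + H / 2 ^+ np.1.+1 <= np.2.2 + H / 2 ^+ np.1].
  case: np => n [x y] /=; have [[/= p1 p2 p3 p4 p5]|nP] := pselect (P n (x, y)); last first.
    by exists (x, y) => /nP.
  have [|x' [y' [q1 q2 q3 q4 q5]]] := rect_int_quarter W0 H0 _ p5.
    apply: holo_onS gh => z [/andP[z1 z2] /andP[z3 z4]]; split; apply/andP; split.
    - exact: le_trans z1.
    - exact: le_trans p2.
    - exact: le_trans z3.
    - exact: le_trans p4.
  exists (x', y') => _; split => //; split => //=.
  - exact: le_trans q1.
  - exact: le_trans p2.
  - exact: le_trans q3.
  - exact: le_trans p4.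
have [nx nxP] := choice step.
pose fix s n := if n is m.+1 then nx (m, s m) else (x1, y1).
have sP n : P n (s n).
  elim: n => [|n IH]; last by have [] := nxP (n, s n) IH.
  by rewrite /P /= !expr0 !divr1 !subrKC !lexx.
have sS n := (nxP (n, s n) (sP n)).2.
have [|n|cx cxP] := @nested_intervals (fun n => (s n).1) W W0.
- by move=> n; have [] := sS n.
- by have [] := sS n.
have [|n|cy cyP] := @nested_intervals (fun n => (s n).2) H H0.
- by move=> n; have [] := sS n.
- by have [] := sS n.
have [l gl] : exists l, has_cderiv g (cx +i* cy) l.
  apply: gh; split => /=; [have := cxP 0%N | have := cyP 0%N].
    by rewrite /= expr0 divr1 subrKC.
  by rewrite /= expr0 divr1 subrKC.
(* the precision in the derivative that [goursat_bound] turns into [e / 4^n] *)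
have D0 : 0 < 4 * ((W + H) ^+ 2 + 1).
  by rewrite mulr_gt0// ltr_wpDl// sqr_ge0.
have [d d0 dP] := gl _ (divr_gt0 e0 D0).
have [n nd] := @expr2_unbounded (W + H) d d0.
have [p1 p2 p3 p4 p5] := sP n; have cxn := cxP n; have cyn := cyP n.
move: p1 p2 p3 p4 p5 cxn cyn; set x := (s n).1; set y := (s n).2.
set X := W / 2 ^+ n; set Y := H / 2 ^+ n => p1 p2 p3 p4 p5 /andP[c1 c2] /andP[c3 c4].
have X0 : 0 <= X by rewrite divr_ge0// exprn_ge0.
have Y0 : 0 <= Y by rewrite divr_ge0// exprn_ge0.
pose c := cx +i* cy; pose r z := g z + ((l * c - g c) + (- l) * z).
have ghn : holo_on (rect x (x + X) y (y + Y)) g.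
  apply: holo_onS gh => z [/andP[z1 z2] /andP[z3 z4]]; split; apply/andP; split.
  - exact: le_trans z1.
  - exact: le_trans p2.
  - exact: le_trans z3.
  - exact: le_trans p4.
have gi : edge_integrable g x (x + X) y (y + Y).
  by apply: holo_edge_integrable; rewrite ?lerDl//; apply: holo_onS ghn => z [].
have ci u : edge_integrable (fun=> u) x (x + X) y (y + Y).
  apply: holo_edge_integrable; rewrite ?lerDl// => z _.
  by exists 0; exact: has_cderiv_cst.
have ii : edge_integrable id x (x + X) y (y + Y).
  apply: holo_edge_integrable; rewrite ?lerDl// => z _.
  by exists 1; exact: has_cderiv_id.
have edgeZ u h x3 x4 y3 y4 : edge_integrable h x3 x4 y3 y4 ->
    edge_integrable (fun z => u * h z) x3 x4 y3 y4.
  by move=> [? ? ? ?]; split; exact: path_integrableZ.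
have edgeD h1 h2 x3 x4 y3 y4 : edge_integrable h1 x3 x4 y3 y4 ->
    edge_integrable h2 x3 x4 y3 y4 ->
    edge_integrable (fun z => h1 z + h2 z) x3 x4 y3 y4.
  by move=> [? ? ? ?] [? ? ? ?]; split; exact: path_integrableD.
have ai := edgeD _ _ _ _ _ _ (ci (l * c - g c)) (edgeZ (- l) _ _ _ _ _ ii).
have rJ : rect_int r x (x + X) y (y + Y) = rect_int g x (x + X) y (y + Y).
  rewrite /r rect_intD// rect_intD//; last exact: edgeZ.
  rewrite rect_intZ// rect_int_cst ?lerDl// rect_int_id ?lerDl//.
  by rewrite mulr0 !addr0.
move: p5; rewrite -rJ; apply/negP; rewrite -leNgt.
have XY : X + Y = (W + H) / 2 ^+ n by rewrite /X /Y -mulrDl.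
have zc z : rect x (x + X) y (y + Y) z -> normc (z - c) <= X + Y.
  case: z => z1 z2 [/= /andP[? ?] /andP[? ?]]; rewrite /c.
  apply: le_trans (normc_leD (z1 - cx) (z2 - cy)) _.
  by apply: lerD; [apply: (@dist_itv_le x)|apply: (@dist_itv_le y)]; apply/andP.
set eta := e / _ in dP.
have eta0 : 0 <= eta by rewrite divr_ge0// ltW. 
have rK z : rect_edge x (x + X) y (y + Y) z -> normc (r z) <= eta * (X + Y).
  move=> [/zc zcXY _].
  have H1 := dP (z - c); rewrite -/c subrKC in H1.
  rewrite (_ : r z = g z - g c - l * (z - c)); last by rewrite /r; ring.
  apply: le_trans (H1 _) _; last by rewrite ler_wpM2l.
  by apply: le_lt_trans nd; rewrite -XY.
have xX : x <= x + X by rewrite lerDl.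
have yY : y <= y + Y by rewrite lerDl.
apply: le_trans (normc_rect_int_le xX yY (edgeD _ _ _ _ _ _ gi ai) rK) _.
rewrite (_ : x + X - x + (y + Y - y) = X + Y); last by ring.
rewrite XY /eta (_ : 4 ^+ n = 2 ^+ n * 2 ^+ n :> R); last by rewrite -exprMn -natrM.
by apply: goursat_bound => //; rewrite exprn_gt0.
Qed.

End goursat.

(** * The integral of the Cauchy kernel over a square *)

Section cauchy_kernel.
Context {R : realType}.
Implicit Types (f g : R[i] -> R[i]) (z w : R[i]).
Local Notation mu := (@lebesgue_measure R).

Lemma has_cderiv_quotient f z w l : has_cderiv f z l -> z != w ->
  exists l', has_cderiv (fun z => f z * (z - w)^-1) z l'.
Proof.
move=> fl zw; apply/derivable_has_cderiv.
apply: (@derivableM R[i] R[i]^o) => /=.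
  by apply/derivable_has_cderiv; exists l.
apply: (@derivableV R[i] R[i]^o); first by rewrite subr_eq0.
by apply: (@derivableB R[i] R[i]^o R[i]^o); [exact: derivable_id|exact: derivable_cst].
Qed.

Lemma Rintegral_atan (c s : R) : 0 < s ->
  \int[mu]_(t in `[c - s, c + s]) (2 * s / ((t - c) ^+ 2 + s ^+ 2)) = pi.
Proof.
move=> s0; pose F t := 2 * atan ((t - c) / s).
have D0 t : (t - c) ^+ 2 + s ^+ 2 != 0.
  by rewrite gt_eqF// ltr_wpDl ?sqr_ge0// exprn_gt0.
have Fd (t : R) : is_derive t 1 F (2 * s / ((t - c) ^+ 2 + s ^+ 2)).
  have h1 : is_derive t 1 (fun t : R => (t - c) / s) (s^-1).
    apply: is_derive_eq; rewrite /GRing.scale /=; ring.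
  have h2 := is_derive1_atan ((t - c) / s).
  have h3 := @is_derive1_comp _ _ (fun t : R => (t - c) / s) t _ _ h2 h1.
  have h4 := @is_deriveZ _ _ _ _ 2 _ _ _ h3.
  apply: is_derive_eq h4 _; rewrite /GRing.scale /=.
  field.
  by rewrite D0 gt_eqF.
have := @continuous_FTC2 R (fun t => 2 * s / ((t - c) ^+ 2 + s ^+ 2)) F (c - s) (c + s).
rewrite /Rintegral => ->//.
- rewrite -EFinB /= /F.
  rewrite (_ : (c + s - c) / s = 1); last by field; rewrite gt_eqF.
  rewrite (_ : (c - s - c) / s = - 1); last by field; rewrite gt_eqF.
  by rewrite atanN atan1; field.
- lra.
- apply: continuous_subspaceT => t.
  apply: (@cvgM _ R); first exact: cvg_cst.
  apply: (@cvgV _ R) => //; apply: cvgD; last exact: cvg_cst.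
  apply: (@continuous_comp _ _ _ (fun t => t - c) (fun t => t ^+ 2)).
    by apply: cvgB; [exact: cvg_id|exact: cvg_cst].
  exact: exprn_continuous.
- split => [t _||].
  + by have [] := Fd t.
  + apply: cvg_at_right_filter.
    by have [/derivable1_diffP/differentiable_continuous] := Fd (c - s).
  + apply: cvg_at_left_filter.
    by have [/derivable1_diffP/differentiable_continuous] := Fd (c + s).
- by move=> t _; rewrite derive1E; have [_ ->] := Fd t.
Qed.

Lemma complexB (x y u v : R) : (x +i* y) - (u +i* v) = (x - u) +i* (y - v).
Proof. by []. Qed.

Lemma complexV (x y : R) :
  (x +i* y)^-1 = (x / (x ^+ 2 + y ^+ 2)) +i* (- y / (x ^+ 2 + y ^+ 2)).
Proof. by congr (_ +i* _); rewrite mulNr. Qed.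

Lemma inv_diff_horizontal (u s : R) : u ^+ 2 + s ^+ 2 != 0 ->
  (u +i* (- s))^-1 - (u +i* s)^-1 = 0 +i* (2 * s / (u ^+ 2 + s ^+ 2)).
Proof.
move=> us; rewrite !complexV complexB sqrrN.
by congr (_ +i* _); field.
Qed.

Lemma inv_diff_vertical (u s : R) : u ^+ 2 + s ^+ 2 != 0 ->
  (s +i* u)^-1 - ((- s) +i* u)^-1 = (2 * s / (u ^+ 2 + s ^+ 2)) +i* 0.
Proof.
move=> us; rewrite !complexV complexB sqrrN (addrC (s ^+ 2)).
by congr (_ +i* _); field.
Qed.

(** Opposite sides combine into the real integrand [2 s / (t^2 + s^2)], whose
    primitive is an arctangent. *)
Lemma rect_int_inv w (s : R) : 0 < s ->
  rect_int (fun z => (z - w)^-1) (complex.Re w - s) (complex.Re w + s)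
    (complex.Im w - s) (complex.Im w + s) = (2 * pi)%:C * 'i.
Proof.
case: w => a b /= s0.
have nz z : rect_edge (a - s) (a + s) (b - s) (b + s) z -> z != a +i* b.
  case: z => u v [_] /= H; apply/eqP => -[ua vb]; move: H.
  by rewrite ua vb => -[] ?; lra.
have [i1 i2 i3 i4] : edge_integrable (fun z => (z - (a +i* b))^-1)
    (a - s) (a + s) (b - s) (b + s).
  apply: holo_edge_integrable; [lra|lra|] => z /nz zw.
  have [l' Hl'] := has_cderiv_quotient (@has_cderiv_cst _ 1 z) zw.
  by exists l'; rewrite (_ : (fun z => _) = fun z => 1 * (z - (a +i* b))^-1)//; apply/funext => ?; rewrite mul1r.
have subE h1 h2 (x y : R) : path_integrable h1 x y -> path_integrable h2 x y ->
    path_int h1 x y - path_int h2 x y = path_int (fun t => h1 t - h2 t) x y.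
  move=> j1 j2; rewrite -mulN1r -path_intZ// -path_intD//; last exact: path_integrableZ.
  by congr path_int; apply/funext => t; rewrite mulN1r.
have k0 c t : (t - c) ^+ 2 + s ^+ 2 != 0.
  by rewrite gt_eqF// ltr_wpDl ?sqr_ge0// exprn_gt0.
rewrite /rect_int !subE//.
rewrite [X in path_int X (a - s)](_ : _ = fun t => 0 +i* (2 * s / ((t - a) ^+ 2 + s ^+ 2))); last first.
  apply/funext => t; rewrite -inv_diff_horizontal//.
  by congr (_^-1 - _^-1); rewrite complexB; congr (_ +i* _); ring.
rewrite [X in path_int X (b - s)](_ : _ = fun t => (2 * s / ((t - b) ^+ 2 + s ^+ 2)) +i* 0); last first.
  apply/funext => t; rewrite -inv_diff_vertical//.
  by congr (_^-1 - _^-1); rewrite complexB; congr (_ +i* _); ring.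
rewrite /path_int/= !Rintegral_atan// !Rintegral_cst// !mul0r.
by simpc; congr (_ +i* _); ring.
Qed.
End cauchy_kernel.

(** * Cauchy's integral formula *)

Section cauchy_formula.
Context {R : realType}.
Implicit Types (f g : R[i] -> R[i]) (z w : R[i]).

(** The contour can be shrunk around a singularity: cut off the two vertical strips
    on its sides, then the two remaining horizontal ones, where Goursat's theorem
    applies. *)
Lemma rect_int_excise g (a b : R) x1 x2 y1 y2 u1 u2 v1 v2 :
  (forall z, z != a +i* b -> exists l, has_cderiv g z l) ->
  x1 <= u1 < a -> a < u2 <= x2 -> y1 <= v1 < b -> b < v2 <= y2 -> 
  x1 < a < x2 -> y1 < b < y2 ->
  rect_int g x1 x2 y1 y2 = rect_int g u1 u2 v1 v2.
Proof.
move=> gh /andP[xu1 u1a] /andP[au2 u2x] /andP[yv1 v1b] /andP[bv2 v2y].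
move=> /andP[xa ax] /andP[yb by_].
have E x3 x4 y3 y4 : x3 <= x4 -> y3 <= y4 -> x3 != a -> x4 != a -> y3 != b -> y4 != b ->
    edge_integrable g x3 x4 y3 y4.
  move=> x34 y34 x3a x4a y3b y4b; apply: holo_edge_integrable => // -[x y] [_ /= H].
  apply: gh; apply/eqP => -[xa' yb']; subst x y.
  by case: H => H; move: x3a x4a y3b y4b; rewrite H eqxx.
have G x3 x4 y3 y4 : x3 <= x4 -> y3 <= y4 -> (x4 < a) || (a < x3) || (y4 < b) || (b < y3) ->
    rect_int g x3 x4 y3 y4 = 0.
  move=> x34 y34 H; apply: goursat => // -[x y] [/= /andP[h1 h2] /andP[h3 h4]].
  apply: gh; apply/eqP => -[xa' yb']; subst x y.
  by case/orP : H => [/orP[/orP[]|]|] H;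
    [move: h2|move: h1|move: h4|move: h3]; rewrite leNgt H.
have le_u : u1 <= u2 by exact: ltW (lt_trans u1a au2).
have le_v : v1 <= v2 by exact: ltW (lt_trans v1b bv2).
have le_y : y1 <= y2 by exact: ltW (lt_trans yb by_).
have u1x : u1 <= x2 by exact: le_trans u2x.
have v1y : v1 <= y2 by exact: le_trans v2y.
have [[n1 n2] [n3 n4]] : (u1 != a /\ u2 != a) /\ (v1 != b /\ v2 != b).
  by rewrite (lt_eqF u1a) (gt_eqF au2) (lt_eqF v1b) (gt_eqF bv2).
have [[n5 n6] [n7 n8]] : (x1 != a /\ x2 != a) /\ (y1 != b /\ y2 != b).
  by rewrite (lt_eqF xa) (gt_eqF ax) (lt_eqF yb) (gt_eqF by_).
have [a1 a2 _ _] := E x1 x2 y1 y2 (le_trans xu1 u1x) le_y n5 n6 n7 n8.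
have G1 : rect_int g x1 u1 y1 y2 = 0 by apply: G; rewrite ?u1a.
rewrite (rect_int_splitx xu1 u1x a1 a2) G1 add0r.
have [{}a1 {}a2 _ _] := E u1 x2 y1 y2 u1x le_y n1 n6 n7 n8.
have G2 : rect_int g u2 x2 y1 y2 = 0 by apply: G; rewrite ?au2 ?orbT.
rewrite (rect_int_splitx le_u u2x a1 a2) G2 addr0.
have [_ _ {}a1 {}a2] := E u1 u2 y1 y2 le_u le_y n1 n2 n7 n8.
have G3 : rect_int g u1 u2 y1 v1 = 0 by apply: G; rewrite ?v1b ?orbT.
rewrite (rect_int_splity yv1 v1y a1 a2) G3 add0r.
have [_ _ {}a1 {}a2] := E u1 u2 v1 y2 le_u v1y n1 n2 n3 n8.
have G4 : rect_int g u1 u2 v2 y2 = 0 by apply: G; rewrite ?bv2 ?orbT.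
by rewrite (rect_int_splity le_v v2y a1 a2) G4 addr0.
Qed.

(** On a small square around [w] the difference between [f z / (z - w)] and
    [f w / (z - w)] is a difference quotient, bounded because [f] is differentiable
    at [w]; its integral tends to [0] with the side of the square. *)
Lemma cauchy_formula f (r : R) w : entire f -> normc w < r ->
  rect_int (fun z => f z * (z - w)^-1) (- r) r (- r) r =
  (2 * pi)%:C * 'i * f w.
Proof.
move=> /entireP ef; case: w => a b wr.
have /andP[ra ar] : - r < a < r.
  by rewrite -ltr_norml; apply: le_lt_trans wr; exact: normr_Re_le (a +i* b).
have /andP[rb br] : - r < b < r.
  by rewrite -ltr_norml; apply: le_lt_trans wr; exact: normr_Im_le (a +i* b).
set w := a +i* b in wr *; have [l fl] := ef w.
have [d d0 dP] := fl _ ltr01.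
pose F z := f z * (z - w)^-1; pose M := 1 + normc l.
have M0 : 0 < M by rewrite ltr_wpDr// Defs.normc_ge0.
have Fh z : z != w -> exists l, has_cderiv F z l.
  by move=> zw; have [l' fl'] := ef z; exact: has_cderiv_quotient fl' zw.
pose s0 := Num.min (Num.min (r - a) (r + a)) (Num.min (r - b) (Num.min (r + b) (d / 4))).
have s00 : 0 < s0 by rewrite !lt_min divr_gt0// andbT; lra.
apply/eqP; rewrite -subr_eq0; apply/eqP/eq0_normc/eqP.
rewrite eq_le Defs.normc_ge0 andbT; apply/ler_addgt0Pl => e e0; rewrite addr0.
pose s := Num.min s0 (e / (16 * M)).
have sp : 0 < s by rewrite lt_min s00 divr_gt0// mulr_gt0.
have : s <= s0 by rewrite ge_min lexx.
rewrite !le_min => /andP[/andP[s1 s2] /and3P[s3 s4 s5]].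
have se : s <= e / (16 * M) by rewrite ge_min lexx orbT.
have excF : rect_int F (- r) r (- r) r = rect_int F (a - s) (a + s) (b - s) (b + s).
  by apply: (@rect_int_excise F a b) => //; apply/andP; split; lra.
rewrite excF.
have zw z : rect_edge (a - s) (a + s) (b - s) (b + s) z -> z != w.
  by move=> [_ /= H]; apply/eqP => E; rewrite E /= in H; case: H; lra.
have i1 : edge_integrable (fun z => 1 * (z - w)^-1) (a - s) (a + s) (b - s) (b + s).
  apply: holo_edge_integrable; try lra.
  by move=> z /zw; apply: (has_cderiv_quotient (@has_cderiv_cst _ 1 z)).
have i2 : edge_integrable F (a - s) (a + s) (b - s) (b + s).
  by apply: holo_edge_integrable; try lra; move=> z /zw; exact: Fh.
have e1 : rect_int (fun z => 1 * (z - w)^-1) (a - s) (a + s) (b - s) (b + s) =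
    (2 * pi)%:C * 'i.
  rewrite (_ : (fun z => _) = fun z => (z - w)^-1); first exact: rect_int_inv.
  by apply/funext => z; rewrite mul1r.
have i3 : edge_integrable (fun z => (- f w) * (1 * (z - w)^-1)) (a - s) (a + s) (b - s) (b + s).
  by case: i1 => ? ? ? ?; split; exact: path_integrableZ.
have i4 : edge_integrable (fun z => F z + (- f w) * (1 * (z - w)^-1)) (a - s) (a + s) (b - s) (b + s).
  by case: i2 i3 => ? ? ? ? [? ? ? ?]; split; exact: path_integrableD.
have -> : rect_int F (a - s) (a + s) (b - s) (b + s) - (2 * pi)%:C * 'i * f w =
   rect_int (fun z => F z + (- f w) * (1 * (z - w)^-1)) (a - s) (a + s) (b - s) (b + s).
  by rewrite rect_intD// rect_intZ// e1 mulNr [in RHS]mulrC.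
have las : a - s <= a + s by lra.
have lbs : b - s <= b + s by lra.
have K z : rect_edge (a - s) (a + s) (b - s) (b + s) z ->
    normc (F z + (- f w) * (1 * (z - w)^-1)) <= M.
  move=> zE; have zw0 := zw _ zE.
  have zd : normc (z - w) < d.
    case: z zE {zw0} => x y [[/= /andP[? ?] /andP[? ?]] _].
    apply: le_lt_trans (normc_leD (x - a) (y - b)) _.
    apply: (@le_lt_trans _ _ (s + s)); last lra.
    by apply: lerD; rewrite ler_norml; apply/andP; split; lra.
  have H := dP _ zd; rewrite subrKC mul1r in H.
  have zn : 0 < normc (z - w).
    rewrite lt_neqAle Defs.normc_ge0 andbT eq_sym.
    by apply: contra zw0 => /eqP/eq0_normc/eqP; rewrite subr_eq0.
  have -> : F z + - f w * (1 * (z - w)^-1) = (f z - f w) * (z - w)^-1 by rewrite /F; ring.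
  rewrite normcM normcV ler_pdivrMr//.
  rewrite -(subrK (l * (z - w)) (f z - f w)).
  apply: le_trans (le_normcD _ _) _.
  by rewrite normcM /M mulrDl mul1r lerD2r.
apply: le_trans (normc_rect_int_le las lbs i4 K) _.
rewrite (_ : a + s - (a - s) + (b + s - (b - s)) = 4 * s); last by ring.
rewrite (_ : 4 * M * (4 * s) = s * (16 * M)); last by ring.
by rewrite -ler_pdivlMr// mulr_gt0.
Qed.

End cauchy_formula.

(** * Taylor approximation *)

Section taylor.
Context {R : realType}.
Implicit Types (f g : R[i] -> R[i]) (z w : R[i]).

Lemma normcX z n : normc (z ^+ n) = normc z ^+ n.
Proof.
elim: n => [|n IH]; first by rewrite !expr0 normc1.
by rewrite !exprS normcM IH.
Qed.

Lemma eq_path_int (h1 h2 : R -> R[i]) a b :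
  (forall t, a <= t <= b -> h1 t = h2 t) -> path_int h1 a b = path_int h2 a b.
Proof.
by move=> h12; congr (_ +i* _); apply: eq_Rintegral => t /[!inE]/=;
  rewrite in_itv/= => /h12 ->.
Qed.

Lemma eq_rect_int g1 g2 x1 x2 y1 y2 : x1 <= x2 -> y1 <= y2 ->
  (forall z, rect_edge x1 x2 y1 y2 z -> g1 z = g2 z) ->
  rect_int g1 x1 x2 y1 y2 = rect_int g2 x1 x2 y1 y2.
Proof.
move=> x12 y12 g12; rewrite /rect_int; congr (_ - _ + _ * (_ - _));
  apply: eq_path_int => t /andP[t1 t2]; apply: g12;
  (split; [by rewrite /rect /= t1 t2 lexx ?x12 ?y12|]).
- exact: Or41.
- exact: Or42.
- exact: Or44.
- exact: Or43.
Qed.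

Lemma rect_edge_square (r : R) z : 0 < r -> rect_edge (- r) r (- r) r z ->
  r <= normc z <= 2 * r.
Proof.
move=> r0; case: z => x y [[/= /andP[x1 x2] /andP[y1 y2]] H].
apply/andP; split.
  have : (r <= `|x|) || (r <= `|y|).
    by case: H => ->; rewrite ?normrN (ger0_norm (ltW r0)) lexx ?orbT.
  case/orP => /le_trans; apply; first exact: normr_Re_le (x +i* y).
  exact: normr_Im_le (x +i* y).
apply: le_trans (normc_leD _ _) _; rewrite mulr_natl mulr2n.
by apply: lerD; rewrite ler_norml; apply/andP.
Qed.

(** Expanding the Cauchy kernel along the boundary of a square gives the
    coefficients, the Cauchy estimates and the remainder at once. *)
Lemma taylor_approx f (r K : R) : entire f -> 0 < r ->
  (forall z, normc z <= 2 * r -> normc (f z) <= K) ->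
  exists a : nat -> R[i], (forall k, normc (a k) <= 8 * K / r ^+ k) /\
    forall w n, normc w < r ->
      normc (f w - \sum_(k < n) a k * w ^+ k) <=
      8 * K * (normc w / r) ^+ n * (r / (r - normc w)).
Proof.
move=> ef r0 fK; have Nr : - r <= r by lra.
have K0 : 0 <= K.
  apply: le_trans (Defs.normc_ge0 (f 0)) (fK 0 _).
  by rewrite normc0 mulr_ge0// ltW.
pose G n z := f z * (z^-1) ^+ n.
have c0 : (2 * pi)%:C * 'i != 0 :> R[i].
  rewrite eq_complex /= !mulr0 !mul0r subr0 mulr1 addr0 eqxx /=.
  by rewrite mulf_neq0// gt_eqF ?pi_gt0.
set c := (2 * pi)%:C * 'i in c0.
have cn : normc c^-1 <= 2^-1.
  rewrite normcV normcM normc_i mulr1.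
  have -> : normc ((2 * pi)%:C : R[i]) = 2 * pi :> R.
    by rewrite /= expr0n addr0 sqrtr_sqr ger0_norm// mulr_ge0// pi_ge0.
  rewrite lef_pV2 ?posrE ?mulr_gt0 ?pi_gt0//.
  by rewrite ler_peMr//; apply: le_trans (pi_ge2 _); rewrite ler1n.
have Gh n z : z != 0 -> exists l, has_cderiv (G n) z l.
  move=> z0; elim: n => [|n [l IH]].
    rewrite (_ : G 0%N = f); first by move/entireP : ef; exact.
    by apply/funext => u; rewrite /G expr0 mulr1.
  have [l' Hl'] := has_cderiv_quotient IH z0; exists l'.
  rewrite (_ : G n.+1 = fun z => G n z * (z - 0)^-1)//.
  by apply/funext => u; rewrite /G subr0 exprSr mulrA.
have En0 z : rect_edge (- r) r (- r) r z -> z != 0.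
  move=> /(rect_edge_square r0) /andP[rz _].
  by apply/eqP => z0; move: rz; rewrite z0 normc0 leNgt r0.
have Ew w z : normc w < r -> rect_edge (- r) r (- r) r z -> z != w.
  move=> wr /(rect_edge_square r0) /andP[rz _].
  by apply/eqP => zw; move: rz; rewrite zw leNgt wr.
have Gi n : edge_integrable (G n) (- r) r (- r) r.
  by apply: holo_edge_integrable => // z /En0; exact: Gh.
have Bi w n : normc w < r ->
    edge_integrable (fun z => G n z * (z - w)^-1) (- r) r (- r) r.
  move=> wr; apply: holo_edge_integrable => // z zE.
  have [l Gl] := Gh n _ (En0 _ zE).
  exact: has_cderiv_quotient Gl (Ew _ _ wr zE).
have GK n z : rect_edge (- r) r (- r) r z -> normc (G n z) <= K / r ^+ n.
  move=> /(rect_edge_square r0) /andP[rz zr]; rewrite normcM normcX normcV.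
  apply: ler_pM; rewrite ?Defs.normc_ge0 ?exprn_ge0 ?invr_ge0 ?Defs.normc_ge0//.
    exact: fK.
  by rewrite exprVn lef_pV2 ?posrE ?exprn_gt0 ?(lt_le_trans r0)// lerXn2r ?nnegrE ?Defs.normc_ge0// ltW.
pose a k := c^-1 * rect_int (G k.+1) (- r) r (- r) r.
pose B n w := c^-1 * rect_int (fun z => G n z * (z - w)^-1) (- r) r (- r) r.
have rr : r - - r + (r - - r) = 4 * r by ring.
(* [a k] are the coefficients; [B n w] is the remainder divided by [w ^+ n] *)
exists a; split => [k|w n wr].
  rewrite normcM.
  apply: le_trans (_ : 2^-1 * (4 * (K / r ^+ k.+1) * (4 * r)) <= _).
    apply: ler_pM; rewrite ?Defs.normc_ge0// -rr.
    by apply: normc_rect_int_le => // z; exact: GK.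
  rewrite exprS le_eqVlt; apply/orP; left; apply/eqP; field.
  by rewrite expf_neq0 gt_eqF.
have fE : f w = \sum_(k < n) a k * w ^+ k + w ^+ n * B n w.
  elim: n => [|n IH].
    rewrite big_ord0 expr0 add0r mul1r /B.
    rewrite (_ : (fun z => _) = fun z => f z * (z - w)^-1).
      by rewrite cauchy_formula// -/c mulKf.
    by apply/funext => z; rewrite /G expr0 mulr1.
  rewrite IH big_ord_recr /= -addrA; congr (_ + _).
  (* 1 / (z^n (z - w)) = 1 / z^(n+1) + w / (z^(n+1) (z - w)) *)
  have -> : B n w = a n + w * B n.+1 w; last by rewrite exprS; ring.
  rewrite /B /a mulrCA -mulrDr; congr (_ * _).
  rewrite -rect_intZ; last exact: Bi.
  rewrite -rect_intD//; last first.
    by case: (Bi w n.+1 wr) => ? ? ? ?; split; exact: path_integrableZ.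
  apply: eq_rect_int => // z zE; rewrite /G exprS.
  have z0 := En0 _ zE; have zw := Ew _ _ wr zE.
  have zw0 : z - w != 0 by rewrite subr_eq0.
  by move: (_ ^+ n) => u; field; rewrite z0 zw0.
rewrite fE addrAC subrr add0r normcM normcX /B normcM.
have wr0 : 0 < r - normc w by rewrite subr_gt0.
apply: le_trans (_ : normc w ^+ n * (2^-1 * (4 * (K / r ^+ n / (r - normc w)) * (4 * r))) <= _).
  apply: ler_pM; rewrite ?exprn_ge0 ?mulr_ge0 ?Defs.normc_ge0//.
  apply: ler_pM; rewrite ?Defs.normc_ge0// -rr.
  apply: normc_rect_int_le => //; first exact: Bi.
  move=> z zE; rewrite normcM normcV; apply: ler_pM; rewrite ?invr_ge0 ?Defs.normc_ge0//.
    exact: GK.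
  have /andP[rz _] := rect_edge_square r0 zE.
  have H : r - normc w <= normc (z - w).
    have := le_normcD (z - w) w; rewrite subrK; lra.
  by rewrite lef_pV2// posrE// (lt_le_trans wr0).
rewrite exprMn exprVn le_eqVlt; apply/orP; left; apply/eqP; field.
by rewrite expf_neq0 !gt_eqF.
Qed.

End taylor.

(** * Affine changes of variables for the plane Lebesgue measure *)

Section plane_integral.
Context {R : realType}.
Local Notation leb := (@lebesgue_measure R).
Local Notation RR := (measurableTypeR R * measurableTypeR R)%type.
Local Notation mu := ((leb \x leb)%E).

Lemma lebesgue_measure_affine (c d : R) (A : set (measurableTypeR R)) : c != 0 -> measurable A ->
  (leb A = `|c|%:E * leb ((fun x => c * x + d)%R @^-1` A))%E.
Proof.
move=> c0 mA.
have maf : measurable_fun [set: measurableTypeR R] (fun x : measurableTypeR R => c * x + d : measurableTypeR R).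
  by apply: measurable_funD => //; exact: measurable_funM.
pose aff (x : measurableTypeR R) : measurableTypeR R := c * x + d.
pose nu := mscale (NngNum (normr_ge0 c)) (pushforward leb aff).
rewrite (@lebesgue_measure_unique R (nu maf)) //.
move=> _ [[x y] _ <-]; rewrite -[RHS]/(`|c|%:E * leb (aff @^-1` `]x, y]))%E /aff.
have {c0}[c0|c0] : c < 0 \/ 0 < c by apply/orP; rewrite -neq_lt.
  rewrite (_ : _ @^-1` _ = `[(y - d) / c, (x - d) / c[%classic); last first.
    apply/seteqP; split => t; rewrite /= !in_itv/= => /andP[h1 h2]; apply/andP; split.
    - by rewrite ler_ndivrMr// ?lerBlDr ?lerBrDr mulrC.
    - by rewrite ltr_ndivlMr// ?ltrBlDr ?ltrBrDr mulrC.
    - by move: h2; rewrite ltr_ndivlMr// ?ltrBlDr ?ltrBrDr mulrC.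
    - by move: h1; rewrite ler_ndivrMr// ?lerBlDr ?lerBrDr mulrC.
  rewrite !lebesgue_measure_itv/= !lte_fin ltr0_norm//.
  rewrite ltr_ndivrMr// -mulrA mulVf ?lt_eqF// mulr1 ltrD2r.
  case: ifP => _; last by rewrite mule0.
  by rewrite -!EFinB -EFinM; congr EFin; field; rewrite lt_eqF.
rewrite (_ : _ @^-1` _ = `](x - d) / c, (y - d) / c]%classic); last first.
  apply/seteqP; split => t; rewrite /= !in_itv/= => /andP[h1 h2]; apply/andP; split.
  - by rewrite ltr_pdivrMr// ?ltrBlDr ?ltrBrDr mulrC.
  - by rewrite ler_pdivlMr// ?lerBlDr ?lerBrDr mulrC.
  - by move: h1; rewrite ltr_pdivrMr// ?ltrBlDr ?ltrBrDr mulrC.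
  - by move: h2; rewrite ler_pdivlMr// ?lerBlDr ?lerBrDr mulrC.
rewrite !lebesgue_measure_itv/= !lte_fin gtr0_norm//.
rewrite ltr_pdivrMr// -mulrA mulVf ?gt_eqF// mulr1 ltrD2r.
case: ifP => _; last by rewrite mule0.
by rewrite -!EFinB -EFinM; congr EFin; field; rewrite gt_eqF.
Qed.

Lemma ge0_integral_affine (c d : R) (f : measurableTypeR R -> \bar R) : c != 0 ->
  measurable_fun [set: measurableTypeR R] f -> (forall x, (0 <= f x)%E) ->
  (\int[leb]_x f x = `|c|%:E * \int[leb]_x f (c * x + d)%R)%E.
Proof.
move=> c0 mf f0.
have maf : measurable_fun [set: measurableTypeR R] (fun x : measurableTypeR R => c * x + d : measurableTypeR R).
  by apply: measurable_funD => //; exact: measurable_funM.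
pose aff (x : measurableTypeR R) : measurableTypeR R := c * x + d.
pose nu := mscale (NngNum (normr_ge0 c)) (pushforward leb aff).
transitivity (\int[nu maf]_x f x)%E.
  apply: eq_measure_integral => A mA _.
  exact: lebesgue_measure_affine.
rewrite /nu ge0_integral_mscale// ge0_integral_pushforward//.
Qed.

Lemma integral_plane_xy (F : RR -> \bar R) :
  measurable_fun [set: RR] F -> (forall v, (0 <= F v)%E) ->
  (\int[mu]_v F v = \int[leb]_x \int[leb]_y F (x, y))%E.
Proof. by move=> mF F0; exact: (fubini_tonelli1 _ mF F0). Qed.

Lemma integral_plane_yx (F : RR -> \bar R) :
  measurable_fun [set: RR] F -> (forall v, (0 <= F v)%E) ->
  (\int[mu]_v F v = \int[leb]_y \int[leb]_x F (x, y))%E.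
Proof. by move=> mF F0; rewrite (fubini_tonelli1 _ mF F0); exact: (fubini_tonelli _ mF F0). Qed.

Lemma ge0_integral_shear_y (c : R) (e : R -> R) (F : RR -> \bar R) : c != 0 ->
  measurable_fun [set: RR] F -> (forall v, (0 <= F v)%E) ->
  measurable_fun [set: measurableTypeR R] (e : _ -> measurableTypeR R) ->
  (\int[mu]_v F v = `|c|%:E * \int[mu]_v F (v.1, c * v.2 + e v.1)%R)%E.
Proof.
move=> c0 mF F0 me.
have mG : measurable_fun [set: RR] (fun v : RR => F (v.1, c * v.2 + e v.1)).
  apply: (measurableT_comp mF); apply: measurable_fun_pair => //.
  apply: measurable_funD; first exact: measurable_funM.
  exact: (measurableT_comp me).
rewrite integral_plane_xy// [in RHS]integral_plane_xy//=.
rewrite -ge0_integralZl//; last 2 first.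
- exact: (measurable_fun_fubini_tonelli_F _ mG (fun v => F0 _)).
- by move=> x _; apply: integral_ge0.
apply: eq_integral => x _; apply: ge0_integral_affine => //.
exact: (measurableT_comp mF).
Qed.

Lemma ge0_integral_shear_x (c : R) (e : R -> R) (F : RR -> \bar R) : c != 0 ->
  measurable_fun [set: RR] F -> (forall v, (0 <= F v)%E) ->
  measurable_fun [set: measurableTypeR R] (e : _ -> measurableTypeR R) ->
  (\int[mu]_v F v = `|c|%:E * \int[mu]_v F (c * v.1 + e v.2, v.2)%R)%E.
Proof.
move=> c0 mF F0 me.
have mG : measurable_fun [set: RR] (fun v : RR => F (c * v.1 + e v.2, v.2)).
  apply: (measurableT_comp mF); apply: measurable_fun_pair => //.
  apply: measurable_funD; first exact: measurable_funM.
  exact: (measurableT_comp me).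
rewrite integral_plane_yx// [in RHS]integral_plane_yx//=.
rewrite -ge0_integralZl//; last 2 first.
- exact: (measurable_fun_fubini_tonelli_G _ mG (fun v => F0 _)).
- by move=> y _; apply: integral_ge0.
apply: eq_integral => y _.
apply: (@ge0_integral_affine c (e y) (fun x => F (x, y))) => //.
exact: (measurableT_comp mF).
Qed.

Lemma integral_plane_swap (F : RR -> \bar R) :
  measurable_fun [set: RR] F -> (forall v, (0 <= F v)%E) ->
  (\int[mu]_v F v = \int[mu]_v F (v.2, v.1))%E.
Proof.
move=> mF F0; rewrite integral_plane_xy// integral_plane_yx//.
by apply: (measurableT_comp mF); exact: measurable_fun_pair.
Qed.

(** The matrix of a similarity factors into two shears with a scaling, preceded
    by an exchange of the coordinates when its diagonal vanishes. *)
Lemma ge0_integral_plane_affine (al be x0 y0 : R) (F : RR -> \bar R) :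
  al ^+ 2 + be ^+ 2 != 0 ->
  measurable_fun [set: RR] F -> (forall v, (0 <= F v)%E) ->
  (\int[mu]_v F v = (al ^+ 2 + be ^+ 2)%:E *
    \int[mu]_v F ((al * v.1 - be * v.2 + x0)%R, (be * v.1 + al * v.2 + y0)%R))%E.
Proof.
move=> ab0 mF F0.
set D := al ^+ 2 + be ^+ 2 in ab0 *.
have [al0|al0] := eqVneq al 0.
  have be0 : be != 0 by apply: contra ab0 => /eqP b0; rewrite /D al0 b0 !expr0n addr0.
  rewrite integral_plane_swap//.
  have mG : measurable_fun [set: RR] (fun v : RR => F (v.2, v.1)).
    by apply: (measurableT_comp mF); exact: measurable_fun_pair.
  rewrite (ge0_integral_shear_x be0 mG (fun=> F0 _) (@measurable_cst _ _ _ _ _ y0))/=.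
  have Nb0 : - be != 0 by rewrite oppr_eq0.
  have mG2 : measurable_fun [set: RR] (fun v : RR => F (v.2, be * v.1 + y0)).
    apply: (measurableT_comp mF); apply: measurable_fun_pair => //.
    by apply: measurable_funD => //; exact: measurable_funM.
  rewrite (ge0_integral_shear_y Nb0 mG2 (fun=> F0 _) (@measurable_cst _ _ _ _ _ x0))/=.
  rewrite muleA -EFinM normrN -normrM -expr2 ger0_norm ?sqr_ge0//.
  rewrite {1}/D al0 expr0n add0r; congr (_ * _)%E.
  by apply: eq_integral => v _; congr (F (_, _)); ring.
have Dal0 : D / al != 0 by rewrite mulf_neq0// invr_eq0.
pose e x := be / al * (x - x0) + y0.
have me : measurable_fun [set: measurableTypeR R] (e : _ -> measurableTypeR R).
  apply: measurable_funD => //; apply: measurable_funM => //.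
  exact: measurable_funB.
rewrite (ge0_integral_shear_y Dal0 mF F0 me).
have me' : measurable_fun [set: measurableTypeR R] ((fun y => - (be * y) + x0) : _ -> measurableTypeR R).
  apply: measurable_funD => //; apply: measurableT_comp => //; exact: measurable_funM.
have mG : measurable_fun [set: RR] (fun v : RR => F (v.1, D / al * v.2 + e v.1)).
  apply: (measurableT_comp mF); apply: measurable_fun_pair => //.
  apply: measurable_funD; first exact: measurable_funM.
  exact: (measurableT_comp me).
rewrite (ge0_integral_shear_x al0 mG _ me')//= muleA -EFinM -normrM divfK//.
rewrite ger0_norm ?addr_ge0 ?sqr_ge0//; congr (_ * _)%E.
apply: eq_integral => v _; congr (F (_, _)); first by ring.
by rewrite /e /D; field.
Qed.

End plane_integral.

(** * Area integrals of functions of a complex variable *)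

Section area_integral.
Context {R : realType}.
Local Notation leb := (@lebesgue_measure R).
Local Notation RR := (measurableTypeR R * measurableTypeR R)%type.
Local Notation mu := ((leb \x leb)%E).
Implicit Types (F G : R[i] -> R) (f g : R[i] -> R[i]) (a b z w : R[i]).

Definition area_int F : \bar R := (\int[mu]_v (F (v.1 +i* v.2))%:E)%E.

Definition plane_measurable F :=
  measurable_fun [set: RR] (fun v : RR => F (v.1 +i* v.2) : measurableTypeR R).

Lemma plane_measurableE F : plane_measurable F ->
  measurable_fun [set: RR] (fun v : RR => (F (v.1 +i* v.2))%:E).
Proof. by move=> mF; apply/measurable_EFinP. Qed.

Lemma plane_measurable_entire f : entire f -> plane_measurable (fun z => normc (f z)).
Proof. by move=> ef; exact: (box_cvg_measurable_fun (entire_continuous ef)). Qed.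

Lemma plane_measurable_normc : plane_measurable (@normc R).
Proof. exact: (plane_measurable_entire (@entire_id R)). Qed.

Lemma plane_measurable_cst c : plane_measurable (fun=> c).
Proof. exact: measurable_cst. Qed.

Lemma plane_measurableM F G : plane_measurable F -> plane_measurable G ->
  plane_measurable (fun z => F z * G z).
Proof. by move=> mF mG; exact: measurable_funM. Qed.

Lemma plane_measurableD F G : plane_measurable F -> plane_measurable G ->
  plane_measurable (fun z => F z + G z).
Proof. by move=> mF mG; exact: measurable_funD. Qed.

Lemma plane_measurable_comp (h : R -> R) F :
  measurable_fun [set: measurableTypeR R] (h : _ -> measurableTypeR R) ->
  plane_measurable F -> plane_measurable (fun z => h (F z)).
Proof. by move=> mh mF; exact: (measurableT_comp mh mF). Qed.

Lemma plane_measurable_powR F p : plane_measurable F ->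
  plane_measurable (fun z => F z `^ p).
Proof. by apply: (@plane_measurable_comp (@powR R ^~ p)); exact: measurable_powR. Qed.

Lemma plane_measurable_expR F : plane_measurable F ->
  plane_measurable (fun z => expR (F z)).
Proof. by apply: plane_measurable_comp; exact: measurable_expR. Qed.

Lemma plane_measurable_gauss (c : R) :
  plane_measurable (fun z => expR (- (c * normc z ^+ 2 / 2))).
Proof.
have mn := plane_measurable_normc.
have mc := plane_measurableM (plane_measurable_cst c) (plane_measurableM mn
  (plane_measurableM mn (plane_measurable_cst 2^-1))).
have -> : (fun z => expR (- (c * normc z ^+ 2 / 2))) =
    (fun z => expR (- (c * (normc z * (normc z / 2))))).
  by apply/funext => z; congr expR; rewrite expr2; ring.
by apply: (plane_measurable_expR (plane_measurable_comp (h := -%R) _ mc)).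
Qed.

Lemma plane_affineE (a b : R[i]) (v : R * R) : a * (v.1 +i* v.2) + b =
  (complex.Re a * v.1 - complex.Im a * v.2 + complex.Re b) +i*
  (complex.Im a * v.1 + complex.Re a * v.2 + complex.Im b).
Proof. by case: a b => a1 a2 [b1 b2] /=; simpc; congr (_ +i* _); ring. Qed.

Lemma plane_measurable_affine F a b : plane_measurable F ->
  plane_measurable (fun z => F (a * z + b)).
Proof.
move=> mF; rewrite /plane_measurable.
under eq_fun do rewrite plane_affineE.
apply: (measurableT_comp (f := fun v : RR => F (v.1 +i* v.2)) (g := fun v : RR =>
  (complex.Re a * v.1 - complex.Im a * v.2 + complex.Re b,
   complex.Im a * v.1 + complex.Re a * v.2 + complex.Im b) : RR) mF).
apply: measurable_fun_pair; apply: measurable_funD => //.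
  by apply: measurable_funB; exact: measurable_funM.
by apply: measurable_funD; exact: measurable_funM.
Qed.

Lemma normc_sqr z : normc z ^+ 2 = complex.Re z ^+ 2 + complex.Im z ^+ 2.
Proof. by case: z => x y /=; rewrite sqr_sqrtr// addr_ge0// sqr_ge0. Qed.

Lemma area_int_affine F a b : a != 0 -> plane_measurable F ->
  (forall z, 0 <= F z) ->
  area_int F = ((normc a ^+ 2)%:E * area_int (fun z => F (a * z + b)%R))%E.
Proof.
move=> a0 mF F0; rewrite /area_int normc_sqr.
rewrite (@ge0_integral_plane_affine _ (complex.Re a) (complex.Im a)
   (complex.Re b) (complex.Im b)).
- by congr (_ * _)%E; apply: eq_integral => v _; rewrite plane_affineE.
- rewrite -normc_sqr expf_neq0//.
  by apply: contra a0 => /eqP/eq0_normc ->.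
- exact: plane_measurableE.
- by move=> v; rewrite lee_fin.
Qed.

Lemma area_int_ge0 F : (forall z, 0 <= F z) -> (0 <= area_int F)%E.
Proof. by move=> F0; apply: integral_ge0 => v _; rewrite lee_fin. Qed.

Lemma le_area_int F G : plane_measurable F -> plane_measurable G ->
  (forall z, 0 <= F z <= G z) -> (area_int F <= area_int G)%E.
Proof.
move=> mF mG FG; apply: ge0_le_integral => //.
- by move=> v _; rewrite lee_fin; have /andP[] := FG (v.1 +i* v.2).
- exact: plane_measurableE.
- exact: plane_measurableE.
- by move=> v _; rewrite lee_fin; have /andP[] := FG (v.1 +i* v.2).
Qed.

Lemma area_intZ (c : R) F : 0 <= c -> plane_measurable F -> (forall z, 0 <= F z) ->
  area_int (fun z => c * F z) = (c%:E * area_int F)%E.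
Proof.
move=> c0 mF F0; rewrite /area_int -ge0_integralZl//.
- exact: plane_measurableE.
- by move=> v _; rewrite lee_fin.
Qed.

Lemma area_intD F G : plane_measurable F -> plane_measurable G ->
  (forall z, 0 <= F z) -> (forall z, 0 <= G z) ->
  area_int (fun z => F z + G z) = (area_int F + area_int G)%E.
Proof.
move=> mF mG F0 G0; rewrite /area_int -ge0_integralD//.
- by move=> v _; rewrite lee_fin.
- exact: plane_measurableE.
- by move=> v _; rewrite lee_fin.
- exact: plane_measurableE.
Qed.

Lemma eq_area_int F G : F =1 G -> area_int F = area_int G.
Proof. by move=> FG; apply: eq_integral => v _; rewrite FG. Qed.

Lemma integral_gauss (p : R) : 0 < p ->
  (\int[leb]_x (expR (- (p * x ^+ 2 / 2)))%:E = (Num.sqrt (2 * pi / p))%:E)%E.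
Proof.
move=> p0; pose c := Num.sqrt (p / 2).
have c0 : 0 < c by rewrite sqrtr_gt0 divr_gt0.
have c2 : c ^+ 2 = p / 2 by rewrite sqr_sqrtr// divr_ge0// ltW.
have := @ge0_integral_affine R c 0 (fun x => (gauss_fun x)%:E).
move=> /(_ _ _ _)/wrap[].
- by rewrite gt_eqF.
- by apply/measurable_EFinP; exact: measurable_gauss_fun.
- by move=> x; rewrite lee_fin gauss_fun_ge0.
rewrite integralT_gauss gtr0_norm// => E.
have -> : Num.sqrt (2 * pi / p) = c^-1 * Num.sqrt pi :> R.
  rewrite /c -sqrtrV ?divr_ge0 ?(ltW p0)// -sqrtrM ?invr_ge0 ?divr_ge0 ?(ltW p0)//.
  by congr Num.sqrt; field; rewrite gt_eqF.
rewrite EFinM E muleA -EFinM mulVf ?gt_eqF// mul1e.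
apply: eq_integral => x _; congr (expR _)%:E.
by rewrite addr0 exprMn c2; field.
Qed.

Lemma area_int_gauss (p : R) : 0 < p ->
  area_int (fun z => expR (- (p * normc z ^+ 2 / 2))) = (2 * pi / p)%:E.
Proof.
move=> p0; rewrite /area_int integral_plane_xy; last 2 first.
- exact: plane_measurableE (plane_measurable_gauss p).
- by move=> v; rewrite lee_fin expR_ge0.
have s0 : 0 <= Num.sqrt (2 * pi / p) :> R by exact: sqrtr_ge0.
have mg : measurable_fun [set: measurableTypeR R]
    (fun x : measurableTypeR R => (expR (- (p * x ^+ 2 / 2)))%:E).
  apply/measurable_EFinP/measurableT_comp => //; apply: measurableT_comp => //.
  by apply: measurable_funM => //; apply: measurable_funM.
transitivity (\int[leb]_x ((Num.sqrt (2 * pi / p))%:E * (expR (- (p * x ^+ 2 / 2)))%:E))%E.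
  apply: eq_integral => x _; rewrite /= muleC -integral_gauss// -ge0_integralZl//.
    by apply: eq_integral => y _; rewrite -EFinM -expRD -/(normc (x +i* y)) normc_sqr/=; congr (expR _)%:E; field.
rewrite ge0_integralZl//.
by rewrite integral_gauss// -EFinM -expr2 sqr_sqrtr// !mulr_ge0 ?pi_ge0// invr_ge0 ltW.
Qed.

End area_integral.

(** * The sub-mean value inequality for polynomials *)

Section submean_poly.
Context {R : realType}.
Local Notation leb := (@lebesgue_measure R).
Local Notation RR := (measurableTypeR R * measurableTypeR R)%type.
Local Notation mu := ((leb \x leb)%E).
Implicit Types (F G : R[i] -> R) (f g : R[i] -> R[i]) (a b z w : R[i]).

Lemma normc_eq0 z : (normc z == 0) = (z == 0).
Proof. by apply/eqP/eqP => [/eq0_normc|->]; rewrite ?normc0. Qed.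

Lemma normc_prod (I : Type) (r : seq I) (F : I -> R[i]) :
  normc (\prod_(i <- r) F i) = \prod_(i <- r) normc (F i).
Proof. by elim/big_rec2 : _ => [|i x y _ <-]; rewrite ?normc1// normcM. Qed.

Lemma powR_prod (I : Type) (r : seq I) (F : I -> R) p : (forall i, 0 <= F i) ->
  \prod_(i <- r) F i `^ p = (\prod_(i <- r) F i) `^ p.
Proof.
move=> F0; elim: r => [|i r IH]; first by rewrite !big_nil powR1.
by rewrite !big_cons IH powRM// prodr_ge0.
Qed.

Lemma unity_roots n : (0 < n)%N -> exists rs : n.-tuple R[i],
  (forall i, normc (tnth rs i) = 1) /\
  forall s z, \prod_(i < n) (s - tnth rs i * z) = s ^+ n - z ^+ n.
Proof.
move=> n0; have [r rE] := closed_field_poly_normal ('X^n - 1 : {poly R[i]}).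
have lc : lead_coef ('X^n - 1 : {poly R[i]}) = 1.
  by apply/eqP; rewrite -monicE monicXnsubC.
rewrite lc scale1r in rE.
have sr : size r == n.
  by have := congr1 (fun q : {poly R[i]} => size q) rE; rewrite size_prod_XsubC size_XnsubC// => -[->].
exists (Tuple sr); split => [i|s z].
  have : root ('X^n - 1 : {poly R[i]}) (tnth (Tuple sr) i).
    by rewrite rE root_prod_XsubC; exact: mem_tnth.
  rewrite rootE !hornerE subr_eq0 => /eqP /(congr1 (@normc R)).
  rewrite normcX normc1 => /eqP; rewrite pexprn_eq1//.
    by case/orP => [|/eqP//]; rewrite gtn_eqF.
  exact: Defs.normc_ge0.
have rEx x : \prod_(i < n) (x - tnth (Tuple sr) i) = x ^+ n - 1.
  have := congr1 (fun q : {poly R[i]} => q.[x]) rE.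
  rewrite !hornerE horner_prod => ->.
  rewrite (big_tuple _ _ (Tuple sr)).
  by apply: eq_bigr => i _; rewrite hornerXsubC.
have [->|z0] := eqVneq z 0.
  rewrite expr0n gtn_eqF// subr0.
  under eq_bigr do rewrite mulr0 subr0.
  by rewrite prodr_const card_ord.
have -> : s ^+ n - z ^+ n = z ^+ n * ((s / z) ^+ n - 1).
  by rewrite mulrBr mulr1 -exprMn mulrCA divff// mulr1.
rewrite -rEx -[in z ^+ n](card_ord n) -prodr_const -big_split/=.
by apply: eq_bigr => i _; rewrite mulrBr mulrCA divff// mulr1 mulrC.
Qed.

(** The relative distance of [|z|] to the modulus of the root [s], truncated so that
    its powers [gap s z `^ (p / n)] increase to [1] with [n] where it is positive;
    it bounds [|s^n - z^n| / |s|^n] from below for every [n > 0]. *)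
Definition gap s z : R := Num.min 1 (`|normc z - normc s| / normc s).

Lemma gap_ge0 s z : 0 <= gap s z.
Proof. by rewrite le_min ler01 mulr_ge0// invr_ge0 Defs.normc_ge0. Qed.

Lemma gap_le1 s z : gap s z <= 1.
Proof. by rewrite ge_min lexx. Qed.

Lemma ler_subrX (x y : R) n : 0 <= x -> 0 <= y -> (0 < n)%N ->
  `|y - x| * x ^+ n.-1 <= `|x ^+ n - y ^+ n|.
Proof.
move=> x0 y0; case: n => // n _ /=.
rewrite subrXX normrM distrC ler_wpM2l//.
rewrite ger0_norm; last by rewrite sumr_ge0// => i _; rewrite mulr_ge0// exprn_ge0.
rewrite big_ord_recl subn0 expr0 mulr1 lerDl.
by rewrite sumr_ge0// => i _; rewrite mulr_ge0// exprn_ge0.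
Qed.

Lemma normc_subX_ge s z n : s != 0 -> (0 < n)%N ->
  normc s ^+ n * gap s z <= normc (s ^+ n - z ^+ n).
Proof.
move=> s0 n0; have sn : 0 < normc s by rewrite lt_neqAle Defs.normc_ge0 andbT eq_sym normc_eq0.
apply: le_trans (_ : `|normc (s ^+ n) - normc (z ^+ n)| <= _); last exact: ler_dist_normc.
rewrite !normcX; apply: le_trans (ler_subrX _ _ n0); rewrite ?Defs.normc_ge0//.
case: n n0 => // n _ /=; rewrite exprSr -mulrA mulrC ler_wpM2r ?exprn_ge0 ?Defs.normc_ge0//.
by rewrite mulrC -ler_pdivlMr// ge_min lexx orbT.
Qed.

Lemma prod_rotations_ge (P : {poly R[i]}) (c : R[i]) (r : seq R[i]) n (rs : n.-tuple R[i]) z :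
  (0 < n)%N -> P = c *: \prod_(s <- r) ('X - s%:P) -> 0 \notin r ->
  (forall s z, \prod_(i < n) (s - tnth rs i * z) = s ^+ n - z ^+ n) ->
  normc P.[0] ^+ n * \prod_(s <- r) gap s z <=
  \prod_(i < n) normc P.[tnth rs i * z].
Proof.
move=> n0 PE r0 rsE.
have PxE x : normc P.[x] = normc c * \prod_(s <- r) normc (s - x).
  rewrite PE hornerZ horner_prod normcM normc_prod; congr (_ * _).
  by apply: eq_bigr => s _; rewrite hornerXsubC normcB.
under [leRHS]eq_bigr do rewrite PxE.
rewrite big_split /= prodr_const card_ord exchange_big/=.
rewrite PxE exprMn -mulrA ler_wpM2l ?exprn_ge0 ?Defs.normc_ge0//.
rewrite -prodrXl -big_split/=; rewrite big_seq [leRHS]big_seq; apply: ler_prod => s sr.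
rewrite subr0 mulr_ge0 ?exprn_ge0 ?Defs.normc_ge0 ?gap_ge0//=.
rewrite -normc_prod rsE; apply: normc_subX_ge => //.
by apply: contra r0 => /eqP <-.
Qed.

(** The arithmetic-geometric mean inequality for the [p]-th powers of the values of
    [P] at the rotations of [z]. *)
Lemma geometric_mean_rotations_le (P : {poly R[i]}) (c : R[i]) (r : seq R[i]) n
    (rs : n.-tuple R[i]) z (p : R) :
  0 < p -> (0 < n)%N -> P = c *: \prod_(s <- r) ('X - s%:P) -> 0 \notin r ->
  (forall s z, \prod_(i < n) (s - tnth rs i * z) = s ^+ n - z ^+ n) ->
  normc P.[0] `^ p * (\prod_(s <- r) gap s z) `^ (p / n%:R) <=
  n%:R^-1 * \sum_(i < n) normc P.[tnth rs i * z] `^ p.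
Proof.
move=> p0 n0 PE r0 rsE.
have nR0 : n%:R != 0 :> R by rewrite pnatr_eq0 -lt0n.
set k := \prod_(s <- r) gap s z; have k0 : 0 <= k.
  by rewrite prodr_ge0// => s _; exact: gap_ge0.
have N0 x : 0 <= normc P.[x] by exact: Defs.normc_ge0.
have := prod_rotations_ge z n0 PE r0 rsE; rewrite -/k => H.
set S := _ * \sum_(_ < _) _.
have S0 : 0 <= S.
  by rewrite mulr_ge0 ?invr_ge0// sumr_ge0// => i _; exact: powR_ge0.
have agm : (normc P.[0] ^+ n * k) `^ p <= S ^+ n.
  apply: le_trans (_ : (\prod_(i < n) normc P.[tnth rs i * z]) `^ p <= _).
    apply: ge0_ler_powR => //; first exact: ltW.
    - by rewrite nnegrE mulr_ge0// exprn_ge0.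
    - by rewrite nnegrE prodr_ge0.
  rewrite -powR_prod//.
  have [+ _] := @leif_AGM R _ (mem 'I_n) (fun i : 'I_n => normc P.[tnth rs i * z] `^ p)
    (fun _ _ => powR_ge0 _ _).
  by rewrite card_ord [in X in _ <= X -> _]mulrC.
have -> : normc P.[0] `^ p * k `^ (p / n%:R) = ((normc P.[0] ^+ n * k) `^ p) `^ n%:R^-1.
  rewrite -powRrM powRM ?exprn_ge0//; congr (_ * _).
  by rewrite -powR_mulrn// -powRrM mulrCA divff// mulr1.
have -> : S = (S ^+ n) `^ n%:R^-1 by rewrite -powR_mulrn// -powRrM divff// powRr1.
apply: ge0_ler_powR => //; rewrite ?nnegrE ?powR_ge0 ?exprn_ge0//.
Qed.

Lemma plane_measurable_gap s : plane_measurable (fun z : R[i] => gap s z).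
Proof.
apply: (measurable_minr (f := fun=> 1)); first exact: measurable_cst.
apply: measurable_funM => //; apply: measurableT_comp => //.
by apply: measurable_funB => //; exact: plane_measurable_normc.
Qed.

Lemma plane_measurable_prod (I : Type) (r : seq I) (h : I -> R[i] -> R) :
  (forall i, plane_measurable (h i)) ->
  plane_measurable (fun z => \prod_(i <- r) h i z).
Proof.
move=> mh; elim: r => [|i r IH].
  under eq_fun do rewrite big_nil; exact: measurable_cst.
rewrite (_ : (fun z => _) = fun z => h i z * \prod_(i <- r) h i z).
  exact: plane_measurableM.
by apply/funext => z; rewrite big_cons.
Qed.

Lemma plane_measurable_sum (I : Type) (r : seq I) (h : I -> R[i] -> R) :
  (forall i, plane_measurable (h i)) ->
  plane_measurable (fun z => \sum_(i <- r) h i z).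
Proof.
move=> mh; elim: r => [|i r IH].
  under eq_fun do rewrite big_nil; exact: measurable_cst.
rewrite (_ : (fun z => _) = fun z => h i z + \sum_(i <- r) h i z).
  exact: plane_measurableD.
by apply/funext => z; rewrite big_cons.
Qed.

Lemma area_int_sum (I : Type) (r : seq I) (h : I -> R[i] -> R) :
  (forall i, plane_measurable (h i)) -> (forall i z, 0 <= h i z) ->
  area_int (fun z => \sum_(i <- r) h i z) = (\sum_(i <- r) area_int (h i))%E.
Proof.
move=> mh h0; elim: r => [|i r IH].
  by rewrite big_nil /area_int integral0_eq// => v _; rewrite big_nil.
rewrite big_cons -IH -area_intD//.
- by apply: eq_area_int => z; rewrite big_cons.
- exact: plane_measurable_sum.
- by move=> z; rewrite sumr_ge0.
Qed.

(** Each vertical line meets a circle in at most two points. *)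
Lemma circle_null (rho : R) : mu [set v : R * R | normc (v.1 +i* v.2) = rho] = 0.
Proof.
rewrite /product_measure1 /=; apply: integral0_eq => x _.
apply: countable_lebesgue_measure0; apply: finite_set_countable.
apply: (@sub_finite_set _ _ [set Num.sqrt (rho ^+ 2 - x ^+ 2); - Num.sqrt (rho ^+ 2 - x ^+ 2)]).
  move=> y /xsectionP /= xyr; set s := Num.sqrt _.
  have y2 : y ^+ 2 = s ^+ 2.
    have e : rho ^+ 2 - x ^+ 2 = y ^+ 2.
      by rewrite -xyr sqr_sqrtr ?addr_ge0 ?sqr_ge0//; ring.
    by rewrite /s e sqrtr_sqr real_normK ?num_real.
  by move/eqP : y2; rewrite eqf_sqr => /orP[] /eqP; [left|right].
exact: finite_set2.
Qed.

Lemma entire_horner (P : {poly R[i]}) : entire (horner P).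
Proof.
elim/poly_ind: P => [|P c IH] z.
  rewrite (_ : horner 0 = fun=> 0); first exact: derivable_cst.
  by apply/funext => x; rewrite horner0.
rewrite (_ : horner (P * 'X + c%:P) = fun x => P.[x] * x + c).
  apply: (@derivableD R[i] R[i]^o R[i]^o); last exact: derivable_cst.
  by apply: (@derivableM R[i] R[i]^o); [exact: IH|exact: derivable_id].
by apply/funext => x; rewrite hornerMXaddC.
Qed.

Lemma powR_inv_cvg1 (k p : R) : 0 < k -> (k `^ (p / n.+1%:R)) @[n --> \oo] --> (1 : R).
Proof.
move=> k0.
have -> : (fun n => k `^ (p / n.+1%:R)) = (fun n => expR (p * ln k * n.+1%:R^-1)).
  by apply/funext => n; rewrite /powR gt_eqF//; congr expR; ring.
have lim0 : (fun n => p * ln k * n.+1%:R^-1) @ \oo --> (0 : R).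
  rewrite -[X in _ --> X](mulr0 (p * ln k)).
  by apply: cvgM; [exact: cvg_cst|exact: cvg_harmonic].
by rewrite -[X in _ --> X](@expR0 R); exact: cvg_comp lim0 (@continuous_expR R 0).
Qed.

Lemma ge0_sume_const (x : \bar R) n : (0 <= x)%E ->
  (\sum_(i < n) x = n%:R%:E * x)%E.
Proof.
move=> x0; elim: n => [|n IH]; first by rewrite big_ord0 mul0e.
rewrite big_ord_recr IH /= -[X in (_ + X)%E]mul1e -ge0_muleDl ?lee_fin//.
by rewrite -EFinD natr1.
Qed.

Lemma circle_negligible (rho : R) :
  mu.-negligible [set v : RR | normc (v.1 +i* v.2) = rho].
Proof.
exists [set v : RR | normc (v.1 +i* v.2) = rho]; split => //; last exact: circle_null.
rewrite -[X in measurable X]setTI.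
exact: (@plane_measurable_normc R measurableT [set rho] (measurable_set1 _)).
Qed.

Lemma gap_prod_negligible (r : seq R[i]) : 0 \notin r ->
  mu.-negligible [set v : RR | \prod_(s <- r) gap s (v.1 +i* v.2) = 0].
Proof.
elim: r => [_|s r IH].
  rewrite (_ : [set v | _] = set0); first exact: negligible_set0.
  by apply/seteqP; split => // v /=; rewrite big_nil => /eqP; rewrite oner_eq0.
rewrite inE negb_or eq_sym => /andP[s0 r0].
apply: negligibleS (negligibleU (circle_negligible (normc s)) (IH r0)).
move=> v /=; rewrite big_cons => /eqP; rewrite mulf_eq0 => /orP[|/eqP]; last by right.
rewrite /gap => H; left; apply/eqP.
rewrite -subr_eq0 -normr_eq0; move: H; rewrite /Order.min; case: ifP => _.
  by rewrite oner_eq0.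
by rewrite mulf_eq0 invr_eq0 normc_eq0 (negbTE s0) orbF.
Qed.

(** As the weight is radial, [|P|^p] may be replaced by its mean over the rotations
    by [n]-th roots of unity.  That mean is at least
    [|P(0)|^p * k(z)^(p/n)], with [k] the product of the gaps, and [k(z)^(p/n)]
    increases to [1] outside of the finitely many circles through the roots. *)
Lemma submean_poly (P : {poly R[i]}) (W : R[i] -> R) (p : R) : 0 < p ->
  plane_measurable W -> (forall z, 0 <= W z) ->
  (forall u z, normc u = 1 -> W (u * z) = W z) ->
  ((normc P.[0%R] `^ p)%:E * area_int W <=
   area_int (fun z => normc P.[z] `^ p * W z)%R)%E.
Proof.
move=> p0 mW W0 Wrot.
have mPW : plane_measurable (fun z => normc P.[z] `^ p * W z).
  exact: (plane_measurableM (plane_measurable_powR p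
    (plane_measurable_entire (@entire_horner P))) mW).
have PW0 z : 0 <= normc P.[z] `^ p * W z by rewrite mulr_ge0// powR_ge0.
have [P00|P00] := eqVneq P.[0] 0.
  by rewrite P00 normc0 powR0 ?gt_eqF// mul0e; exact: area_int_ge0.
have [r PE] := closed_field_poly_normal P.
have r0 : 0 \notin r.
  apply: contra P00; rewrite -root_prod_XsubC rootE => /eqP r0.
  by rewrite PE hornerZ r0 mulr0.
pose k z := \prod_(s <- r) gap s z.
have k0 z : 0 <= k z by rewrite prodr_ge0// => s _; exact: gap_ge0.
have k1 z : k z <= 1.
  by rewrite /k; apply: prodr_ile1 => s _; rewrite gap_ge0 gap_le1.
have mk : plane_measurable k.
  by apply: plane_measurable_prod => s; exact: plane_measurable_gap.
pose A := normc P.[0] `^ p.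
have A0 : 0 < A.
  by rewrite powR_gt0// lt_neqAle Defs.normc_ge0 andbT eq_sym normc_eq0.
pose g n z := k z `^ (p / n.+1%:R) * W z.
have mg n : plane_measurable (g n).
  exact: (plane_measurableM (plane_measurable_powR _ mk) mW).
have g0 n z : 0 <= g n z by rewrite mulr_ge0// powR_ge0.
pose I := area_int (fun z => normc P.[z] `^ p * W z).
have step n : (A%:E * area_int (g n) <= I)%E.
  have [rs [rs1 rsE]] := @unity_roots n.+1 isT.
  have mh i : plane_measurable (fun z => normc P.[tnth rs i * z] `^ p * W z).
    have := plane_measurable_affine (tnth rs i) 0 mPW.
    by under eq_fun do rewrite addr0 Wrot//.
  have h0 i z : 0 <= normc P.[tnth rs i * z] `^ p * W z.
    by rewrite mulr_ge0// powR_ge0.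
  have hI i : area_int (fun z => normc P.[tnth rs i * z] `^ p * W z) = I.
    rewrite /I [in RHS](@area_int_affine _ _ (tnth rs i) 0)//.
      rewrite rs1 expr1n mul1e; apply: eq_area_int => z.
      by rewrite addr0 Wrot.
    by rewrite -normc_eq0 rs1 oner_neq0.
  rewrite -area_intZ ?(ltW A0)//.
  apply: (@le_trans _ _ (area_int (fun z => n.+1%:R^-1 *
      \sum_(i < n.+1) normc P.[tnth rs i * z] `^ p * W z))).
    apply: le_area_int.
    - exact: (plane_measurableM (plane_measurable_cst _) (mg n)).
    - exact: (plane_measurableM (plane_measurable_cst _) (plane_measurable_sum _ mh)).
    - move=> z; rewrite mulr_ge0 ?(ltW A0)//= -mulr_suml !mulrA ler_wpM2r//.
      exact: geometric_mean_rotations_le PE r0 rsE.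
  rewrite area_intZ ?invr_ge0//; last 2 first.
  - exact: plane_measurable_sum.
  - by move=> z; rewrite sumr_ge0.
  rewrite area_int_sum// (eq_bigr (fun=> I)) => [|i _]; last exact: hI.
  by rewrite ge0_sume_const ?muleA -?EFinM ?mulVf ?mul1e//; exact: area_int_ge0.
have mono z : {homo (fun n => (g n z)%:E) : n m / (n <= m)%N >-> (n <= m)%E}.
  move=> n m nm; rewrite lee_fin ler_wpM2r//.
  have [kz0|kz0] := eqVneq (k z) 0.
    by rewrite kz0 !powR0// mulf_neq0// ?gt_eqF// invr_gt0.
  apply: ger_powR; first by rewrite k1 lt_neqAle eq_sym kz0 k0.
  by rewrite ler_pM2l// lef_pV2 ?posrE// ler_nat.
pose G (v : RR) := limn (fun n => (g n (v.1 +i* v.2))%:E).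
have GE v : 0 < k (v.1 +i* v.2) -> G v = (W (v.1 +i* v.2))%:E.
  move=> kz0; apply/cvg_lim => //; apply: cvg_EFin.
    by near=> n.
  rewrite -[X in _ --> X]mul1r; apply: cvgM; last exact: cvg_cst.
  exact: powR_inv_cvg1.
have cvI : ((area_int (g n)) @[n --> \oo] --> (\int[mu]_v G v)%E).
  apply: (@cvg_monotone_convergence _ _ _ mu setT measurableT
    (fun n v => (g n (v.1 +i* v.2))%:E)).
  - by move=> n; exact: plane_measurableE.
  - by move=> n v _; rewrite lee_fin.
  - by move=> v _; exact: mono.
have aeG : (\int[mu]_v (W (v.1 +i* v.2))%:E = \int[mu]_v G v)%E.
  apply: ae_eq_integral => //.
  - exact: plane_measurableE.
  - apply: (emeasurable_fun_cvg (fun n v => (g n (v.1 +i* v.2))%:E)) => //.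
      by move=> n; exact: plane_measurableE.
    move=> v _; apply: ereal_nondecreasing_is_cvgn.
    exact: mono.
  - apply: (negligibleS _ (gap_prod_negligible r0)) => v /=.
    move=> H; apply/eqP; rewrite eq_le k0 andbT leNgt; apply/negP => kz0.
    by apply: H => _; rewrite GE.
rewrite [area_int W]aeG.
have : (A%:E * \int[mu]_v G v <= I)%E.
  rewrite -(cvg_lim _ cvI)// -limeMl//; last first.
    by apply/cvg_ex; exists (\int[mu]_v G v)%E.
  apply: lime_le; last by near=> n; exact: step.
  by apply: is_cvgeMl => //; apply/cvg_ex; exists (\int[mu]_v G v)%E.
by [].
Unshelve. all: by end_near.
Qed.

End submean_poly.

(** * The sub-mean value inequality for entire functions *)

Section submean_entire.
Context {R : realType}.
Local Notation leb := (@lebesgue_measure R).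
Local Notation RR := (measurableTypeR R * measurableTypeR R)%type.
Local Notation mu := ((leb \x leb)%E).
Implicit Types (f g : R[i] -> R[i]) (z w : R[i]).

Lemma entire_bounded_disc f (rho : R) : entire f ->
  exists K, forall z, normc z <= rho -> normc (f z) <= K.
Proof.
move=> ef; have [rho0|rho0] := ltP rho 0.
  by exists 0 => z; rewrite leNgt (lt_le_trans rho0 (Defs.normc_ge0 z)).
pose h (v : R * R) := normc (f (v.1 +i* v.2)).
pose A : set (R * R) := `[- rho, rho]%classic `*` `[- rho, rho]%classic.
have [|||v _ vP] := @compact_EVT_max _ R h A.
- by exists (0, 0); split; rewrite /= in_itv/= oppr_le0 rho0.
- by apply: compact_setX; exact: segment_compact.
- apply: continuous_subspaceT => v; apply/cvgrPdist_lt => e e0.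
  have [d d0 dP] := entire_continuous ef v e0.
  exists (ball v.1 d, ball v.2 d); first by split; exact: nbhsx_ballx.
  move=> w [/= w1 w2]; rewrite distrC; apply: dP; rewrite distrC.
    exact: w1.
  exact: w2.
exists (h v) => -[x y] xy; apply: (vP (x, y)).
rewrite inE; split; rewrite /= in_itv/= -ler_norml.
  exact: le_trans (normr_Re_le (x +i* y)) xy.
exact: le_trans (normr_Im_le (x +i* y)) xy.
Qed.

Lemma cvg_powR (u : nat -> R) (l p : R) : 0 < p -> (forall n, 0 <= u n) ->
  u n @[n --> \oo] --> l -> (u n `^ p) @[n --> \oo] --> l `^ p.
Proof.
move=> p0 u0 ul.
have l0 : 0 <= l.
  by rewrite -(cvg_lim _ ul)//; apply: limr_ge; [apply/cvg_ex; exists l|near=> n].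
move: l0; rewrite le_eqVlt => /predU1P[l0|l0].
  rewrite -l0 powR0 ?gt_eqF//; rewrite -l0 in ul; apply/cvgrPdist_le => e e0.
  have e1 : 0 < e `^ p^-1 by rewrite powR_gt0.
  move/cvgrPdist_le: ul => /(_ _ e1); apply: filterS => n.
  rewrite !sub0r !normrN !ger0_norm ?powR_ge0// => une.
  have -> : e = (e `^ p^-1) `^ p by rewrite -powRrM mulVf ?gt_eqF// powRr1// ltW.
  by apply: ge0_ler_powR; rewrite ?nnegrE// ltW.
have lnu : ln (u n) @[n --> \oo] --> ln l.
  exact: cvg_comp ul (continuous_ln l0).
have -> : l `^ p = expR (p * ln l) by rewrite /powR gt_eqF.
have H : expR (p * ln (u n)) @[n --> \oo] --> expR (p * ln l).
  apply: (cvg_comp (fun n => p * ln (u n)) expR _ (@continuous_expR R _)).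
  by apply: cvgM; [exact: cvg_cst|exact: lnu].
apply: cvg_trans H; apply: near_eq_cvg.
move/cvgrPdist_lt : ul => /(_ _ l0); apply: filterS => n H.
rewrite /powR gt_eqF//; rewrite ltr_norml in H; lra.
Unshelve. all: by end_near.
Qed.

Definition disc_weight (p rho : R) z : R :=
  (normc z <= rho)%R%:R * expR (- (p * normc z ^+ 2 / 2)).

Lemma disc_weight_ge0 p rho z : 0 <= disc_weight p rho z.
Proof. by rewrite mulr_ge0// expR_ge0. Qed.

Lemma plane_measurable_disc (rho : R) :
  plane_measurable (fun z => (normc z <= rho)%R%:R : R).
Proof.
have mn := @plane_measurable_normc R.
have mE : measurable [set v : RR | normc (v.1 +i* v.2) <= rho].
  rewrite (_ : [set v | _] = (fun v : RR => normc (v.1 +i* v.2)) @^-1` `]-oo, rho]).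
    by rewrite -[X in measurable X]setTI; apply: mn.
  by apply/seteqP; split => v /=; rewrite in_itv.
rewrite /plane_measurable (_ : (fun v => _) = \1_[set v : RR | normc (v.1 +i* v.2) <= rho]).
  exact: measurable_indic.
by apply/funext => v; rewrite indicE; congr ((nat_of_bool _)%:R); apply/idP/idP; rewrite inE.
Qed.

Lemma plane_measurable_disc_weight p rho :
  plane_measurable (fun z : R[i] => disc_weight p rho z).
Proof.
exact: (plane_measurableM (plane_measurable_disc rho) (plane_measurable_gauss p)).
Qed.

Lemma disc_weight_le p rho z : disc_weight p rho z <= expR (- (p * normc z ^+ 2 / 2)).
Proof. by rewrite /disc_weight ler_piMl ?expR_ge0//; case: (normc z <= rho). Qed.

(** On a disc the Taylor polynomials converge uniformly, and they have the same
    value at the origin. *)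
Lemma submean_disc f (p rho : R) : entire f -> 0 < p -> 0 < rho ->
  ((normc (f 0%R) `^ p)%:E * area_int (disc_weight p rho) <=
   area_int (fun z => normc (f z) `^ p * disc_weight p rho z)%R)%E.
Proof.
move=> ef p0 rho0; pose r := 2 * rho.
have r0 : 0 < r by rewrite mulr_gt0.
have [K0 K0P] := entire_bounded_disc (2 * r) ef.
pose K := Num.max 0 K0.
have KP z : normc z <= 2 * r -> normc (f z) <= K.
  by move=> /K0P /le_trans; apply; rewrite le_max lexx orbT.
have K_ge0 : 0 <= K by rewrite le_max lexx.
have [a [_ aP]] := taylor_approx ef r0 KP.
pose T n : {poly R[i]} := \poly_(k < n.+1) a k.
have TE n w : (T n).[w] = \sum_(k < n.+1) a k * w ^+ k by rewrite horner_poly.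
have T0 n : (T n).[0] = f 0.
  have := aP 0 n.+1; rewrite normc0 => /(_ r0).
  rewrite mul0r expr0n/= mulr0 mul0r TE => H.
  apply/esym/eqP; rewrite -subr_eq0; apply/eqP/eq0_normc/eqP.
  by rewrite eq_le H Defs.normc_ge0.
pose e n : R := 16 * K * (2^-1) ^+ n.+1.
have Te n w : normc w <= rho -> normc (f w - (T n).[w]) <= e n.
  move=> wr; have wr' : normc w < r by apply: le_lt_trans wr _; rewrite /r; lra.
  rewrite TE; apply: le_trans (aP w n.+1 wr') _.
  have -> : e n = 8 * K * (2^-1) ^+ n.+1 * 2 by rewrite /e; ring.
  have w2 : normc w / r <= 2^-1 by rewrite ler_pdivrMr// /r; lra.
  have w3 : r / (r - normc w) <= 2.
    by rewrite ler_pdivrMr ?subr_gt0// /r; lra.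
  have q0 : 0 <= normc w / r by rewrite divr_ge0 ?Defs.normc_ge0// ltW.
  apply: ler_pM => //.
  - by apply: mulr_ge0; [rewrite mulr_ge0|exact: exprn_ge0].
  - by apply: divr_ge0; rewrite ?subr_ge0 ltW.
  - by apply: ler_wpM2l; [rewrite mulr_ge0|apply: lerXn2r; rewrite ?nnegrE].
have e_cvg : e n @[n --> \oo] --> (0 : R).
  rewrite /e -(mulr0 (16 * K)); apply: cvgM; first exact: cvg_cst.
  have H : (2^-1 : R) ^+ n @[n --> \oo] --> (0 : R).
    by apply: cvg_expr; rewrite ger0_norm// invf_lt1// ltr1n.
  by move: H; rewrite -(cvg_shiftS (fun n => (2^-1 : R) ^+ n)).
have Tcvg w : normc w <= rho -> normc (T n).[w] @[n --> \oo] --> normc (f w).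
  move=> wr; apply/cvgrPdist_le => d d0; move/cvgrPdist_le : e_cvg => /(_ _ d0).
  apply: filterS => n; rewrite sub0r normrN => end_.
  apply: le_trans (ler_dist_normc _ _) _; apply: le_trans (Te _ _ wr) _.
  exact: le_trans (ler_norm _) end_.
pose M := K + 16 * K.
have TM n w : normc w <= rho -> normc (T n).[w] <= M.
  move=> wr; have -> : (T n).[w] = f w - (f w - (T n).[w]) by rewrite subKr.
  apply: le_trans (le_normcD _ _) _; rewrite normcN; apply: lerD.
    by apply: KP; apply: le_trans wr _; rewrite /r; lra.
  apply: le_trans (Te _ _ wr) _; rewrite /e ler_piMr ?mulr_ge0//.
  by rewrite exprn_ile1// invf_le1// ler1n.
have mT n := @plane_measurable_entire R _ (@entire_horner R (T n)).
have mW := plane_measurable_disc_weight p rho.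
have [|||||_ _ H] := @dominated_convergence _ _ _ mu setT measurableT
  (fun n v => (normc (T n).[v.1 +i* v.2] `^ p * disc_weight p rho (v.1 +i* v.2))%:E)
  (fun v => (normc (f (v.1 +i* v.2)) `^ p * disc_weight p rho (v.1 +i* v.2))%:E)
  (fun v => (M `^ p * expR (- (p * normc (v.1 +i* v.2) ^+ 2 / 2)))%:E).
- move=> n; exact: (plane_measurableE
    (plane_measurableM (plane_measurable_powR p (mT n)) mW)).
- exact: (plane_measurableE
    (plane_measurableM (plane_measurable_powR p (plane_measurable_entire ef)) mW)).
- apply: aeW => v _; apply: cvg_EFin; first by near=> n.
  rewrite /disc_weight; case: (leP (normc (v.1 +i* v.2)) rho) => vr; last first.
    by rewrite mul0r mulr0; under eq_fun do rewrite mulr0; exact: cvg_cst.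
  apply: cvgM; last exact: cvg_cst.
  by apply: cvg_powR => //; [move=> n; exact: Defs.normc_ge0|exact: Tcvg].
- apply/integrableP; split.
    exact: (plane_measurableE
      (plane_measurableM (plane_measurable_cst _) (plane_measurable_gauss p))).
  under eq_integral do rewrite gee0_abs ?lee_fin ?mulr_ge0 ?powR_ge0 ?expR_ge0//.
  rewrite -/(area_int (fun z => M `^ p * expR (- (p * normc z ^+ 2 / 2)))).
  rewrite area_intZ ?powR_ge0//; last exact: (plane_measurable_gauss p).
  by rewrite area_int_gauss// -EFinM ltry.
- apply: aeW => v n _; rewrite gee0_abs ?lee_fin ?mulr_ge0 ?powR_ge0 ?disc_weight_ge0//.
  rewrite /disc_weight; case: (leP (normc (v.1 +i* v.2)) rho) => vr; last first.
    by rewrite mul0r mulr0 mulr_ge0 ?powR_ge0 ?expR_ge0.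
  rewrite mul1r ler_wpM2r ?expR_ge0//; apply: ge0_ler_powR; rewrite ?nnegrE ?Defs.normc_ge0 ?(ltW p0)//.
    by rewrite /M addr_ge0// mulr_ge0.
  exact: TM.
rewrite [leRHS]/area_int -(cvg_lim _ H)//; apply: lime_ge; first by apply/cvg_ex; eexists; exact: H.
near=> n; rewrite -(T0 n); apply: submean_poly => //.
- by move=> z; exact: disc_weight_ge0.
- by move=> u z u1; rewrite /disc_weight normcM u1 mul1r.
Unshelve. all: by end_near.
Qed.

End submean_entire.

(** * The complex exponential *)

Section complex_exponential.
Context {R : realType}.
Implicit Types (f g : R[i] -> R[i]) (a b z w h l : R[i]).

Definition expC z : R[i] :=
  (expR (complex.Re z) * cos (complex.Im z)) +i*
  (expR (complex.Re z) * sin (complex.Im z)).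

Lemma expCD z w : expC (z + w) = expC z * expC w.
Proof.
case: z w => x y [u v]; rewrite /expC /= expRD cosD sinD.
by simpc; congr (_ +i* _); ring.
Qed.

Lemma normc_expC z : normc (expC z) = expR (complex.Re z).
Proof.
case: z => x y; rewrite /expC /= !exprMn -mulrDr cos2Dsin2 mulr1 sqrtr_sqr.
by rewrite ger0_norm// expR_ge0.
Qed.

Lemma is_derive0_approx (g : R -> R) (l : R) : is_derive (0 : R) (1 : R) g l ->
  forall e, 0 < e -> exists2 d, 0 < d &
    forall u, `|u| < d -> `|g u - g 0 - l * u| <= e * `|u|.
Proof.
move=> [gd gl] e e0.
have : h^-1 *: ((g \o shift 0) (h *: (1 : R)) - g 0) @[h --> 0^'] --> l.
  by rewrite -gl; exact: gd.
move=> /cvgrPdist_le /(_ _ e0); rewrite near_withinE => /nbhs_ballP[d /= d0 dP].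
exists d => // u ud; have [->|u0] := eqVneq u 0.
  by rewrite subrr mulr0 subr0 normr0 mulr0.
have := dP u; rewrite /ball/= sub0r normrN => /(_ ud u0).
rewrite /GRing.scale /= mulr1 addr0 => H.
rewrite -ler_pdivrMr ?normr_gt0// -normfV -normrM mulrBl.
by rewrite -mulrA divff// mulr1 -normrN opprB mulrC.
Qed.

Lemma has_cderiv_expC z : has_cderiv expC z (expC z).
Proof.
move=> e' e'0; have n0 : 0 < normc (expC z) by rewrite normc_expC expR_gt0.
(* [7] bounds the sum of the coefficients in [B1] and [B2] below *)
have [e [e0 e1 ee']] : exists e : R,
    [/\ 0 < e, e <= 1 & e <= e' / (7 * normc (expC z))].
  exists (Num.min 1 (e' / (7 * normc (expC z)))); split.
  - by rewrite lt_min ltr01 divr_gt0// mulr_gt0.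
  - by rewrite ge_min lexx.
  - by rewrite ge_min lexx orbT.
have [d1 d10 P1] := is_derive0_approx (is_derive_expR 0) e0.
have [d2 d20 P2] := is_derive0_approx (is_derive_cos 0) e0.
have [d3 d30 P3] := is_derive0_approx (is_derive_sin 0) e0.
pose d := Num.min (Num.min d1 d2) (Num.min d3 e).
have d0 : 0 < d by rewrite !lt_min d10 d20 d30.
exists d => // -[u v]; rewrite !lt_min => /andP[/andP[h1 h2] /andP[h3 h4]].
have hu := normr_Re_le (u +i* v); have hv := normr_Im_le (u +i* v).
rewrite /= -/(normc (u +i* v)) in hu hv.
have {P1} := P1 u (le_lt_trans hu h1); rewrite expR0 mul1r => P1.
have {P2} := P2 v (le_lt_trans hv h2); rewrite cos0 sin0 oppr0 mul0r subr0 => P2.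
have {P3} := P3 v (le_lt_trans hv h3); rewrite sin0 cos0 mul1r subr0 => P3.
have u1 : `|u| <= e by apply: le_trans hu (ltW h4).
rewrite expCD (_ : _ - _ - _ = expC z * (expC (u +i* v) - 1 - (u +i* v))); last by ring.
rewrite normcM.
have -> : expC (u +i* v) - 1 - (u +i* v) = (expR u * cos v - 1 - u) +i* (expR u * sin v - v).
  by rewrite /expC /=; congr (_ +i* _); rewrite subr0.
have U : `|1 + u| <= 2.
  by apply: le_trans (ler_normD _ _) _; rewrite normr1; lra.
have c1 : `|cos v| <= 1 by rewrite ler_norml cos_geN1 cos_le1.
have s1 : `|sin v| <= 1 by rewrite ler_norml sin_geN1 sin_le1.
have B1 : `|expR u * cos v - 1 - u| <= e * `|u| * 1 + 2 * (e * `|v|).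
  have -> : expR u * cos v - 1 - u = (expR u - 1 - u) * cos v + (1 + u) * (cos v - 1) by ring.
  by apply: le_trans (ler_normD _ _) _; rewrite !normrM; apply: lerD; apply: ler_pM.
have B2 : `|expR u * sin v - v| <= e * `|u| * 1 + (2 * (e * `|v|) + e * `|v|).
  have -> : expR u * sin v - v = (expR u - 1 - u) * sin v + ((1 + u) * (sin v - v) + u * v) by ring.
  apply: le_trans (ler_normD _ _) _; rewrite !normrM; apply: lerD; first exact: ler_pM.
  apply: le_trans (ler_normD _ _) _; rewrite !normrM; apply: lerD; first exact: ler_pM.
  exact: ler_wpM2r.
apply: le_trans (_ : normc (expC z) * (e * (7 * normc (u +i* v))) <= _).
  rewrite ler_wpM2l ?Defs.normc_ge0//; apply: le_trans (normc_leD _ _) _.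
  apply: le_trans (lerD B1 B2) _.
  rewrite [leLHS](_ : _ = e * (2 * `|u| + 5 * `|v|)); last by ring.
  by rewrite ler_wpM2l ?(ltW e0)//; lra.
rewrite [leLHS](_ : _ = e * (7 * normc (expC z)) * normc (u +i* v)); last by ring.
by rewrite ler_wpM2r ?Defs.normc_ge0// -ler_pdivlMr ?mulr_gt0.
Qed.

Lemma has_cderiv_comp_affine f a b z l : has_cderiv f (a * z + b) l ->
  has_cderiv (fun z => f (a * z + b)) z (l * a).
Proof.
move=> fl e e0; have k0 : 0 < 1 + normc a by rewrite ltr_wpDr ?Defs.normc_ge0.
have [d d0 dP] := fl (e / (1 + normc a)) (divr_gt0 e0 k0).
exists (d / (1 + normc a)); first by rewrite divr_gt0.
move=> h; rewrite ltr_pdivlMr// => hd.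
have ah : normc (a * h) <= normc h * (1 + normc a).
  by rewrite normcM mulrC ler_wpM2l ?Defs.normc_ge0// lerDr.
have := dP (a * h) (le_lt_trans ah hd).
rewrite (_ : a * (z + h) + b = a * z + b + a * h); last by ring.
rewrite mulrA => /le_trans; apply.
by rewrite mulrAC ler_pdivrMr// -mulrA ler_wpM2l// ltW.
Qed.

Lemma entire_comp_affine f a b : entire f -> entire (fun z => f (a * z + b)).
Proof.
move=> /entireP ef; apply/entireP => z.
by have [l fl] := ef (a * z + b); exists (l * a); exact: has_cderiv_comp_affine.
Qed.

Lemma entire_expC : entire expC.
Proof. by apply/entireP => z; exists (expC z); exact: has_cderiv_expC. Qed.

Lemma entireM f g : entire f -> entire g -> entire (fun z => f z * g z).
Proof. by move=> ef eg z; apply: (@derivableM R[i] R[i]^o); [exact: ef|exact: eg]. Qed.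

End complex_exponential.

(** * Densities, energies and the pointwise bound in Fock spaces *)

Section fock_energy.
Context {R : realType}.
Local Notation leb := (@lebesgue_measure R).
Local Notation RR := (measurableTypeR R * measurableTypeR R)%type.
Local Notation mu := ((leb \x leb)%E).
Implicit Types (f g : R[i] -> R[i]) (a b z w : R[i]) (p q : R).

Lemma norm_cstK p : 0 < p -> 2 * pi / p * (p / (2 * pi)) = 1 :> R.
Proof.
by move=> p0; rewrite -invf_div mulVf// gt_eqF// divr_gt0// mulr_gt0// pi_gt0.
Qed.

Definition density f z : R := normc (f z) * expR (- (normc z ^+ 2 / 2)).

(** The [p]-th power of the norm, up to the normalization [p / (2 pi)]. *)
Definition energy p f : \bar R := area_int (fun z => density f z `^ p).

Lemma density_ge0 f z : 0 <= density f z.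
Proof. by rewrite mulr_ge0 ?Defs.normc_ge0 ?expR_ge0. Qed.

Lemma energy_ge0 p f : (0 <= energy p f)%E.
Proof. by apply: area_int_ge0 => z; exact: powR_ge0. Qed.

Lemma density_powRE p f z :
  density f z `^ p = normc (f z) `^ p * expR (- (p * normc z ^+ 2 / 2)).
Proof.
rewrite powRM ?Defs.normc_ge0 ?expR_ge0// -expRM; congr (_ * expR _); ring.
Qed.

Lemma fock_norm_energy p f :
  fock_norm p f = (((p / (2 * pi))%:E * energy p f) `^ p^-1)%E.
Proof.
congr ((_ * _) `^ _)%E; apply: eq_integral => v _.
by rewrite density_powRE.
Qed.

Lemma plane_measurable_density f : entire f ->
  plane_measurable (fun z => density f z).
Proof.
move=> ef; have H := plane_measurableM (plane_measurable_entire ef) (plane_measurable_gauss 1).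
rewrite (_ : (fun z => _) = fun z => normc (f z) * expR (- (1 * normc z ^+ 2 / 2)))//.
by apply/funext => z; rewrite mul1r.
Qed.

Lemma plane_measurable_density_powR p f : entire f ->
  plane_measurable (fun z => density f z `^ p).
Proof. by move=> ef; exact: (plane_measurable_powR p (plane_measurable_density ef)). Qed.

Lemma fock_norm_powR p f : 0 < p ->
  (fock_norm p f `^ p)%E = ((p / (2 * pi))%:E * energy p f)%E.
Proof.
move=> p0; rewrite fock_norm_energy -poweRrM mulVf ?gt_eqF// poweRe1//.
by rewrite mule_ge0 ?energy_ge0// lee_fin divr_ge0 ?mulr_ge0 ?pi_ge0 ?ltW.
Qed.

Lemma disc_weight_cvg p :  0 < p ->
  area_int (disc_weight p n%:R) @[n --> \oo] --> ((2 * pi / p)%:E : \bar R).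
Proof.
move=> p0; rewrite -area_int_gauss//.
pose g n (v : RR) := (disc_weight p n%:R (v.1 +i* v.2))%:E.
have gE (v : RR) : limn (g ^~ v) = (expR (- (p * normc (v.1 +i* v.2) ^+ 2 / 2)))%:E.
  apply/cvg_lim => //; apply: cvg_near_cst.
  exists (Num.bound (normc (v.1 +i* v.2))) => // n /= nb.
  rewrite /g /disc_weight (_ : (_ <= n%:R) = true) ?mul1r//.
  apply: ltW; apply: lt_le_trans (archi_boundP (Defs.normc_ge0 _)) _.
  by rewrite ler_nat.
rewrite /area_int; under eq_integral do rewrite -gE.
apply: cvg_monotone_convergence => //.
- move=> n; exact: (plane_measurableE (plane_measurable_disc_weight p n%:R)).
- by move=> n v _; rewrite lee_fin disc_weight_ge0.
- move=> v _ n m nm; rewrite lee_fin ler_wpM2r ?expR_ge0// ler_nat.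
  case: (leP _ (n%:R : R)) => //= vn.
  by rewrite (le_trans vn)// ler_nat.
Qed.

Lemma density0_le_energy p f : 0 < p -> entire f ->
  ((density f 0 `^ p)%:E * (2 * pi / p)%:E <= energy p f)%E.
Proof.
move=> p0 ef; have H n : ((density f 0 `^ p)%:E * area_int (disc_weight p n.+1%:R) <= energy p f)%E.
  rewrite {1}/density normc0 expr0n /= mul0r oppr0 expR0 mulr1.
  apply: le_trans (submean_disc ef p0 (ltr0Sn _ _)) _.
  apply: le_area_int.
  - exact: (plane_measurableM (plane_measurable_powR p (plane_measurable_entire ef))
      (plane_measurable_disc_weight p _)).
  - exact: plane_measurable_density_powR.
  - move=> z; rewrite mulr_ge0 ?powR_ge0 ?disc_weight_ge0//= density_powRE.
    by rewrite ler_wpM2l ?powR_ge0// disc_weight_le.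
have C : area_int (disc_weight p n.+1%:R) @[n --> \oo] --> ((2 * pi / p)%:E : \bar R).
  rewrite (cvg_shiftS (fun n => area_int (disc_weight p n%:R))).
  exact: disc_weight_cvg.
rewrite -(cvg_lim _ C)// -limeMl//; last by apply/cvg_ex; eexists; exact: C.
apply: lime_le; last by near=> n; exact: H.
by apply: is_cvgeMl => //; apply/cvg_ex; eexists; exact: C.
Unshelve. all: by end_near.
Qed.

(** The Weyl translation of the Fock spaces: the exponential factor makes the
    density of the result the translate of the density of [f]. *)
Definition translate w f z : R[i] :=
  f (1 * z + w) * expC (- (w^*)%C * z + (- (normc w ^+ 2 / 2))%:C).

Lemma entire_translate w f : entire f -> entire (translate w f).
Proof.
move=> ef; apply: entireM; first exact: entire_comp_affine.
exact: (@entire_comp_affine R _ _ _ (@entire_expC R)).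
Qed.

Lemma density_translate w f z : density (translate w f) z = density f (z + w).
Proof.
rewrite /density /translate normcM normc_expC mul1r -mulrA -expRD; congr (_ * expR _).
by rewrite !normc_sqr; case: w z => x y [u v] /=; field.
Qed.

Lemma energy_translate p w f : entire f -> energy p (translate w f) = energy p f.
Proof.
move=> ef; rewrite /energy [RHS](@area_int_affine _ _ 1 w) ?oner_neq0//.
- rewrite normc1 expr1n mul1e; apply: eq_area_int => z.
  by rewrite density_translate mul1r.
- exact: plane_measurable_density_powR.
- by move=> z; exact: powR_ge0.
Qed.

Lemma density_le_energy p f w : 0 < p -> entire f ->
  ((density f w `^ p)%:E * (2 * pi / p)%:E <= energy p f)%E.
Proof.
move=> p0 ef; rewrite -(energy_translate p w ef) -[w in density f w]add0r -density_translate.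
exact: (density0_le_energy p0 (@entire_translate w f ef)).
Qed.

Lemma density_le_norm p f w : 0 < p -> entire f ->
  ((density f w)%:E <= fock_norm p f)%E.
Proof.
move=> p0 ef; have := density_le_energy w p0 ef.
have c0 : 0 < p / (2 * pi) :> R by rewrite divr_gt0// mulr_gt0// pi_gt0.
rewrite -(@lee_pmul2l _ (p / (2 * pi))%:E)//.
rewrite muleC -muleA -EFinM norm_cstK// mulr1 fock_norm_energy => H.
have -> : (density f w)%:E = ((density f w `^ p)%:E `^ p^-1)%E.
  by rewrite poweR_EFin -powRrM divff ?gt_eqF// powRr1// density_ge0.
apply: gt0_ler_poweR H; rewrite ?invr_ge0 ?(ltW p0)//.
- by rewrite in_itv/= lee_fin powR_ge0 leey.
- by rewrite in_itv/= leey andbT mule_ge0 ?energy_ge0// lee_fin ltW.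
Qed.

Lemma energyE p f (N : R) : 0 < p -> fock_norm p f = N%:E ->
  energy p f = (2 * pi / p * N `^ p)%:E.
Proof.
move=> p0 fN; have := fock_norm_powR f p0; rewrite fN poweR_EFin => E.
by rewrite EFinM E muleA -EFinM norm_cstK// mul1e.
Qed.

Lemma fock_norm_le p f (N : R) : 0 < p -> 0 <= N ->
  (energy p f <= (2 * pi / p * N `^ p)%:E)%E -> (fock_norm p f <= N%:E)%E.
Proof.
move=> p0 N0; have c0 : 0 < p / (2 * pi) :> R by rewrite divr_gt0// mulr_gt0// pi_gt0.
rewrite -(@lee_pmul2l _ (p / (2 * pi))%:E)// => H.
have -> : N%:E = ((N `^ p)%:E `^ p^-1)%E.
  by rewrite poweR_EFin -powRrM divff ?gt_eqF// powRr1.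
rewrite fock_norm_energy.
apply: gt0_ler_poweR; rewrite ?invr_ge0 ?(ltW p0)//.
- by rewrite in_itv/= leey andbT mule_ge0 ?energy_ge0// lee_fin ltW.
- by rewrite in_itv/= lee_fin powR_ge0 leey.
by apply: le_trans H _; rewrite -EFinM lee_fin mulrA [X in X * _]mulrC norm_cstK// mul1r.
Qed.

(** [density f ^ q <= N ^ (q - p) * density f ^ p] by the pointwise bound. *)
Lemma energy_le p q f (N : R) : 0 < p -> p <= q -> entire f ->
  (fock_norm p f <= N%:E)%E -> (energy q f <= (2 * pi / p * N `^ q)%:E)%E.
Proof.
move=> p0 pq ef fN; have q0 : 0 < q by exact: lt_le_trans pq.
have dN z : density f z <= N.
  by rewrite -lee_fin; exact: le_trans (density_le_norm z p0 ef) fN.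
have N0 : 0 <= N by exact: le_trans (density_ge0 f 0) (dN 0).
have powE x : x `^ q = x `^ (q - p) * x `^ p.
  by rewrite -powRD subrK// gt_eqF.
apply: (@le_trans _ _ ((N `^ (q - p))%:E * energy p f)%E).
  rewrite /energy -area_intZ ?powR_ge0//; last 2 first.
  - exact: plane_measurable_density_powR.
  - by move=> z; exact: powR_ge0.
  apply: le_area_int.
  - exact: plane_measurable_density_powR.
  - exact: (plane_measurableM (plane_measurable_cst _) (plane_measurable_density_powR p ef)).
  - move=> z; rewrite powR_ge0/= powE ler_wpM2r ?powR_ge0//.
    apply: ge0_ler_powR; rewrite ?subr_ge0 ?nnegrE ?density_ge0//.
have [M0 ME] : exists M, fock_norm p f = M%:E.
  exists (fine (fock_norm p f)); rewrite fineK// ge0_fin_numE ?fock_norm_ge0//.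
  by apply: le_lt_trans fN _; rewrite ltry.
rewrite (energyE p0 ME) -EFinM lee_fin powE mulrCA ler_wpM2l//.
  by rewrite mulr_ge0 ?mulr_ge0 ?pi_ge0// invr_ge0 ltW.
rewrite ler_wpM2l ?powR_ge0//; rewrite ME lee_fin in fN.
apply: ge0_ler_powR; rewrite ?nnegrE ?(ltW p0)//.
by rewrite -lee_fin -ME fock_norm_ge0.
Qed.

End fock_energy.

(** * Boundedness of weighted composition operators *)

Section weighted_composition.
Context {R : realType}.
Implicit Types (f g psi phi : R[i] -> R[i]) (a b z w : R[i]) (p q : R).

(** The reproducing kernel at [w], normalized: [exp (conj w * z - |w|^2 / 2)]. *)
Definition fock_kernel w : R[i] -> R[i] := translate (- w) (fun=> 1).

Lemma entire_cst (c : R[i]) : entire (fun=> c).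
Proof. by move=> z; exact: derivable_cst. Qed.

Lemma entire_fock_kernel w : entire (fock_kernel w).
Proof. exact: (@entire_translate R (- w) _ (@entire_cst 1)). Qed.

Lemma density_fock_kernel w z : density (fock_kernel w) z = expR (- (normc (z - w) ^+ 2 / 2)).
Proof. by rewrite density_translate /density normc1 mul1r. Qed.

Lemma fock_norm_kernel p w : 0 < p -> fock_norm p (fock_kernel w) = 1%:E.
Proof.
move=> p0; rewrite fock_norm_energy energy_translate; last exact: entire_cst.
have -> : energy p (fun=> 1) = (2 * pi / p)%:E :> \bar R.
  rewrite -area_int_gauss//; apply: eq_area_int => z.
  by rewrite density_powRE normc1 powR1 mul1r.
by rewrite -EFinM mulrC norm_cstK// poweR_EFin powR1.
Qed.

Lemma in_fock_kernel p w : 0 < p -> in_fock p (fock_kernel w).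
Proof. by move=> p0; split; [exact: entire_fock_kernel|rewrite fock_norm_kernel// ltry]. Qed.

Lemma density_wcomp psi phi f z :
  density (wcomp psi phi f) z = m_at psi phi z * density f (phi z).
Proof.
rewrite /density /m_at /wcomp normcM -!mulrA; congr (_ * _).
by rewrite [RHS]mulrCA -expRD; congr (_ * expR _); field.
Qed.

Lemma m_at_ge0 psi phi z : 0 <= m_at psi phi z.
Proof. by rewrite mulr_ge0 ?Defs.normc_ge0 ?expR_ge0. Qed.

Lemma m_at_le_norm_kernel q psi phi z : 0 < q -> entire (wcomp psi phi (fock_kernel (phi z))) ->
  ((m_at psi phi z)%:E <= fock_norm q (wcomp psi phi (fock_kernel (phi z))))%E.
Proof.
move=> q0 eW; apply: le_trans (density_le_norm z q0 eW).
by rewrite density_wcomp density_fock_kernel subrr normc0 expr0n /= mul0r oppr0 expR0 mulr1.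
Qed.

Lemma entire_wcomp psi phi a b f : (forall z, phi z = a * z + b) ->
  entire psi -> entire f -> entire (wcomp psi phi f).
Proof.
move=> phiE epsi ef.
rewrite (_ : wcomp psi phi f = fun z => psi z * f (a * z + b)).
  exact: (entireM epsi (@entire_comp_affine R f a b ef)).
by apply/funext => z; rewrite /wcomp phiE.
Qed.

(** Where [m_at] is small the change of variables [w = phi z] bounds the energy of
    [W f] by that of [f]; where [f \o phi] is small it is bounded by that of
    [psi]. *)
Lemma energy_wcomp_le q psi phi a b f (d e : R) :
  0 < q -> (forall z, phi z = a * z + b) -> a != 0 -> entire psi -> entire f ->
  0 <= d -> 0 <= e ->
  (forall z, m_at psi phi z <= d \/ normc (f (phi z)) <= e) ->
  (energy q (wcomp psi phi f) <=
   (d `^ q / normc a ^+ 2)%:E * energy q f + (e `^ q)%:E * energy q psi)%E.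
Proof.
move=> q0 phiE a0 epsi ef d0 e0 H.
have na : normc a != 0 by rewrite normc_eq0.
have mf := plane_measurable_density_powR q ef.
have mpsi := plane_measurable_density_powR q epsi.
have mfphi := plane_measurable_affine a b mf.
have p0 g z : 0 <= density g z `^ q by exact: powR_ge0.
have -> : energy q f = ((normc a ^+ 2)%:E *
    area_int (fun z => density f (a * z + b) `^ q)%R)%E.
  exact: (area_int_affine b a0 mf (p0 f)).
rewrite muleA -EFinM divfK ?expf_neq0//.
rewrite -(area_intZ (powR_ge0 _ _) mfphi (fun z => p0 f _)).
rewrite -(area_intZ (powR_ge0 e q) mpsi (p0 psi)).
have m1 := plane_measurableM (plane_measurable_cst (d `^ q)) mfphi.
have m2 := plane_measurableM (plane_measurable_cst (e `^ q)) mpsi.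
have t1 z : 0 <= d `^ q * density f (a * z + b) `^ q by rewrite mulr_ge0 ?powR_ge0.
have t2 z : 0 <= e `^ q * density psi z `^ q by rewrite mulr_ge0 ?powR_ge0.
rewrite -(area_intD m1 m2 t1 t2).
apply: le_area_int.
- exact: (plane_measurable_density_powR q (entire_wcomp phiE epsi ef)).
- exact: (plane_measurableD m1 m2).
have mono x y : 0 <= x -> x <= y -> x `^ q <= y `^ q.
  by move=> x0 xy; rewrite ge0_ler_powR ?nnegrE ?(ltW q0)// (le_trans x0).
move=> z; rewrite p0/=; case: (H z) => Hz.
  rewrite -[leLHS]addr0; apply: lerD; last exact: t2.
  rewrite density_wcomp -phiE -(powRM _ d0 (density_ge0 f _)).
  apply: mono; first exact: mulr_ge0 (m_at_ge0 _ _ _) (density_ge0 _ _).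
  by rewrite ler_wpM2r ?density_ge0.
rewrite -[leLHS]add0r; apply: lerD; first exact: t1.
rewrite -(powRM _ e0 (density_ge0 psi z)).
apply: mono; first exact: density_ge0.
rewrite /density /wcomp normcM mulrA [X in X * _]mulrC.
by rewrite ler_wpM2r ?expR_ge0// ler_wpM2r ?Defs.normc_ge0.
Qed.

Lemma fock_norm_wcomp_le p q psi phi a b f (m N : R) :
  0 < p -> p <= q -> (forall z, phi z = a * z + b) -> a != 0 -> entire psi ->
  entire f -> (forall z, m_at psi phi z <= m) -> (fock_norm p f <= N%:E)%E ->
  (fock_norm q (wcomp psi phi f) <=
    ((q / (p * normc a ^+ 2)) `^ q^-1 * m * N)%:E)%E.
Proof.
move=> p0 pq phiE a0 epsi ef mm fN.
have q0 : 0 < q by exact: lt_le_trans pq.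
have m0 : 0 <= m by exact: le_trans (m_at_ge0 psi phi 0) (mm 0).
have N0 : 0 <= N by rewrite -lee_fin; apply: le_trans fN; exact: fock_norm_ge0.
have na : 0 < normc a by rewrite lt_neqAle eq_sym normc_eq0 a0 Defs.normc_ge0.
have c0 : 0 <= q / (p * normc a ^+ 2) by rewrite divr_ge0 ?mulr_ge0 ?exprn_ge0 ?ltW.
apply: fock_norm_le => //; first by rewrite !mulr_ge0 ?powR_ge0.
apply: le_trans (energy_wcomp_le q0 phiE a0 epsi ef m0 (lexx 0) _) _.
  by move=> z; left.
rewrite powR0 ?gt_eqF// mul0e adde0.
apply: le_trans (lee_wpmul2l _ (energy_le p0 pq ef fN)) _.
  by rewrite lee_fin divr_ge0 ?powR_ge0 ?exprn_ge0// ltW.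
rewrite -EFinM lee_fin powRM ?mulr_ge0 ?powR_ge0// powRM ?powR_ge0//.
rewrite -powRrM mulVf ?gt_eqF// powRr1// le_eqVlt; apply/orP; left; apply/eqP.
move: (pi : R) (m `^ q) (N `^ q) => x mq Nq.
by field; rewrite !gt_eqF.
Qed.

Lemma m_sup_leP psi phi (m : R) :
  reflect (forall z, m_at psi phi z <= m) (m_sup psi phi <= m%:E)%E.
Proof.
apply: (iffP idP) => [H z|H].
  by rewrite -lee_fin; apply: le_trans H; apply: ereal_sup_ubound; exists z.
by apply: ge_ereal_sup => _ [z _ <-]; rewrite lee_fin.
Qed.

Lemma m_sup_ge0 psi phi : (0 <= m_sup psi phi)%E.
Proof.
apply: (@le_trans _ _ (m_at psi phi 0)%:E); first by rewrite lee_fin m_at_ge0.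
by apply: ereal_sup_ubound; exists 0.
Qed.

Lemma m_sup_le_op_norm p q psi phi a b : 0 < p -> 0 < q ->
  (forall z, phi z = a * z + b) -> entire psi ->
  (m_sup psi phi <= op_norm p q (wcomp psi phi))%E.
Proof.
move=> p0 q0 phiE epsi; apply: ge_ereal_sup => _ [z _ <-] /=.
have eW := entire_wcomp phiE epsi (@entire_fock_kernel (phi z)).
apply: le_trans (m_at_le_norm_kernel q0 eW) _.
apply: ereal_sup_ubound; exists (fock_kernel (phi z)); last by [].
by split; [exact: in_fock_kernel|rewrite fock_norm_kernel].
Qed.

Lemma op_norm_le p q psi phi a b : 0 < p -> p <= q ->
  (forall z, phi z = a * z + b) -> a != 0 -> entire psi ->
  (op_norm p q (wcomp psi phi) <=
    ((q / (p * normc a ^+ 2)) `^ q^-1)%:E * m_sup psi phi)%E.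
Proof.
move=> p0 pq phiE a0 epsi; have q0 : 0 < q by exact: lt_le_trans pq.
have na : 0 < normc a by rewrite lt_neqAle eq_sym normc_eq0 a0 Defs.normc_ge0.
have c0 : 0 < (q / (p * normc a ^+ 2)) `^ q^-1.
  by rewrite powR_gt0// divr_gt0// mulr_gt0// exprn_gt0.
have [->|mfin] := eqVneq (m_sup psi phi) +oo%E.
  by rewrite gt0_muley ?leey// lte_fin.
have mE : m_sup psi phi = (fine (m_sup psi phi))%:E.
  by rewrite fineK// ge0_fin_numE ?m_sup_ge0// ltey.
have /m_sup_leP mm : (m_sup psi phi <= (fine (m_sup psi phi))%:E)%E by rewrite -mE.
apply: ge_ereal_sup => _ [f [[ef _] fN] <-].
apply: le_trans (fock_norm_wcomp_le p0 pq phiE a0 epsi ef mm fN) _.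
by rewrite mulr1 EFinM -mE.
Qed.

Lemma in_fock_wcomp p q psi phi a b f : 0 < p -> p <= q ->
  (forall z, phi z = a * z + b) -> a != 0 -> entire psi ->
  (m_sup psi phi < +oo)%E -> in_fock p f -> in_fock q (wcomp psi phi f).
Proof.
move=> p0 pq phiE a0 epsi mfin [ef fp]; split; first exact: (entire_wcomp phiE).
have mE : m_sup psi phi = (fine (m_sup psi phi))%:E.
  by rewrite fineK// ge0_fin_numE ?m_sup_ge0.
have /m_sup_leP mm : (m_sup psi phi <= (fine (m_sup psi phi))%:E)%E by rewrite -mE.
have fE : fock_norm p f = (fine (fock_norm p f))%:E.
  by rewrite fineK// ge0_fin_numE ?fock_norm_ge0.
have fN : (fock_norm p f <= (fine (fock_norm p f))%:E)%E by rewrite -fE.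
by apply: le_lt_trans (fock_norm_wcomp_le p0 pq phiE a0 epsi ef mm fN) _; rewrite ltry.
Qed.

Theorem bounded_wcompP p q psi phi a b : 0 < p -> p <= q ->
  (forall z, phi z = a * z + b) -> a != 0 -> entire psi ->
  bounded_op p q (wcomp psi phi) <-> (m_sup psi phi < +oo)%E.
Proof.
move=> p0 pq phiE a0 epsi; have q0 : 0 < q by exact: lt_le_trans pq.
split => [[_ bn]|mfin].
  by apply: le_lt_trans bn; exact: m_sup_le_op_norm phiE epsi.
split => [f|]; first exact: in_fock_wcomp.
apply: le_lt_trans (op_norm_le p0 pq phiE a0 epsi) _.
rewrite lte_mul_pinfty ?lee_fin ?powR_ge0//.
Qed.

End weighted_composition.

(** * Compactness forces [m_at] to vanish at infinity *)

Section compact_necessary.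
Context {R : realType}.
Implicit Types (psi phi : R[i] -> R[i]) (a b z w : R[i]).

Lemma cvg_complex_inftyP (F : R[i] -> R) : (forall z, 0 <= F z) ->
  F z @[z --> complex_infty] --> (0 : R) <->
  forall e, 0 < e -> exists M : R, forall z, M < normc z -> F z < e.
Proof.
move=> F0; split=> [H e e0|H U /nbhs_ballP[e /= e0 eU]].
  have [|M _ MP] := H (ball (0 : R) e); first exact: nbhsx_ballx.
  exists M => z /MP; rewrite /= /ball/= sub0r normrN; apply: le_lt_trans.
  exact: ler_norm.
have [M MP] := H e e0; exists M => // z /MP Fz; apply: eU.
by rewrite /ball/= sub0r normrN ger0_norm.
Qed.

Lemma fock_norm_fineK (q : {posnum R}) (f g : fock q) :
  (fine (fock_norm q%:num (f \- g)))%:E = fock_norm q%:num (f \- g).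
Proof.
rewrite fineK// ge0_fin_numE ?fock_norm_ge0//.
by have [] := in_fockB (ltac:(by []) : 0 < q%:num) (fockP f) (fockP g).
Qed.

(** The distance is the norm or its [q]-th power; either way small distances and
    small norms mean the same. *)
Lemma fock_dist_lt_norm (q : {posnum R}) (e : R) : 0 < e ->
  exists2 d, 0 < d & forall f g : fock q, ball f d g ->
    (fock_norm q%:num (f \- g)%R <= e%:E)%E.
Proof.
move=> e0; have q0 : 0 < q%:num by [].
exists (if 1 <= q%:num then e else e `^ q%:num).
  by case: ifP => // _; exact: powR_gt0.
move=> f g; rewrite ballEmdist/= => H; rewrite -fock_norm_fineK lee_fin.
have {H} : fock_dist f g < if 1 <= q%:num then e else e `^ q%:num by exact: H.
have N0 : 0 <= fine (fock_norm q%:num (f \- g)) by apply: fine_ge0; exact: fock_norm_ge0.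
rewrite /fock_dist; case: ifP => _ H; first exact: ltW.
rewrite leNgt; apply/negP => eN; move: H; rewrite ltNge => /negP; apply.
by apply: ge0_ler_powR; rewrite ?nnegrE ?(ltW q0) ?(ltW e0) ?(ltW eN).
Qed.

Lemma norm_lt_fock_dist (q : {posnum R}) (d : R) : 0 < d ->
  exists2 e, 0 < e & forall f g : fock q,
    (fock_norm q%:num (f \- g)%R <= e%:E)%E -> ball f d g.
Proof.
move=> d0; have q0 : 0 < q%:num by [].
have d20 : 0 < d / 2 by rewrite divr_gt0.
exists (if 1 <= q%:num then d / 2 else (d / 2) `^ q%:num^-1).
  by case: ifP => // _; exact: powR_gt0.
move=> f g; rewrite -fock_norm_fineK lee_fin ballEmdist/= => H.
suff : fock_dist f g <= d / 2.
  by move=> h; apply: le_lt_trans h _; rewrite ltr_pdivrMr// ltr_pMr// ltr1n.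
have N0 : 0 <= fine (fock_norm q%:num (f \- g)) by apply: fine_ge0; exact: fock_norm_ge0.
move: H; rewrite /fock_dist; case: ifP => // _ H.
have -> : d / 2 = ((d / 2) `^ q%:num^-1) `^ q%:num.
  by rewrite -powRrM mulVf ?gt_eqF// powRr1// ltW.
by apply: ge0_ler_powR; rewrite ?nnegrE ?powR_ge0 ?(ltW q0).
Qed.

Lemma kernel_density_small a b phi (u : R[i]) (c e : R) : (forall z, phi z = a * z + b) ->
  0 < normc a -> 0 <= c -> 0 < e ->
  exists M : R, forall z, M < normc z -> c * density (fock_kernel (phi z)) (phi u) <= e.
Proof.
move=> phiE a0 c0 e0; have a20 : 0 < normc a ^+ 2 by rewrite exprn_gt0.
pose s := 1 + 2 * c / (e * normc a ^+ 2).
have s1 : 1 <= s by rewrite lerDl; apply: divr_ge0; apply: mulr_ge0 => //; exact: ltW.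
exists (normc u + s) => z zM; rewrite density_fock_kernel !phiE.
have -> : a * u + b - (a * z + b) = a * (u - z) by ring.
rewrite normcM exprMn.
have sz : s <= normc (u - z).
  by have := le_normcD (z - u) u; rewrite subrK normcB; lra.
pose t := normc a ^+ 2 * normc (u - z) ^+ 2 / 2.
have ct : c <= e * t.
  have -> : c = e * (normc a ^+ 2 * (s - 1) / 2).
    by rewrite /s; field; rewrite !gt_eqF.
  rewrite ler_wpM2l ?(ltW e0)// ler_wpM2r// ler_wpM2l ?(ltW a20)//.
  apply: (@le_trans _ _ s); first by rewrite gerBl.
  apply: (@le_trans _ _ (normc (u - z))) => //; rewrite expr2 ler_peMr ?Defs.normc_ge0//.
  exact: le_trans s1 sz.
have t0 : 0 <= t by apply: divr_ge0 => //; apply: mulr_ge0; exact: sqr_ge0.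
rewrite -/t expRN ler_pdivrMr ?expR_gt0//.
apply: le_trans ct _; rewrite ler_wpM2l ?(ltW e0)//.
by apply: le_trans (expR_ge1Dx t); rewrite lerDr.
Qed.

(** The images of the normalized kernels centred at [phi z] tend pointwise to [0]
    as [z] tends to infinity, while their norms dominate [m_at psi phi z]. *)
Lemma compact_wcomp_m_at (p q : {posnum R}) psi phi a b :
  (forall z, phi z = a * z + b) -> 0 < normc a -> entire psi ->
  compact_op p q (wcomp psi phi) ->
  m_at psi phi z @[z --> complex_infty] --> (0 : R).
Proof.
move=> phiE a0 epsi [Wq Wc].
have [p0 q0] : 0 < p%:num /\ 0 < q%:num by [].
apply/(cvg_complex_inftyP (m_at_ge0 psi phi)) => e e0.
apply: contrapT => /forallNP H.
have {}H M : exists z, M < normc z /\ e <= m_at psi phi z.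
  have /existsNP[z /not_implyP[zM /negP]] := H M; rewrite -leNgt => ze.
  by exists z.
pose K z : fock p := Fock (in_fock_kernel (phi z) p0).
pose S : set (fock p) := [set f | (fock_norm p%:num f <= 1%:E)%E].
have KS z : S (K z) by rewrite /S /= fock_norm_kernel.
have Sb : exists M : R, forall f : fock p, S f -> (fock_norm p%:num f <= M%:E)%E by exists 1.
have := Wc S Sb.
rewrite precompactE; set X := [set g | _] => cX.
pose A (M : R) : set (fock q) := [set g | exists z, [/\ M < normc z, e <= m_at psi phi z
  & g = wcomp psi phi (K z) :> (R[i] -> R[i])]].
have AX M : A M `<=` closure X.
  move=> g [z [_ _ gE]]; apply: subset_closure; exists (K z) => //.
have A0 M : A M !=set0.
  have [z [zM ze]] := H M.
  by exists (Fock (Wq _ (fockP (K z)))), z.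
(* a cluster point of the images of the kernels [K z] as [z] tends to infinity *)
pose G := filter_from setT A.
have GF : ProperFilter G.
  apply: filter_from_proper; last by move=> M _; exact: A0.
  apply: filter_from_filter; first by exists 0.
  move=> M N _ _; exists (Num.max M N) => // g [z [zM ze gE]].
  rewrite gt_max in zM; case/andP: zM => zM zN.
  by split; exists z.
have GX : G (closure X) by exists 0 => //; exact: AX.
have [g [_ gcl]] := cX G GF GX.
have near_g M (d : R) : 0 < d -> exists z, [/\ M < normc z, e <= m_at psi phi z &
   forall u, normc (g u - wcomp psi phi (fock_kernel (phi z)) u) * expR (- (normc u ^+ 2 / 2)) <= d].
  move=> d0; have [r r0 rP] := fock_dist_lt_norm q d0.
  have GM : G (A M) by exists M.
  have [h [[z [zM ze hE]] gh]] := gcl _ _ GM (nbhsx_ballx g r r0).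
  exists z; split => // u; have := rP _ _ gh; rewrite hE => gN.
  rewrite -lee_fin; apply: le_trans gN.
  have eB : entire (g \- wcomp psi phi (K z)).
    by apply: entireB; [have [] := fockP g|have [] := Wq _ (fockP (K z))].
  exact: (density_le_norm u q0 eB).
have g0 u : g u = 0.
  apply: eq0_normc; apply/eqP; rewrite eq_le Defs.normc_ge0 andbT.
  have x0 : 0 < expR (- (normc u ^+ 2 / 2)) by exact: expR_gt0.
  rewrite -(pmulr_lle0 _ x0); apply/ler_addgt0Pl => d d0; rewrite addr0.
  have d20 : 0 < d / 2 by rewrite divr_gt0.
  have [M MP] := kernel_density_small u phiE a0 (m_at_ge0 psi phi u) d20.
  have [z [zM _ zP]] := near_g M (d / 2) d20.
  have h1 := zP u; have h2 := MP z zM; rewrite -density_wcomp /density in h2.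
  apply: le_trans (_ : d / 2 + d / 2 <= _); last by rewrite -splitr.
  apply: le_trans (lerD h1 h2); rewrite -mulrDl ler_wpM2r ?(ltW x0)//.
  by apply: le_trans (le_normcD _ _); rewrite subrK.
have [z [_ ze zP]] := near_g 0 (e / 2) (divr_gt0 e0 (ltr0Sn _ 1)).
have := zP z; rewrite g0 sub0r normcN -/(density _ _) density_wcomp density_fock_kernel.
rewrite subrr normc0 expr0n /= mul0r oppr0 expR0 mulr1; lra.
Qed.

End compact_necessary.

(** * Cauchy estimates and limits along ultrafilters *)

Section normal_family.
Context {R : realType}.
Implicit Types (f g psi phi : R[i] -> R[i]) (a b z w h l : R[i]).

(** Cauchy estimates in the form that survives pointwise limits: the constants
    depend on a bound of [f] only. *)
Lemma entire_quadratic_approx f z (K : R) : entire f ->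
  (forall h, normc h <= 2 -> normc (f (z + h)) <= K) ->
  exists2 l, normc l <= 8 * K & forall h, normc h <= 2^-1 ->
    normc (f (z + h) - f z - l * h) <= 16 * K * normc h ^+ 2.
Proof.
move=> ef fK; pose g h := f (1 * h + z).
have eg : entire g := @entire_comp_affine R f 1 z ef.
have gK h : normc h <= 2 * 1 -> normc (g h) <= K.
  by rewrite mulr1 /g mul1r addrC; exact: fK.
have K0 : 0 <= K.
  by apply: le_trans (Defs.normc_ge0 (f (z + 0))) (fK _ _); rewrite normc0.
have [a [aK aP]] := taylor_approx eg ltr01 gK.
have a0 : a 0%N = f z.
  have := aP 0 1%N; rewrite normc0 => /(_ ltr01).
  rewrite big_ord1 expr0 mulr1 mul0r expr1 mulr0 mul0r /g mulr0 add0r => H.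
  by apply/esym/eqP; rewrite -subr_eq0; apply/eqP/eq0_normc/eqP; rewrite eq_le H Defs.normc_ge0.
exists (a 1%N); first by have := aK 1%N; rewrite expr1n divr1.
move=> h h2; have h1 : normc h < 1 by apply: le_lt_trans h2 _; rewrite invf_lt1// ltr1n.
have := aP h 2%N h1; rewrite !big_ord_recl big_ord0 /= expr0 mulr1 addr0 a0 expr1.
rewrite /g mul1r (addrC h) opprD addrA => /le_trans; apply.
rewrite divr1 mul1r.
rewrite (_ : 16 * K * _ = 8 * K * normc h ^+ 2 * 2); last by ring.
have K8 : 0 <= 8 * K * normc h ^+ 2.
  by apply: mulr_ge0; [rewrite mulr_ge0|exact: sqr_ge0].
rewrite ler_wpM2l// -[leRHS]invrK lef_pV2 ?posrE ?invr_gt0 ?subr_gt0//.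
by rewrite lerBrDr; lra.
Qed.

(** Bolzano-Weierstrass for ultrafilters, which spares the extraction of
    subsequences. *)
Lemma ultra_bounded_cvg (T : Type) (U : set_system T) (k : T -> R) (C : R) :
  UltraFilter U -> (forall t, `|k t| <= C) ->
  exists x, forall e, 0 < e -> U [set t | `|k t - x| < e].
Proof.
move=> UU kC.
have kU : ProperFilter (k @ U) by apply: fmap_proper_filter.
have seg : U (k @^-1` `[- C, C]%classic).
  by apply: filterS (@filterT _ U _) => t _; rewrite /= in_itv/= -ler_norml kC.
have [x [_ xcl]] := @segment_compact R (- C) C _ kU seg.
exists x => e e0; have [//|Un] := in_ultra_setVsetC [set t | `|k t - x| < e] UU.
have Un' : U (k @^-1` (~` ball x e)).
  apply: filterS Un => t /= tn xt; apply: tn; rewrite distrC; exact: xt.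
by have [y []] := xcl _ _ Un' (nbhsx_ballx x e e0).
Qed.

Lemma ultra_bounded_ccvg (T : Type) (U : set_system T) (k : T -> R[i]) (C : R) :
  UltraFilter U -> (forall t, normc (k t) <= C) ->
  exists2 c, normc c <= C & forall e, 0 < e -> U [set t | normc (k t - c) < e].
Proof.
move=> UU kC.
have [x xP] := ultra_bounded_cvg (k := fun t => complex.Re (k t)) UU
  (fun t => le_trans (normr_Re_le _) (kC t)).
have [y yP] := ultra_bounded_cvg (k := fun t => complex.Im (k t)) UU
  (fun t => le_trans (normr_Im_le _) (kC t)).
have P e : 0 < e -> U [set t | normc (k t - (x +i* y)) < e].
  move=> e0; have e2 : 0 < e / 2 by rewrite divr_gt0.
  apply: filterS (filterI (xP _ e2) (yP _ e2)) => t [/= h1 h2].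
  rewrite [ltRHS]splitr; apply: le_lt_trans (ltrD h1 h2).
  by case: (k t) => u v; exact: (normc_leD (u - x) (v - y)).
exists (x +i* y) => //; apply/ler_addgt0Pl => e /P /filter_ex[t te].
rewrite [leRHS]addrC; apply: le_trans (lerD (kC t) (ltW te)); rewrite (normcB (k t)).
by apply: le_trans (le_normcD _ _); rewrite subrKC.
Qed.

Lemma limn_einf_le (u : (\bar R)^nat) (c : \bar R) : (forall n, (u n <= c)%E) ->
  (limn_einf u <= c)%E.
Proof.
move=> uc; rewrite limn_einf_lim; apply: lime_le; first exact: is_cvg_einfs.
near=> n; apply: le_trans (uc n); apply: ereal_inf_lbound.
by exists n => //=.
Unshelve. all: by end_near.
Qed.

(** Fatou's lemma for the energy. *)
Lemma energy_lim_le p (F : R[i] -> R[i]) (f : nat -> R[i] -> R[i]) (c : \bar R) :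
  0 < p -> (forall n, entire (f n)) -> (forall n, (energy p (f n) <= c)%E) ->
  (forall z, normc (f n z) @[n --> \oo] --> normc (F z)) -> (energy p F <= c)%E.
Proof.
move=> p0 ef fc fF.
have := @fatou _ _ R (@lebesgue_measure R \x @lebesgue_measure R)%E setT measurableT
  (fun n v => (density (f n) (v.1 +i* v.2) `^ p)%:E)
  (fun n => plane_measurableE (plane_measurable_density_powR p (ef n)))
  (fun n v _ => powR_ge0 _ _).
have -> : (fun v : R * R => limn_einf (fun n => (density (f n) (v.1 +i* v.2) `^ p)%:E)) =
    (fun v => (density F (v.1 +i* v.2) `^ p)%:E).
  apply/funext => v.
  have H : (density (f n) (v.1 +i* v.2) `^ p)%:E @[n --> \oo] -->
      ((density F (v.1 +i* v.2) `^ p)%:E : \bar R).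
    apply: cvg_EFin; first by near=> n.
    apply: cvg_powR => //; first by move=> n; exact: density_ge0.
    by apply: cvgM; [exact: fF|exact: cvg_cst].
  by rewrite (cvg_limn_einf_sup H).1.
move=> /le_trans; apply; apply: limn_einf_le => n; exact: fc.
Unshelve. all: by end_near.
Qed.

End normal_family.

(** * Montel's theorem in Fock spaces *)

Section montel.
Context {R : realType}.
Implicit Types (g psi phi : R[i] -> R[i]) (a b z w h l : R[i]).

Lemma normc_le_growth p f (M : R) z : 0 < p -> entire f ->
  (fock_norm p f <= M%:E)%E -> normc (f z) <= M * expR (normc z ^+ 2 / 2).
Proof.
move=> p0 ef fM; have := le_trans (density_le_norm z p0 ef) fM.
by rewrite lee_fin /density expRN ler_pdivrMr ?expR_gt0.
Qed.

(** Bounds on the disc of radius [r + 2] every function of norm at most [M]. *)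
Definition growth (M r : R) : R := M * expR ((r + 2) ^+ 2 / 2).

Lemma normc_le_near_growth p f (M r : R) z h : 0 < p -> entire f ->
  (fock_norm p f <= M%:E)%E -> normc z <= r -> normc h <= 2 ->
  normc (f (z + h)) <= growth M r.
Proof.
move=> p0 ef fM zr h2; apply: le_trans (normc_le_growth (z + h) p0 ef fM) _.
have M0 : 0 <= M by rewrite -lee_fin; apply: le_trans fM; exact: fock_norm_ge0.
have zh : normc (z + h) <= r + 2 by apply: le_trans (le_normcD _ _) _; exact: lerD.
rewrite ler_wpM2l// ler_expR ler_wpM2r// lerXn2r ?nnegrE ?Defs.normc_ge0//.
exact: le_trans (Defs.normc_ge0 _) zh.
Qed.

(** Montel's theorem for a norm-bounded family along an ultrafilter: the
    pointwise limit inherits the quadratic approximation with the same constants,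
    and the resulting equicontinuity makes the convergence locally uniform. *)
Lemma ultra_normal_family (T : Type) (U : set_system T) (p M : R)
    (f : T -> R[i] -> R[i]) : UltraFilter U -> 0 < p ->
  (forall t, entire (f t)) -> (forall t, (fock_norm p (f t) <= M%:E)%E) ->
  exists F : R[i] -> R[i],
  [/\ entire F, (energy p F <= (2 * pi / p * M `^ p)%:E)%E &
    forall r e, 0 < e -> U [set t | forall z, normc z <= r -> normc (f t z - F z) <= e]].
Proof.
move=> UU p0 ef fM; have M0 : 0 <= M.
  have [t _] := filter_ex (@filterT _ U _).
  by rewrite -lee_fin; apply: le_trans (fM t); exact: fock_norm_ge0.
have pt z : exists c, forall e, 0 < e -> U [set t | normc (f t z - c) < e].
  have [c _ cP] := ultra_bounded_ccvg (k := fun t => f t z) UU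
    (fun t => normc_le_growth z p0 (@ef t) (fM t)).
  by exists c.
have [F FP] := choice pt.
have quad z : exists2 l, normc l <= 8 * growth M (normc z) & forall h, normc h <= 2^-1 ->
    normc (F (z + h) - F z - l * h) <= 16 * growth M (normc z) * normc h ^+ 2.
  have ql t : exists l, normc l <= 8 * growth M (normc z) /\ forall h, normc h <= 2^-1 ->
      normc (f t (z + h) - f t z - l * h) <= 16 * growth M (normc z) * normc h ^+ 2.
    have [l l1 l2] := entire_quadratic_approx (@ef t)
      (fun h => normc_le_near_growth (h := h) p0 (@ef t) (fM t) (lexx (normc z))).
    by exists l.
  have [l lP] := choice ql.
  have [c c8 cP] := ultra_bounded_ccvg (k := l) UU (fun t => (lP t).1).
  exists c => // h h2; apply/ler_addgt0Pl => e e0.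
  have e3 : 0 < e / 3 by rewrite divr_gt0.
  have [t [[/= t1 t2] t3]] := filter_ex (filterI (filterI (FP (z + h) _ e3) (FP z _ e3)) (cP _ e3)).
  rewrite (_ : F (z + h) - F z - c * h = (f t (z + h) - f t z - l t * h) +
    (- (f t (z + h) - F (z + h)) + ((f t z - F z) + (l t - c) * h))); last by ring.
  apply: le_trans (le_normcD _ _) _; rewrite addrC; apply: lerD; last exact: (lP t).2.
  apply: le_trans (le_normcD _ _) _; rewrite normcN.
  rewrite (_ : e = e / 3 + (e / 3 + e / 3)); last by field.
  apply: lerD; first exact: ltW.
  apply: le_trans (le_normcD _ _) _; apply: lerD; first exact: ltW.
  rewrite normcM -[leRHS]mulr1; apply: ler_pM; rewrite ?Defs.normc_ge0 ?ltW//.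
  by apply: le_lt_trans h2 _; rewrite invf_lt1// ltr1n.
have eF : entire F.
  apply/entireP => z; have [l _ lP] := quad z; exists l => e e0.
  have G0 : 0 <= growth M (normc z) by rewrite mulr_ge0// expR_ge0.
  pose L := 16 * growth M (normc z) + 1.
  have L0 : 0 < L by rewrite ltr_wpDl// mulr_ge0.
  exists (Num.min 2^-1 (e / L)); first by rewrite lt_min invr_gt0 ltr0n divr_gt0.
  move=> h; rewrite lt_min => /andP[h1 h2].
  apply: le_trans (lP h (ltW h1)) _.
  rewrite expr2 mulrA ler_wpM2r ?Defs.normc_ge0//.
  apply: (@le_trans _ _ (L * normc h)).
    by rewrite ler_wpM2r ?Defs.normc_ge0// lerDl.
  by rewrite mulrC -ler_pdivlMr// ltW.
have lip r g z h : 0 <= r -> (exists2 l, normc l <= 8 * growth M (normc z) &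
    forall h, normc h <= 2^-1 ->
    normc (g (z + h) - g z - l * h) <= 16 * growth M (normc z) * normc h ^+ 2) ->
    normc z <= r -> normc h <= 2^-1 ->
    normc (g (z + h) - g z) <= 16 * growth M r * normc h.
  move=> r0 [l l8 lP] zr h2.
  have Gr : growth M (normc z) <= growth M r.
    rewrite ler_wpM2l// ler_expR ler_wpM2r// lerXn2r ?nnegrE ?addr_ge0 ?Defs.normc_ge0//.
    by rewrite lerD2r.
  have G0 : 0 <= growth M (normc z) by rewrite mulr_ge0// expR_ge0.
  rewrite -(subrK (l * h) (g (z + h) - g z)); apply: le_trans (le_normcD _ _) _.
  apply: le_trans (lerD (lP _ h2) (lexx _)) _; rewrite normcM.
  apply: le_trans (_ : 16 * growth M (normc z) * normc h <= _); last first.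
    by rewrite ler_wpM2r ?Defs.normc_ge0// ler_wpM2l.
  rewrite expr2 mulrA -mulrDl ler_wpM2r ?Defs.normc_ge0//.
  have : 16 * growth M (normc z) * normc h <= 16 * growth M (normc z) * 2^-1.
    by rewrite ler_wpM2l// mulr_ge0.
  lra.
have quadf t z : exists2 l, normc l <= 8 * growth M (normc z) & forall h, normc h <= 2^-1 ->
    normc (f t (z + h) - f t z - l * h) <= 16 * growth M (normc z) * normc h ^+ 2.
  exact: (entire_quadratic_approx (@ef t)
    (fun h => normc_le_near_growth (h := h) p0 (@ef t) (fM t) (lexx (normc z)))).
have unif r e : 0 < e ->
    U [set t | forall z, normc z <= r -> normc (f t z - F z) <= e].
  move=> e0; set A := [set t | _]; have [//|An] := in_ultra_setVsetC A UU.
  have [rneg|r0] := ltP r 0.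
    apply: filterS (@filterT _ U _) => t _ z zr.
    by move: (le_lt_trans zr rneg); rewrite ltNge Defs.normc_ge0.
  (* were the convergence not uniform, bad points [zz t] would accumulate at [c],
     where pointwise convergence and equicontinuity exclude them *)
  have zt t : exists z, normc z <= r /\ (~ A t -> e < normc (f t z - F z)).
    have [At|/existsNP[z /not_implyP[zr /negP]]] := pselect (A t).
      by exists 0; rewrite normc0.
    by rewrite -ltNge => ze; exists z.
  have [zz zP] := choice zt.
  have [c cr cP] := ultra_bounded_ccvg (k := zz) UU (fun t => (zP t).1).
  pose L := 16 * growth M r + 1.
  have G0 : 0 <= growth M r by rewrite mulr_ge0// expR_ge0.
  have L0 : 0 < L by rewrite ltr_wpDl// mulr_ge0.
  have d0 : 0 < Num.min 2^-1 (e / (3 * L)).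
    by rewrite lt_min invr_gt0 ltr0n divr_gt0// mulr_gt0.
  have e3 : 0 < e / 3 by rewrite divr_gt0.
  have [t [[tA tc] tF]] := filter_ex (filterI (filterI An (cP _ d0)) (FP c _ e3)).
  have := (zP t).2 tA; rewrite ltNge => /negP; case.
  move: tc; rewrite /= lt_min => /andP[/ltW k1 k2].
  have Lk : 16 * growth M r * normc (zz t - c) <= e / 3.
    apply: (@le_trans _ _ (L * normc (zz t - c))).
      by rewrite ler_wpM2r ?Defs.normc_ge0// lerDl.
    rewrite mulrC -ler_pdivlMr// (_ : e / 3 / L = e / (3 * L)) ?ltW//.
    by field; rewrite gt_eqF.
  have h1 := lip r (f t) c (zz t - c) r0 (quadf t c) cr k1.
  have h2 := lip r F c (zz t - c) r0 (quad c) cr k1.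
  rewrite subrKC in h1 h2.
  rewrite (_ : f t (zz t) - F (zz t) = (f t (zz t) - f t c) +
    ((f t c - F c) - (F (zz t) - F c))); last by ring.
  apply: le_trans (le_normcD _ _) _.
  rewrite (_ : e = e / 3 + (e / 3 + e / 3)); last by field.
  apply: lerD; first exact: le_trans Lk.
  apply: le_trans (le_normcD _ _) _; rewrite normcN.
  by apply: lerD; [exact: ltW|exact: le_trans Lk].
exists F; split => //.
have sel n : exists t, forall z, normc z <= n%:R -> normc (f t z - F z) <= n.+1%:R^-1.
  have n0 : 0 < n.+1%:R^-1 :> R by rewrite invr_gt0 ltr0n.
  by have [t tP] := filter_ex (unif n%:R n.+1%:R^-1 n0); exists t.
have [s sP] := choice sel.
have bound n : (energy p (f (s n)) <= (2 * pi / p * M `^ p)%:E)%E :=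
  energy_le p0 (lexx p) (@ef (s n)) (fM (s n)).
have lim z : normc (f (s n) z) @[n --> \oo] --> normc (F z).
  apply/cvgrPdist_le => e e0; near=> n.
  apply: le_trans (ler_dist_normc _ _) _; rewrite normcB.
  apply: le_trans (sP n z _) _; first by near: n; exact: nbhs_infty_ger.
  near: n; have /cvgrPdist_le /(_ _ e0) := @cvg_harmonic R.
  by apply: filterS => n; rewrite sub0r normrN; apply: le_trans; exact: ler_norm.
exact: (energy_lim_le p0 (fun n => @ef (s n)) bound lim).
Unshelve. all: by end_near.
Qed.

End montel.

(** * Vanishing of [m_at] at infinity gives compactness *)

Section compact_sufficient.
Context {R : realType}.
Implicit Types (f g psi phi : R[i] -> R[i]) (a b z w h l : R[i]).

Lemma powRD_le (q x y : R) : 0 < q -> 0 <= x -> 0 <= y ->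
  (x + y) `^ q <= 2 `^ q * (x `^ q + y `^ q).
Proof.
move=> q0 x0 y0.
have mono u v : 0 <= u -> u <= v -> u `^ q <= v `^ q.
  by move=> u0 uv; rewrite ge0_ler_powR ?nnegrE ?(ltW q0)// (le_trans u0).
have [xy|/ltW yx] := leP x y.
  apply: (@le_trans _ _ ((2 * y) `^ q)); first by apply: mono; lra.
  by rewrite powRM// ler_wpM2l ?powR_ge0// lerDr powR_ge0.
apply: (@le_trans _ _ ((2 * x) `^ q)); first by apply: mono; lra.
by rewrite powRM// ler_wpM2l ?powR_ge0// lerDl powR_ge0.
Qed.

Lemma energyB_le q f g : 0 < q -> entire f -> entire g ->
  (energy q (f \- g)%R <= (2 `^ q)%:E * (energy q f + energy q g))%E.
Proof.
move=> q0 ef eg.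
have mf := plane_measurable_density_powR q ef.
have mg := plane_measurable_density_powR q eg.
have p0 u z : 0 <= density u z `^ q by exact: powR_ge0.
rewrite -(area_intD mf mg (p0 f) (p0 g)).
have s0 z : 0 <= density f z `^ q + density g z `^ q by rewrite addr_ge0.
rewrite -(area_intZ (powR_ge0 2 q) (plane_measurableD mf mg) s0).
apply: le_area_int.
- exact: (plane_measurable_density_powR q (entireB ef eg)).
- exact: (plane_measurableM (plane_measurable_cst _) (plane_measurableD mf mg)).
move=> z; rewrite p0/=.
apply: le_trans (powRD_le q0 (density_ge0 f z) (density_ge0 g z)).
apply: ge0_ler_powR; rewrite ?nnegrE ?(ltW q0)//; first exact: density_ge0.
  by rewrite addr_ge0// density_ge0.
rewrite /density -mulrDl ler_wpM2r ?expR_ge0//.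
by apply: le_trans (le_normcD _ _) _; rewrite normcN.
Qed.

Lemma m_sup_lty psi phi a b : (forall z, phi z = a * z + b) -> entire psi ->
  m_at psi phi z @[z --> complex_infty] --> (0 : R) -> (m_sup psi phi < +oo)%E.
Proof.
move=> phiE epsi /(cvg_complex_inftyP (m_at_ge0 psi phi)) /(_ _ ltr01)[M MP].
have [K KP] := entire_bounded_disc M epsi.
pose B := Num.max 1 (K * expR ((normc a * M + normc b) ^+ 2 / 2)).
suff /m_sup_leP H : forall z, m_at psi phi z <= B by apply: le_lt_trans H _; rewrite ltry.
move=> z; rewrite le_max; have [zM|/MP/ltW->//] := leP (normc z) M.
apply/orP; right; rewrite /m_at; apply: ler_pM; rewrite ?Defs.normc_ge0 ?expR_ge0//.
  exact: KP.
rewrite ler_expR ler_wpM2r//.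
apply: (@le_trans _ _ (normc (phi z) ^+ 2)); first by rewrite gerBl sqr_ge0.
have le1 : normc (phi z) <= normc a * M + normc b.
  rewrite phiE; apply: le_trans (le_normcD _ _) _; rewrite normcM lerD2r.
  by rewrite ler_wpM2l ?Defs.normc_ge0.
by rewrite lerXn2r ?nnegrE ?Defs.normc_ge0// (le_trans (Defs.normc_ge0 _) le1).
Qed.

(** The tail [|z| > r] contributes little because [m_at] is small there, the disc
    [|z| <= r] because the family converges uniformly on its image by [phi]. *)
Lemma m_at_compact_wcomp (p q : {posnum R}) psi phi a b : p%:num <= q%:num ->
  (forall z, phi z = a * z + b) -> a != 0 -> in_fock q%:num psi ->
  m_at psi phi z @[z --> complex_infty] --> (0 : R) ->
  compact_op p q (wcomp psi phi).
Proof.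
move=> pq phiE a0 [epsi psiq] m0.
have [p0 q0] : 0 < p%:num /\ 0 < q%:num by [].
have mfin := m_sup_lty phiE epsi m0.
have Wq f : in_fock p%:num f -> in_fock q%:num (wcomp psi phi f).
  exact: (in_fock_wcomp p0 pq phiE a0 epsi mfin).
split => // S [M0 SM0]; pose M := Num.max 0 M0.
have M_ge0 : 0 <= M by rewrite le_max lexx.
have SM (f : fock p) : S f -> (fock_norm p%:num f <= M%:E)%E.
  by move=> /SM0 /le_trans; apply; rewrite lee_fin le_max lexx orbT.
pose B : set (fock p) := [set f | (fock_norm p%:num f <= M%:E)%E].
pose Y : set (fock q) := [set g : fock q | exists2 f, B f & g = wcomp psi phi f :> (R[i] -> R[i])].
suff cY : compact Y.
  apply: (@precompact_subset _ _ Y); last exact: (compact_precompact (@metric_hausdorff _ _)).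
  by move=> g [f Sf gE]; exists f => //; exact: SM.
rewrite compact_ultra => V VU VY.
have z0 : in_fock p%:num (fun _ : R[i] => 0).
  by split; [exact: entire_cst|rewrite fock_norm0// ltry].
have sec (g : fock q) : exists f : fock p, B f /\ (Y g -> g = wcomp psi phi f :> (R[i] -> R[i])).
  have [[f Bf gE]|nY] := pselect (Y g); first by exists f.
  by exists (Fock z0); split => //; rewrite /B /= fock_norm0.
(* lift the ultrafilter on the image of the ball to the ball itself *)
have [s sP] := choice sec.
have es (g : fock q) : entire (s g) by have [] := fockP (s g).
have [F [eF EF UF]] := @ultra_normal_family R _ V p%:num M
  (fun g : fock q => s g : R[i] -> R[i]) VU p0 es (fun g : fock q => (sP g).1).
have Fp : (fock_norm p%:num F <= M%:E)%E by exact: fock_norm_le.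
have inF : in_fock p%:num F by split => //; apply: le_lt_trans Fp _; rewrite ltry.
pose G : fock q := Fock (Wq F inF).
exists G; split; first by exists (Fock inF).
move=> W /nbhs_ballP[d /= d0 dW].
have [e e0 eP] := norm_lt_fock_dist q d0.
(* split the target for the energy of [W (F - s g)] evenly between the two terms of
   [energy_wcomp_le]: [dl] for the first, [ep] for the second *)
have psiE : energy q%:num psi = (2 * pi / q%:num * fine (fock_norm q%:num psi) `^ q%:num)%:E.
  by apply: energyE => //; rewrite fineK// ge0_fin_numE ?fock_norm_ge0.
set E := (2 * pi / q%:num * _) in psiE.
have E0 : 0 <= E by rewrite -lee_fin -psiE; exact: energy_ge0.
pose C := 2 `^ q%:num * (2 * pi / p%:num * M `^ q%:num + 2 * pi / p%:num * M `^ q%:num).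
have pip : 0 <= 2 * pi / p%:num :> R.
  by apply: divr_ge0; [apply: mulr_ge0 => //; exact: pi_ge0|exact: ltW].
have C0 : 0 <= C by apply: mulr_ge0; rewrite ?powR_ge0// addr_ge0// mulr_ge0 ?powR_ge0.
have na : 0 < normc a ^+ 2.
  by rewrite exprn_gt0// lt_neqAle eq_sym normc_eq0 a0 Defs.normc_ge0.
pose target := 2 * pi / q%:num * e `^ q%:num.
have tg0 : 0 < target.
  by rewrite mulr_gt0 ?powR_gt0// divr_gt0// mulr_gt0// pi_gt0.
pose dl := (target / 2 * normc a ^+ 2 / (C + 1)) `^ q%:num^-1.
have C10 : 0 < C + 1 by rewrite ltr_wpDl.
have dlp : 0 < target / 2 * normc a ^+ 2 / (C + 1).
  by rewrite divr_gt0// mulr_gt0// divr_gt0.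
have dl0 : 0 < dl by exact: powR_gt0.
pose ep := (target / 2 / (E + 1)) `^ q%:num^-1.
have E10 : 0 < E + 1 by rewrite ltr_wpDl.
have epp : 0 < target / 2 / (E + 1) by rewrite divr_gt0// divr_gt0.
have ep0 : 0 < ep by exact: powR_gt0.
have powK x : 0 <= x -> (x `^ q%:num^-1) `^ q%:num = x.
  by move=> x0; rewrite -powRrM mulVf ?gt_eqF// powRr1.
have [r rP] := (cvg_complex_inftyP (m_at_ge0 psi phi)).1 m0 _ dl0.
apply: filterS (filterI VY (UF (normc a * r + normc b) ep ep0)) => g [Yg gF].
apply: dW; apply: eP.
have -> : (G \- g)%R = wcomp psi phi (F \- s g)%R.
  by apply/funext => z; rewrite /= ((sP g).2 Yg) /wcomp mulrBr.
have eFs : entire (F \- s g) := entireB eF (@es g).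
apply: fock_norm_le => //; first exact: ltW.
apply: le_trans (energy_wcomp_le q0 phiE a0 epsi eFs (ltW dl0) (ltW ep0) _) _.
  move=> z; have [zr|/rP/ltW] := leP (normc z) r; last by left.
  right; rewrite /= normcB; apply: gF.
  rewrite phiE; apply: le_trans (le_normcD _ _) _; rewrite normcM lerD2r.
  by rewrite ler_wpM2l ?Defs.normc_ge0.
have EFs : (energy q%:num (F \- s g)%R <= C%:E)%E.
  apply: le_trans (energyB_le q0 eF (@es g)) _.
  rewrite EFinM EFinD; apply: lee_wpmul2l; first by rewrite lee_fin powR_ge0.
  exact: leeD (energy_le p0 pq eF Fp) (energy_le p0 pq (@es g) (sP g).1).
rewrite psiE /dl /ep (powK _ (ltW dlp)) (powK _ (ltW epp)) -/target.
have k1 : 0 <= target / 2 * normc a ^+ 2 / (C + 1) / normc a ^+ 2.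
  by apply: divr_ge0; exact: ltW.
have tg2 : 0 <= target / 2 by rewrite divr_ge0// ltW.
apply: le_trans (leeD (lee_wpmul2l _ EFs) (lexx _)) _; first by rewrite lee_fin.
rewrite -!EFinM -EFinD lee_fin [leRHS]splitr.
move: (target / 2) (normc a ^+ 2) na tg2 => t A na tg2.
apply: lerD.
  rewrite (_ : _ * C = t * (C / (C + 1))); last by field; rewrite !gt_eqF.
  by rewrite ler_piMr// ler_pdivrMr// mul1r lerDl.
rewrite -mulrA (mulrC _^-1) ler_piMr//.
by rewrite ler_pdivrMr// mul1r lerDl.
Qed.

End compact_sufficient.

(** * The theorem *)

Theorem theorem3p4 (R : realType) (p q : {posnum R}) (psi phi : R[i] -> R[i])
    (a b : R[i])
    (hpq : p%:num <= q%:num)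
    (hpsi : in_fock q%:num psi)
    (hpsi0 : psi <> (fun=> 0))
    (ha0 : 0 < normc a) (ha1 : normc a <= 1)
    (hphi : forall z, phi z = a * z + b) :
  [/\ bounded_op p%:num q%:num (wcomp psi phi) <-> (m_sup psi phi < +oo)%E,
      (m_sup psi phi <= op_norm p%:num q%:num (wcomp psi phi) <=
        ((q%:num / (p%:num * normc a ^+ 2)) `^ (q%:num)^-1)%:E *
        m_sup psi phi)%E &
      compact_op p q (wcomp psi phi) <->
        m_at psi phi z @[z --> complex_infty] --> (0 : R)].
Proof.
have [p0 q0] : 0 < p%:num /\ 0 < q%:num by [].
have a0 : a != 0 by rewrite -normc_eq0 gt_eqF.
have epsi := hpsi.1; split.
- exact: bounded_wcompP hphi a0 epsi.
- apply/andP; split; first exact: m_sup_le_op_norm hphi epsi.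
  exact: op_norm_le hphi a0 epsi.
split; first exact: compact_wcomp_m_at hphi ha0 epsi.
exact: m_at_compact_wcomp hpq hphi a0 hpsi.
Qed.
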